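(* Let $\varphi$ be a holomorphic self-map of $\mathbb{D}$. If $C_\varphi$ is a Hilbert–Schmidt operator in the Dirichlet space $\mathcal{D}$, then $$\int_0^1\frac{\mathrm{cap}(E_\varphi(s))}{1-s}\,\log\frac{1}{1-s}\,ds<\infty.$$
   Context: $\mathbb{D}$ is the open unit disc in $\mathbb{C}$ and $\mathbb{T}=\partial\mathbb{D}$. The Dirichlet space $\mathcal{D}$ consists of the holomorphic functions $f$ on $\mathbb{D}$ with $\mathcal{D}(f)=\int_{\mathbb{D}}|f'(z)|^2\,dA(z)<\infty$, where $dA=dx\,dy/\pi$, with norm $\|f\|_{\mathcal{D}}^2=|f(0)|^2+\mathcal{D}(f)$. The composition operator is $C_\varphi(f)=f\circ\varphi$, $f\in\mathcal{D}$. For $s\in(0,1)$, the level set of $\varphi$ is $E_\varphi(s)=\{\zeta\in\mathbb{T}:|\varphi(\zeta)|\ge s\}$, where $\varphi(\zeta)$ denotes the boundary value $\lim_{r\to1}\varphi(r\zeta)$; for a function in $\mathcal{D}$ this limit exists for $\zeta\in\mathbb{T}$ outside a set of logarithmic capacity zero. For a Borel probability measure $\mu$ on $\mathbb{T}$ with Fourier coefficients $\widehat{\mu}(n)$, let $I_0(\mu)=\sum_{n=1}^\infty\frac{|\widehat{\mu}(n)|^2}{n}$. For a closed set $E\subset\mathbb{T}$, the logarithmic capacity is $\mathrm{cap}(E)=1/\inf\{I_0(\mu):\mu\text{ is a probability measure on }E\}$. The same notation $\mathrm{cap}$ is applied to the level sets $E_\varphi(s)$.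
   Formalization: As cap(T)=1/0 with the given I_0, the integral over (0,1) can diverge near s=0 (e.g. φ(z)=z/2); proved instead: cap(E_φ(s0)) is finite for some s0 in (0,1), and for every such s0 the integral over (s0,1) is finite; cap of a level set is the inner capacity. *)

(* Defs.v *)
From mathcomp Require Import all_boot all_order all_algebra.
From mathcomp Require Import all_classical all_reals all_analysis.
From mathcomp.real_closed Require Import complex.

Set Implicit Arguments.
Unset Strict Implicit.
Unset Printing Implicit Defensive.

Import Order.TTheory GRing.Theory Num.Theory.
Import numFieldNormedType.Exports.

Local Open Scope classical_set_scope.
Local Open Scope ring_scope.
Local Open Scope complex_scope.

(* Measures live on the real plane, with its product (= Borel) sigma-algebra,
   because R[i] itself carries no measurable structure in the library. *)
Notation plane R := (measurableTypeR R * measurableTypeR R)%type.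

Definition to_complex {R : realType} (p : plane R) : R[i] := p.1 +i* p.2.

(* The modulus as an element of R, the norm `|z| of R[i] being valued in R[i]. *)
Definition modulus {R : realType} (z : R[i]) : R := complex.Re `|z|.

Definition unit_disc (R : realType) : set R[i] := [set z | modulus z < 1].
Definition unit_circle (R : realType) : set R[i] := [set z | modulus z = 1].
Arguments unit_disc : clear implicits.
Arguments unit_circle : clear implicits.

Definition complex_integral {R : realType}
    (mu : {measure set (plane R) -> \bar R}) (D : set R[i])
    (f : R[i] -> R[i]) : R[i] :=
  (\int[mu]_(p in to_complex @^-1` D) complex.Re (f (to_complex p))) +i*
  (\int[mu]_(p in to_complex @^-1` D) complex.Im (f (to_complex p))).

Section Dirichlet_space.
Context {R : realType}.
Implicit Types f g : R[i] -> R[i].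

(* Elements of function spaces on the disc are represented by total functions
   whose values off the disc are irrelevant. *)

Definition complex_derivative f (z : R[i]) : R[i] :=
  'D_(1 : R[i]^o) (f : R[i]^o -> R[i]^o) (z : R[i]^o).

Definition holomorphic f : Prop :=
  forall z, unit_disc R z -> derivable (f : R[i]^o -> R[i]^o) (z : R[i]^o) 1.

Definition planar_lebesgue : {measure set (plane R) -> \bar R} :=
  ((@lebesgue_measure R) \x (@lebesgue_measure R))%E.

Definition dirichlet_integral f : \bar R :=
  ((pi^-1)%:E * \int[planar_lebesgue]_(p in to_complex @^-1` unit_disc R)
     ((modulus (complex_derivative f (to_complex p)) ^+ 2)%:E))%E.

Definition dirichlet_space : set (R[i] -> R[i]) :=
  [set f | holomorphic f /\ (dirichlet_integral f < +oo)%E].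

Definition dirichlet_sqnorm f : \bar R :=
  ((modulus (f 0) ^+ 2)%:E + dirichlet_integral f)%E.

Definition dirichlet_inner f g : R[i] :=
  f 0 * (g 0)^* +
  (pi^-1)%:C * complex_integral planar_lebesgue (unit_disc R)
    (fun z => complex_derivative f z * (complex_derivative g z)^*).

Definition dirichlet_onb (e : nat -> R[i] -> R[i]) : Prop :=
  [/\ forall n, dirichlet_space (e n),
      forall m n, dirichlet_inner (e m) (e n) = (m == n)%:R &
      forall f, dirichlet_space f ->
        (forall n, dirichlet_inner f (e n) = 0) ->
        forall z, unit_disc R z -> f z = 0].

Definition bounded_operator (A : (R[i] -> R[i]) -> R[i] -> R[i]) : Prop :=
  [/\ forall f, dirichlet_space f -> dirichlet_space (A f),
      forall (a : R[i]) f g, dirichlet_space f -> dirichlet_space g ->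
        forall z, unit_disc R z ->
          A (fun w => a * f w + g w) z = a * A f z + A g z &
      exists M : R, forall f, dirichlet_space f ->
        (dirichlet_sqnorm (A f) <= M%:E * dirichlet_sqnorm f)%E].

(* The Dirichlet space is separable and infinite-dimensional, so its orthonormal
   bases are the complete orthonormal sequences. *)
Definition hilbert_schmidt (A : (R[i] -> R[i]) -> R[i] -> R[i]) : Prop :=
  bounded_operator A /\
  exists2 e, dirichlet_onb e &
    (\sum_(0 <= n <oo) dirichlet_sqnorm (A (e n)) < +oo)%E.

Definition composition_operator (phi f : R[i] -> R[i]) : R[i] -> R[i] :=
  f \o phi.

End Dirichlet_space.

Section Capacity.
Context {R : realType}.

Definition fourier_coef (mu : probability (plane R) R) (n : nat) : R[i] :=
  complex_integral mu (unit_circle R) (fun z => z ^- n).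

Definition energy (mu : probability (plane R) R) : \bar R :=
  (\sum_(1 <= n <oo) (modulus (fourier_coef mu n) ^+ 2 / n%:R)%:E)%E.

Definition probability_on (E : set R[i]) : set (probability (plane R) R) :=
  [set mu | mu (to_complex @^-1` E) = 1%E].

(* The inverse in \bar R satisfies 0^-1 = +oo and +oo^-1 = 0; the latter gives
   capacity 0 to sets carrying no probability measure of finite energy, the
   former capacity +oo to the whole circle, since the energy has no term n = 0
   and vanishes at the normalised Lebesgue measure. *)
Definition capacity_closed (E : set R[i]) : \bar R :=
  ((ereal_inf [set energy mu | mu in probability_on E])^-1)%E.

(* Level sets need not be closed: the capacity is extended to arbitrary subsets
   of the circle as the inner capacity. On closed sets nothing changes, since
   [capacity_closed] is monotone. *)
Definition capacity (E : set R[i]) : \bar R :=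
  ereal_sup [set capacity_closed K | K in
    [set K | closed (K : set R[i]^o) /\ K `<=` E `&` unit_circle R]].

(* Points without a radial limit are left out. *)
Definition level_set (phi : R[i] -> R[i]) (s : R) : set R[i] :=
  [set zeta | unit_circle R zeta /\
     exists2 w : R[i]^o,
       (phi (r%:C * zeta) : R[i]^o) @[r --> (1 : R)^'-] --> w &
       s <= modulus w].

End Capacity.

(* Main.v *)
From HB Require Import structures.
Require Import Defs.
From mathcomp Require Import all_boot all_order all_algebra.
From mathcomp Require Import all_classical all_reals all_analysis.
From mathcomp.real_closed Require Import complex.
From mathcomp Require Import ring lra zify measurable_realfun.
Set Implicit Arguments.
Unset Strict Implicit.
Unset Printing Implicit Defensive.
Import Order.TTheory GRing.Theory Num.Theory.
Import numFieldNormedType.Exports.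
Local Open Scope classical_set_scope.
Local Open Scope ring_scope.

(** Write [T(s) = - ln (1 - s)] and let [J] be the integral over the disc of
    [|phi'|^2 / (1 - |phi|^2)^2] ([hyperbolic_integral]).

    The Hilbert-Schmidt condition makes [J] finite.  On the Dirichlet space the
    functional [f |-> f' w] has squared norm at least [1 / (4 (1 - |w|^2)^2)]: a
    truncated kernel polynomial shows it.  Expanding that polynomial in the
    given orthonormal basis [e] gives the same lower bound for the sum of the
    [|e_n' w|^2] ([onb_kernel]).  Taking [w = phi z], multiplying by
    [|phi' z|^2] and integrating over [z] bounds [J] by a multiple of the sum of
    the Dirichlet integrals of the [e_n \o phi] ([hyperbolic_integral_lty]).
    The expansion needs completeness of the space ([onb_derivative_cvg]), hence
    Taylor series of holomorphic functions ([taylor]): Goursat's theorem makes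
    the weighted Fourier coefficients on circles independent of the radius, and
    the Fourier series converges by Chernoff's argument ([fourier_sum_cvg]).

    The capacity of a level set is bounded by a Dirichlet integral.  Put
    [u = ln 2 - ln (1 - |phi|^2)] and, for a level [s], [W = u^2 / (T^2 + u^2)]
    with [T = T(s)].  Close to a point of the level set, on the radius, [u] is
    at least [T], so that [W] is at least [1 / 2].  Let [mu] be a probability
    measure of energy [I] on a closed part of the level set.  Integrating [W]
    against [mu] on circles close to the unit circle gives at most the mean of
    [W], plus [lambda D + I / lambda] for every positive [lambda], where [D] is
    the Dirichlet integral of [W] divided by [pi]: this pairs the Fourier
    coefficients of [W], with weight [k], with those of [mu], with weight
    [1 / k].  That the weighted coefficients are controlled on every circle by
    [D] is elementary for any differentiable [W] ([weighted_coef_le]).  Once [T]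
    is large the mean is at most [1 / 4], and [1 <= 64 D I] follows
    ([level_test]): the capacity is at most [64 D] ([capacity_level_le]).

    The gradient of [W] squares to at most a function of [T] and [u] times
    [|phi'|^2 / (1 - |phi|^2)^2].  When this function is multiplied by
    [T(s) / (1 - s)] its integral over [s] is at most [8 / 3], whatever [u] is
    ([level_kernel_integral]).  By Tonelli's theorem the integral of the theorem
    is then at most a multiple of [J], up to the levels below which [T(s)] is
    not yet large, where the monotonicity of the capacity suffices. *)

(** * The modulus and the topology of the complex field *)

Section Modulus.
Context {R : realType}.
Implicit Types x y z w : R[i].

Lemma normcE_modulus z : `|z| = (modulus z)%:C%C.
Proof. by rewrite /modulus normc_def. Qed.

Lemma modulusE z : modulus z = Num.sqrt (complex.Re z ^+ 2 + complex.Im z ^+ 2).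
Proof. by rewrite /modulus normc_def. Qed.

Lemma modulus_ge0 z : 0 <= modulus z.
Proof. by rewrite modulusE sqrtr_ge0. Qed.

Lemma modulus_sqr z : modulus z ^+ 2 = complex.Re z ^+ 2 + complex.Im z ^+ 2.
Proof. by rewrite modulusE sqr_sqrtr// addr_ge0// sqr_ge0. Qed.

Lemma modulusM z w : modulus (z * w) = modulus z * modulus w.
Proof. by apply: (@complexI R); rewrite rmorphM/= -!normcE_modulus normrM. Qed.

Lemma modulusX z n : modulus (z ^+ n) = modulus z ^+ n.
Proof. by apply: (@complexI R); rewrite rmorphXn/= -!normcE_modulus normrX. Qed.

Lemma modulusV z : modulus z^-1 = (modulus z)^-1.
Proof. by apply: (@complexI R); rewrite fmorphV/= -!normcE_modulus normfV. Qed.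

Lemma modulusN z : modulus (- z) = modulus z.
Proof. by apply: (@complexI R); rewrite -!normcE_modulus normrN. Qed.

Lemma modulusB z w : modulus (z - w) = modulus (w - z).
Proof. by rewrite -modulusN opprB. Qed.

Lemma le_modulusD z w : modulus (z + w) <= modulus z + modulus w.
Proof. by rewrite -lecR rmorphD/= -!normcE_modulus ler_normD. Qed.

Lemma modulus0 : modulus (0 : R[i]) = 0.
Proof. by apply: (@complexI R); rewrite -normcE_modulus normr0. Qed.

Lemma modulus1 : modulus (1 : R[i]) = 1.
Proof. by apply: (@complexI R); rewrite -normcE_modulus normr1. Qed.

Lemma modulus_real (a : R) : modulus a%:C%C = `|a|.
Proof. by rewrite modulusE/= expr0n addr0 sqrtr_sqr. Qed.

Lemma modulus_nat n : modulus (n%:R : R[i]) = n%:R.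
Proof.
by apply: (@complexI R); rewrite -normcE_modulus normr_nat rmorph_nat.
Qed.

Lemma modulus_eq0 z : (modulus z == 0) = (z == 0).
Proof. by rewrite -[RHS]normr_eq0 normcE_modulus -(inj_eq (@complexI R)). Qed.

Lemma modulus_conj z : modulus (z^*)%C = modulus z.
Proof. by case: z => a b; rewrite !modulusE/= sqrrN. Qed.

Lemma modulusi : modulus ('i%C : R[i]) = 1.
Proof. by rewrite modulusE/= expr0n expr1n add0r sqrtr1. Qed.

Lemma le_Re_modulus z : `|complex.Re z| <= modulus z.
Proof.
by rewrite modulusE -sqrtr_sqr ler_sqrt ?addr_ge0 ?sqr_ge0// lerDl sqr_ge0.
Qed.

Lemma le_Im_modulus z : `|complex.Im z| <= modulus z.
Proof.
by rewrite modulusE -sqrtr_sqr ler_sqrt ?addr_ge0 ?sqr_ge0// lerDr sqr_ge0.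
Qed.

Lemma modulus_le_ReIm z : modulus z <= `|complex.Re z| + `|complex.Im z|.
Proof.
rewrite modulusE -[leRHS]ger0_norm ?addr_ge0// -sqrtr_sqr ler_sqrt ?sqr_ge0//.
rewrite sqrrD !real_normK ?num_real//.
by rewrite [leRHS]addrAC lerDl mulrn_wge0// mulr_ge0.
Qed.

Lemma mulCJ z : z * (z^*)%C = ((modulus z ^+ 2)%:C)%C.
Proof. by case: z => a b; rewrite modulus_sqr/=; simpc; congr (_ +i* _)%C; ring. Qed.

Lemma le_modulus_sum (I : Type) (r : seq I) (F : I -> R[i]) :
  modulus (\sum_(i <- r) F i) <= \sum_(i <- r) modulus (F i).
Proof.
apply: (big_ind2 (fun (x : R[i]) (y : R) => modulus x <= y)); rewrite ?modulus0 //.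
by move=> x1 x2 y1 y2 h1 h2; apply: (le_trans (le_modulusD _ _)); exact: lerD.
Qed.

Lemma Re_add z w : complex.Re (z + w) = complex.Re z + complex.Re w.
Proof. by case: z w => [a b] [c d]. Qed.
Lemma Im_add z w : complex.Im (z + w) = complex.Im z + complex.Im w.
Proof. by case: z w => [a b] [c d]. Qed.
Lemma Re_opp z : complex.Re (- z) = - complex.Re z. Proof. by case: z. Qed.
Lemma Im_opp z : complex.Im (- z) = - complex.Im z. Proof. by case: z. Qed.
Lemma Re_mul z w : complex.Re (z * w) =
  complex.Re z * complex.Re w - complex.Im z * complex.Im w.
Proof. by case: z w => [a b] [c d]. Qed.
Lemma Im_mul z w : complex.Im (z * w) =
  complex.Re z * complex.Im w + complex.Im z * complex.Re w.
Proof. by case: z w => [a b] [c d]. Qed.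
Lemma Re_conjc z : complex.Re (z^*)%C = complex.Re z. Proof. by case: z. Qed.
Lemma Im_conjc z : complex.Im (z^*)%C = - complex.Im z. Proof. by case: z. Qed.
Lemma conjcM z w : conjc (z * w) = conjc z * conjc w. Proof. exact: rmorphM. Qed.
Lemma conjcD z w : conjc (z + w) = conjc z + conjc w. Proof. exact: rmorphD. Qed.
Lemma conjcB z w : conjc (z - w) = conjc z - conjc w. Proof. exact: rmorphB. Qed.
Lemma conj_real (a : R) : conjc (a%:C%C) = a%:C%C. Proof. exact: conjc_real. Qed.
Lemma complex_eqP z w :
  complex.Re z = complex.Re w -> complex.Im z = complex.Im w -> z = w.
Proof. by case: z w => [a b] [c d] /= -> ->. Qed.

End Modulus.

Section Topology.
Context {R : realType}.

Lemma cvg_modulusP {T : Type} {F : set_system T} {FF : Filter F}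
    (f : T -> R[i]^o) (l : R[i]^o) :
  (f @ F --> l) <-> forall e : R, 0 < e -> \forall x \near F, modulus (l - f x) < e.
Proof.
split=> [/cvgrPdist_lt fl e e0|fl].
  have : 0 < (e%:C%C : R[i]) by rewrite ltcR.
  by move=> /fl; apply: filterS => x; rewrite normcE_modulus ltcR.
apply/cvgrPdist_lt => -[e e'] ee.
move: ee; rewrite ltcE/= => /andP[/eqP -> e0].
by apply: filterS (fl _ e0) => x; rewrite normcE_modulus -[(_ +i* 0)%C]/(_%:C%C) ltcR.
Qed.

Lemma cvg_ReImP {T : Type} {F : set_system T} {FF : Filter F}
    (f : T -> R[i]^o) (l : R[i]^o) :
  (f @ F --> l) <-> ((fun x => complex.Re (f x)) @ F --> complex.Re l) /\
    ((fun x => complex.Im (f x)) @ F --> complex.Im l).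
Proof.
split=> [/cvg_modulusP fl|[/cvgrPdist_lt fr /cvgrPdist_lt fi]].
  split; apply/cvgrPdist_lt => e /fl; apply: filterS => x; apply: le_lt_trans.
    by rewrite -Re_opp -Re_add le_Re_modulus.
  by rewrite -Im_opp -Im_add le_Im_modulus.
apply/cvg_modulusP => e e0.
have e20 : 0 < e / 2 by rewrite divr_gt0.
near=> x; apply: (le_lt_trans (modulus_le_ReIm _)).
rewrite (splitr e) ltrD// ?Re_add ?Im_add ?Re_opp ?Im_opp; near: x; [exact: fr|exact: fi].
Unshelve. all: end_near. Qed.

Lemma near_modulusP (z : R[i]^o) (P : R[i] -> Prop) :
  (\forall w \near z, P w) <->
  exists2 d : R, 0 < d & forall w, modulus (w - z) < d -> P w.
Proof.
split=> [/nbhs_ballP[[d d']]/=|[d d0 dP]].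
  rewrite /ball/= ltcE/= => /andP[/eqP -> d0] dP; exists d => // w wz.
  by apply: dP; rewrite /= normcE_modulus modulusB -[(_ +i* 0)%C]/(_%:C%C) ltcR.
apply/nbhs_ballP; exists d%:C%C; first by rewrite /= ltcR.
by move=> w; rewrite -ball_normE/ball_/= normcE_modulus modulusB ltcR; exact: dP.
Qed.

Lemma near_modulus_lt (z : R[i]^o) (e : R) : 0 < e ->
  \forall w \near z, modulus (z - w) < e.
Proof. by move=> e0; apply/near_modulusP; exists e => // w; rewrite modulusB. Qed.

Lemma continuous_Re : continuous (fun z : R[i]^o => complex.Re z).
Proof. move=> z; apply/(@cvgrPdist_lt _ _ _ (nbhs z)) => e e0.
apply: filterS (near_modulus_lt z e0) => w; apply: le_lt_trans.
by rewrite -Re_opp -Re_add le_Re_modulus. Qed.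

Lemma continuous_Im : continuous (fun z : R[i]^o => complex.Im z).
Proof. move=> z; apply/(@cvgrPdist_lt _ _ _ (nbhs z)) => e e0.
apply: filterS (near_modulus_lt z e0) => w; apply: le_lt_trans.
by rewrite -Im_opp -Im_add le_Im_modulus. Qed.

Lemma continuous_modulus : continuous (modulus : R[i]^o -> R).
Proof.
move=> z; apply/(@cvgrPdist_lt _ _ _ (nbhs z)) => e e0.
apply: filterS (near_modulus_lt z e0) => w; apply: le_lt_trans.
rewrite ler_norml lerBrDr lerBlDr; apply/andP; split.
  by rewrite addrC lerBlDr modulusB; apply: le_trans (le_modulusD _ _); rewrite addrC subrK.
by apply: le_trans (le_modulusD _ _); rewrite subrK.
Qed.

Lemma continuous_conj : continuous (conjc : R[i]^o -> R[i]^o).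
Proof.
move=> z; apply/(@cvg_modulusP _ (nbhs z)) => e e0.
by apply: filterS (near_modulus_lt z e0) => w; rewrite -rmorphB modulus_conj.
Qed.

Lemma near_realP (t : R) (P : R -> Prop) :
  (\forall x \near t, P x) <->
  exists2 d : R, 0 < d & forall x, `|x - t| < d -> P x.
Proof.
split=> [/nbhs_ballP[d d0 dP]|[d d0 dP]].
  by exists d => // x xt; apply: dP; rewrite -ball_normE/ball_/= distrC.
by apply/nbhs_ballP; exists d => // x; rewrite -ball_normE/ball_/= distrC; exact: dP.
Qed.

(** First order expansions: both notions of derivative, the complex one at a
    point of the plane and the real one along a curve, say that the remainder
    is small compared with the increment.  In this form they compose. *)
Lemma is_derive_complexP (f : R[i]^o -> R[i]^o) (z : R[i]^o) (d : R[i]) :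
  is_derive z 1 f d <->
  forall e : R, 0 < e -> exists2 r : R, 0 < r & forall w,
    modulus (w - z) < r -> modulus (f w - f z - d * (w - z)) <= e * modulus (w - z).
Proof.
split=> [[dfz dE] e e0|H].
  move: dfz => /cvg_ex[/= l fl].
  have ld : l = d by rewrite -dE /derive; apply/esym/cvg_lim.
  move: fl; rewrite ld => /cvg_modulusP/(_ _ e0).
  rewrite near_withinE => /near_modulusP[r r0 rP]; exists r => // w wz.
  have [->|wzn] := eqVneq w z; first by rewrite !subrr mulr0 subrr modulus0 mulr0.
  have hn : w - z != 0 by rewrite subr_eq0.
  have := rP (w - z); rewrite subr0 => /(_ wz hn).
  rewrite [X in f X](_ : _ = w); last by rewrite /GRing.scale/= mulr1 subrK.
  rewrite /GRing.scale/= => lte.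
  have -> : f w - f z - d * (w - z) = - (d - (w - z)^-1 * (f w - f z)) * (w - z).
    by rewrite mulNr mulrBl mulrAC mulVf// mul1r opprB.
  by rewrite modulusM modulusN ler_wpM2r ?modulus_ge0// ltW.
have fl : (h^-1 *: ((f \o shift z) (h *: (1 : R[i]^o)) - f z)) @[h --> (0 : R[i]^o)^'] --> (d : R[i]^o).
  apply/cvg_modulusP => e e0; have e20 : 0 < e / 2 by rewrite divr_gt0.
  have [r r0 rP] := H _ e20.
  rewrite near_withinE; apply/near_modulusP; exists r => // h; rewrite subr0 => hr hn.
  have := rP (h + z); rewrite addrK => /(_ hr).
  rewrite /= /GRing.scale/= mulr1 => le2.
  apply: (@le_lt_trans _ _ (e / 2)); last by rewrite ltr_pdivrMr// ltr_pMr// ltr1n.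
  have hm : 0 < modulus h by rewrite lt_def modulus_ge0 modulus_eq0 hn.
  rewrite -(ler_pM2r hm); apply: le_trans le2; rewrite -modulusM modulusB.
  by rewrite mulrBl mulrAC mulVf// mul1r.
have dfz : derivable f z 1 by apply/cvg_ex; exists d.
by apply: DeriveDef => //; apply: cvg_lim fl.
Qed.

Lemma is_derive_realP (f : R -> R) (t : R) (d : R) :
  is_derive t 1 f d <->
  forall e : R, 0 < e -> exists2 r : R, 0 < r & forall x,
    `|x - t| < r -> `|f x - f t - d * (x - t)| <= e * `|x - t|.
Proof.
split=> [[dfz dE] e e0|H].
  move: dfz => /cvg_ex[/= l fl].
  have ld : l = d by rewrite -dE /derive; apply/esym/cvg_lim.
  move: fl; rewrite ld => /cvgrPdist_lt/(_ _ e0).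
  rewrite near_withinE => /near_realP[r r0 rP]; exists r => // w wz.
  have [->|wzn] := eqVneq w t; first by rewrite !subrr mulr0 subrr normr0 mulr0.
  have hn : w - t != 0 by rewrite subr_eq0.
  have := rP (w - t); rewrite subr0 => /(_ wz hn).
  rewrite [X in f X](_ : _ = w); last by rewrite /GRing.scale/= mulr1 subrK.
  rewrite /GRing.scale/= => lte.
  have -> : f w - f t - d * (w - t) = - (d - (w - t)^-1 * (f w - f t)) * (w - t).
    by rewrite mulNr mulrBl mulrAC mulVf// mul1r opprB.
  by rewrite normrM normrN ler_wpM2r// ltW.
have fl : (h^-1 *: ((f \o shift t) (h *: (1 : R)) - f t)) @[h --> (0 : R)^'] --> (d : R).
  apply/cvgrPdist_lt => e e0; have e20 : 0 < e / 2 by rewrite divr_gt0.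
  have [r r0 rP] := H _ e20.
  rewrite near_withinE; apply/near_realP; exists r => // h; rewrite subr0 => hr hn.
  have := rP (h + t); rewrite addrK => /(_ hr).
  rewrite /= /GRing.scale/= mulr1 => le2.
  apply: (@le_lt_trans _ _ (e / 2)); last by rewrite ltr_pdivrMr// ltr_pMr// ltr1n.
  have hm : 0 < `|h| by rewrite normr_gt0.
  rewrite -(ler_pM2r hm); apply: le_trans le2; rewrite -normrM distrC.
  by rewrite mulrBl mulrAC mulVf// mul1r.
have dfz : derivable f t 1 by apply/cvg_ex; exists d.
by apply: DeriveDef => //; apply: cvg_lim fl.
Qed.

(** The derivative of a curve in the plane.  It is taken in each coordinate, as
    the complex numbers are normed over themselves and not over the reals. *)
Definition curve_derive (g : R -> R[i]) (t : R) (v : R[i]) : Prop :=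
  is_derive t 1 (fun x => complex.Re (g x)) (complex.Re v) /\
  is_derive t 1 (fun x => complex.Im (g x)) (complex.Im v).

Lemma curve_deriveP (g : R -> R[i]) (t : R) (v : R[i]) :
  curve_derive g t v <->
  forall e : R, 0 < e -> exists2 r : R, 0 < r & forall x,
    `|x - t| < r -> modulus (g x - g t - v * (x - t)%:C%C) <= e * `|x - t|.
Proof.
have ReE x : complex.Re (g x - g t - v * (x - t)%:C%C) =
    complex.Re (g x) - complex.Re (g t) - complex.Re v * (x - t).
  by rewrite !Re_add !Re_opp Re_mul/= mulr0 subr0.
have ImE x : complex.Im (g x - g t - v * (x - t)%:C%C) =
    complex.Im (g x) - complex.Im (g t) - complex.Im v * (x - t).
  by rewrite !Im_add !Im_opp Im_mul/= mulr0 add0r.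
split=> [[/is_derive_realP gr /is_derive_realP gi] e e0|H].
  have e20 : 0 < e / 2 by rewrite divr_gt0.
  have [r1 r10 h1] := gr _ e20; have [r2 r20 h2] := gi _ e20.
  exists (Num.min r1 r2); first by rewrite lt_min r10.
  move=> x; rewrite lt_min => /andP[x1 x2]; apply: (le_trans (modulus_le_ReIm _)).
  by rewrite ReE ImE (splitr e) mulrDl lerD// ?h1 ?h2.
split; apply/is_derive_realP => e /H[r r0 h]; exists r => // x /h; apply: le_trans.
  by rewrite -ReE le_Re_modulus.
by rewrite -ImE le_Im_modulus.
Qed.

Lemma curve_derive_continuous g t v : curve_derive g t v -> {for t, continuous (g : R -> R[i]^o)}.
Proof.
move=> [gr gi]; apply/cvg_ReImP; split; apply: differentiable_continuous; apply/derivable1_diffP.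
  by case: gr.
by case: gi.
Qed.

Lemma is_derive_complex_continuous (f : R[i]^o -> R[i]^o) (z d : R[i]^o) :
  is_derive z 1 f d -> {for z, continuous f}.
Proof. by move=> [fz _]; apply: differentiable_continuous; apply/derivable1_diffP. Qed.

Lemma curve_derive_comp (f : R[i]^o -> R[i]^o) (g : R -> R[i]) t d v :
  is_derive (g t : R[i]^o) 1 f d -> curve_derive g t v ->
  curve_derive (f \o g) t (d * v).
Proof.
move=> /is_derive_complexP df /[dup] dg /curve_deriveP dg'; apply/curve_deriveP => e e0.
pose M := modulus v + 1; have M0 : 0 < M by rewrite ltr_wpDl ?modulus_ge0.
pose D := modulus d + 1; have D0 : 0 < D by rewrite ltr_wpDl ?modulus_ge0.
have e1 : 0 < e / 2 / M by rewrite !divr_gt0.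
have e2 : 0 < Num.min 1 (e / 2 / D) by rewrite lt_min ltr01 !divr_gt0.
have [r1 r10 h1] := df _ e1; have [r2 r20 h2] := dg' _ e2.
have : \forall x \near t, modulus (g t - g x) < r1.
  by have /(@cvg_modulusP _ (nbhs t))/(_ _ r10) := curve_derive_continuous dg.
move=> /near_realP[r3 r30 h3].
exists (Num.min r2 r3); first by rewrite lt_min r20.
move=> x; rewrite lt_min => /andP[x2 x3].
have gM : modulus (g x - g t) <= M * `|x - t|.
  rewrite -[g x - g t](subrK (v * (x - t)%:C%C)); apply: (le_trans (le_modulusD _ _)).
  rewrite /M addrC mulrDl modulusM modulus_real lerD// mul1r.
  by rewrite -[leRHS]mul1r; apply: (le_trans (h2 _ x2)); rewrite ler_wpM2r// ge_min lexx.
have -> : (f \o g) x - (f \o g) t - d * v * (x - t)%:C%C =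
    (f (g x) - f (g t) - d * (g x - g t)) + d * (g x - g t - v * (x - t)%:C%C).
  by rewrite /=; ring.
apply: (le_trans (le_modulusD _ _)); rewrite (splitr e) mulrDl lerD//.
  apply: (le_trans (h1 _ _)); first by rewrite modulusB h3.
  have -> : e / 2 * `|x - t| = e / 2 / M * (M * `|x - t|) by rewrite mulrA divfK// gt_eqF.
  by rewrite ler_wpM2l// ltW.
rewrite modulusM; apply: (le_trans (ler_wpM2l (modulus_ge0 _) (h2 _ x2))).
rewrite mulrA ler_wpM2r//; apply: (@le_trans _ _ (D * (e / 2 / D))).
  by rewrite ler_pM ?modulus_ge0 ?(ltW e2)// ?ge_min ?lexx ?orbT// /D lerDl.
by rewrite mulrC divfK// gt_eqF.
Qed.

Lemma curve_derive_cst (c : R[i]) t : curve_derive (fun=> c) t 0.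
Proof. by split; exact: is_derive_cst. Qed.

Lemma curve_derive_real (f : R -> R) (t v : R) : is_derive t 1 f v ->
  curve_derive (fun x => (f x)%:C%C) t v%:C%C.
Proof. by move=> fv; split=> //=; exact: is_derive_cst. Qed.

Lemma curve_deriveD (f g : R -> R[i]) t u v : curve_derive f t u -> curve_derive g t v ->
  curve_derive (fun x => f x + g x) t (u + v).
Proof.
move=> [fr fi] [gr gi]; split; rewrite ?Re_add ?Im_add.
  by rewrite (_ : (fun _ => _) = (fun x => complex.Re (f x)) + (fun x => complex.Re (g x)));
    [exact: is_deriveD|apply/funext => x; rewrite Re_add].
by rewrite (_ : (fun _ => _) = (fun x => complex.Im (f x)) + (fun x => complex.Im (g x)));
  [exact: is_deriveD|apply/funext => x; rewrite Im_add].
Qed.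

Lemma curve_deriveM (f g : R -> R[i]) t u v : curve_derive f t u -> curve_derive g t v ->
  curve_derive (fun x => f x * g x) t (u * g t + f t * v).
Proof.
move=> [fr fi] [gr gi]; split.
- pose df := is_deriveB (is_deriveM fr gr) (is_deriveM fi gi).
  rewrite (_ : (fun _ => _) = (fun x => complex.Re (f x)) * (fun x => complex.Re (g x))
     - (fun x => complex.Im (f x)) * (fun x => complex.Im (g x))).
    apply: (is_derive_eq df); rewrite /GRing.scale/= Re_add !Re_mul; ring.
  by apply/funext => x; rewrite Re_mul.
- pose df := is_deriveD (is_deriveM fr gi) (is_deriveM fi gr).
  rewrite (_ : (fun _ => _) = (fun x => complex.Re (f x)) * (fun x => complex.Im (g x))
     + (fun x => complex.Im (f x)) * (fun x => complex.Re (g x))).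
    apply: (is_derive_eq df); rewrite /GRing.scale/= Im_add !Im_mul; ring.
  by apply/funext => x; rewrite Im_mul.
Qed.

Lemma curve_derive_eq (f : R -> R[i]) t u v : curve_derive f t u -> u = v -> curve_derive f t v.
Proof. by move=> + <-. Qed.

End Topology.

Section Expi.
Context {R : realType}.
Implicit Types (x t : R) (k : int).

Definition expi x : R[i] := (cos x +i* sin x)%C.

Lemma expi0 : expi 0 = 1.
Proof. by rewrite /expi cos0 sin0. Qed.

Lemma expiD x t : expi (x + t) = expi x * expi t.
Proof. by apply: complex_eqP; rewrite /= ?cosD ?sinD// addrC [cos x * _]mulrC. Qed.

Lemma modulus_expi x : modulus (expi x) = 1.
Proof. by rewrite modulusE/= cos2Dsin2 sqrtr1. Qed.

Lemma expi_neq0 x : expi x != 0.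
Proof. by rewrite -modulus_eq0 modulus_expi oner_eq0. Qed.

Lemma conj_expi x : (expi x)^*%C = expi (- x).
Proof. by rewrite /expi cosN sinN. Qed.

Lemma expiN x : expi (- x) = (expi x)^-1.
Proof. by apply: (mulfI (expi_neq0 x)); rewrite -expiD subrr expi0 divff ?expi_neq0. Qed.

Lemma expi_2pi : expi (2 * pi) = 1.
Proof. by rewrite /expi mulr_natl cos2pi sin2pi. Qed.

Lemma expiMn n x : expi (n%:R * x) = expi x ^+ n.
Proof.
by elim: n => [|n ih]; rewrite ?mul0r ?expi0// exprS -ih -expiD -natr1 mulrDl mul1r addrC.
Qed.

Lemma expi_period k x : expi (k%:~R * (x + 2 * pi)) = expi (k%:~R * x).
Proof.
rewrite mulrDr expiD; suff -> : expi (k%:~R * (2 * pi)) = 1 by rewrite mulr1.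
case: k => n; first by rewrite -pmulrn expiMn expi_2pi expr1n.
by rewrite NegzE mulrNz mulNr -pmulrn expiN expiMn expi_2pi expr1n invr1.
Qed.

Lemma curve_derive_expi x : curve_derive expi x ('i%C * expi x).
Proof.
split; rewrite /= ?Re_mul ?Im_mul/= !(mul0r, mul1r, sub0r, add0r).
- exact: is_derive_cos.
- exact: is_derive_sin.
Qed.

Lemma curve_derive_expiM a x :
  curve_derive (fun t => expi (a * t)) x ('i%C * a%:C%C * expi (a * x)).
Proof.
have da : is_derive x 1 (fun t : R => a * t) a.
  have := is_deriveZ a (is_derive_id x (1 : R)).
  by rewrite /GRing.scale/= mulr1.
have [dr di] := curve_derive_expi (a * x).
split.
- apply: is_derive_eq (is_derive1_comp (g := fun t => a * t) dr da) _.
  by rewrite !Re_mul/=; ring.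
- apply: is_derive_eq (is_derive1_comp (g := fun t => a * t) di da) _.
  by rewrite !Im_mul !Re_mul/=; ring.
Qed.

Lemma expi_eq1 x : - (2 * pi) < x < 2 * pi -> expi x = 1 -> x = 0.
Proof.
move=> /andP[x1 x2] [c1 s0].
have half : sin (x / 2) = 0.
  have : cos (x / 2 *+ 2) = 1 - sin (x / 2) ^+ 2 *+ 2.
    by rewrite mulr2n cosD -!expr2 cos2sin2; ring.
  rewrite -mulr_natr divfK// c1 => /eqP.
  rewrite eq_sym subr_eq addrC -subr_eq subrr eq_sym mulrn_eq0/= sqrf_eq0.
  by move/eqP.
have [x0|x0|//] := ltgtP x 0.
  have : 0 < sin (- (x / 2)) by apply: sin_gt0_pi; lra.
  by rewrite sinN half oppr0 ltxx.
have : 0 < sin (x / 2) by apply: sin_gt0_pi; lra.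
by rewrite half ltxx.
Qed.

(** The argument of a point of the circle is the arc cosine of its real part, up
    to the sign, which the imaginary part decides. *)
Lemma expi_surj (z : R[i]) : modulus z = 1 -> exists2 x, - pi <= x <= pi & z = expi x.
Proof.
case: z => a b /(congr1 (fun u => u ^+ 2)); rewrite modulus_sqr/= expr1n => ab.
have a1 : -1 <= a <= 1 by nra.
have sE : sin (acos a) = `|b|.
  by rewrite sin_acos// -[in X in Num.sqrt X]ab addrC addKr sqrtr_sqr.
have p0 := acos_ge0 a1; have p1 := acos_lepi a1; have ppi := pi_ge0 R.
have [b0|b0] := leP 0 b.
  exists (acos a); first by apply/andP; split; lra.
  by rewrite /expi acosK ?in_itv//= sE ger0_norm.
exists (- acos a); first by apply/andP; split; lra.
by rewrite /expi cosN sinN acosK ?in_itv//= sE ltr0_norm// opprK.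
Qed.

End Expi.

(** * Orthonormal systems for a Hermitian form *)

(** The form is only assumed to behave well on a set [S] of vectors, because
    it is given by integrals that are meaningful on part of a function space. *)
Section Hermitian.
Context {R : realType} (V : lmodType R[i]) (S : V -> Prop) (B : V -> V -> R[i]).
Hypothesis S_lin : forall a f g, S f -> S g -> S (a *: f + g).
Hypothesis S0 : S 0.
Hypothesis B_lin : forall a f g h, S f -> S g -> S h ->
  B (a *: f + g) h = a * B f h + B g h.
Hypothesis B_herm : forall f g, S f -> S g -> B g f = (B f g)^*%C.
Hypothesis B_pos : forall f, S f -> 0 <= complex.Re (B f f).

Variables (I : eqType) (e : I -> V).
Hypothesis Se : forall i, S (e i).
Hypothesis e_orth : forall i j, B (e i) (e j) = (i == j)%:R.

Lemma hermitian_0l h : S h -> B 0 h = 0.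
Proof.
move=> Sh; have := B_lin 1 S0 S0 Sh; rewrite scaler0 addr0 mul1r.
by move=> /(congr1 (fun u => u - B 0 h)); rewrite subrr addrK.
Qed.

Lemma hermitian_set_sum (r : seq I) (c : I -> R[i]) : S (\sum_(i <- r) c i *: e i).
Proof. by elim: r => [|i r ih]; rewrite ?big_nil// big_cons; exact: S_lin. Qed.

Lemma hermitian_suml (r : seq I) (c : I -> R[i]) h : S h ->
  B (\sum_(i <- r) c i *: e i) h = \sum_(i <- r) c i * B (e i) h.
Proof.
move=> Sh; elim: r => [|i r ih]; first by rewrite !big_nil hermitian_0l.
by rewrite !big_cons B_lin// ?ih//; exact: hermitian_set_sum.
Qed.

Lemma hermitian_coef (r : seq I) (c : I -> R[i]) j : uniq r -> j \in r ->
  B (\sum_(i <- r) c i *: e i) (e j) = c j.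
Proof.
move=> ur jr; rewrite hermitian_suml// (bigD1_seq j)//= e_orth eqxx mulr1.
by rewrite big1 ?addr0// => i /negbTE ij; rewrite e_orth ij mulr0.
Qed.

Lemma hermitian_pythagoras (r : seq I) (c : I -> R[i]) : uniq r ->
  B (\sum_(i <- r) c i *: e i) (\sum_(i <- r) c i *: e i) =
  (\sum_(i <- r) modulus (c i) ^+ 2)%:C%C.
Proof.
move=> ur; rewrite hermitian_suml; last exact: hermitian_set_sum.
rewrite rmorph_sum/= [LHS]big_seq [RHS]big_seq; apply: eq_bigr => i ir.
by rewrite B_herm ?hermitian_coef ?mulCJ//; exact: hermitian_set_sum.
Qed.

Lemma hermitian_residual (r : seq I) f : uniq r -> S f ->
  let s := \sum_(i <- r) B f (e i) *: e i in
  B (f - s) (f - s) = B f f - (\sum_(i <- r) modulus (B f (e i)) ^+ 2)%:C%C.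
Proof.
move=> ur Sf s; set sg := \sum_(i <- r) _.
have Ss : S s by exact: hermitian_set_sum.
have Ssf : S (f - s) by rewrite addrC -scaleN1r; exact: S_lin.
have subl h : S h -> B (f - s) h = B f h - B s h.
  by move=> Sh; rewrite addrC -scaleN1r B_lin// mulN1r addrC.
have Bsf : B s f = sg%:C%C.
  rewrite hermitian_suml// rmorph_sum/=; apply: eq_bigr => i _.
  by rewrite (B_herm Sf (Se i)) mulCJ.
have Bss : B s s = sg%:C%C by exact: hermitian_pythagoras.
have Bfs : B f s = sg%:C%C by rewrite (B_herm Ss Sf) Bsf conj_real.
rewrite subl// (B_herm Ssf Sf) (B_herm Ssf Ss) subl// subl// Bsf Bss Bfs subrr.
rewrite conjc0 subr0 [in RHS](B_herm Sf Sf).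
by case: (B f f) => a b; apply: complex_eqP => /=; ring.
Qed.

(** The squared distance of [f] from its projection is nonnegative. *)
Lemma bessel (r : seq I) f : uniq r -> S f ->
  \sum_(i <- r) modulus (B f (e i)) ^+ 2 <= complex.Re (B f f).
Proof.
move=> ur Sf; have Ssf : S (f - \sum_(i <- r) B f (e i) *: e i).
  by rewrite addrC -scaleN1r; apply: S_lin => //; exact: hermitian_set_sum.
by have := B_pos Ssf; rewrite hermitian_residual// Re_add Re_opp/= subr_ge0.
Qed.

End Hermitian.

(** * Integrals of complex-valued functions of a real variable *)

Section ComplexContinuity.
Context {R : realType}.
Implicit Types (F G : R -> R[i]) (t : R).

(** An inductive wrapper, so that the topology of the complex field stays
    folded when two such statements are compared. *)
Variant ccont F t : Prop := Ccont of {for t, continuous (F : R -> R[i]^o)}.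

Lemma ccont_near F G t : (\forall x \near t, F x = G x) -> ccont F t -> ccont G t.
Proof.
move=> FG [cF]; split; rewrite /prop_for /continuous_at -(nbhs_singleton FG).
by apply: cvg_trans cF; apply: near_eq_cvg; apply: filterS FG => x ->.
Qed.

Lemma ccont_cst (c : R[i]) t : ccont (fun=> c) t.
Proof. by split; exact: cvg_cst. Qed.

Lemma ccontD F G t : ccont F t -> ccont G t -> ccont (fun x => F x + G x) t.
Proof.
by move=> [cF] [cG]; split; exact: (@cvgD _ (R[i]^o) _ _ _ (F : R -> R[i]^o) G _ _ cF cG).
Qed.

Lemma ccontN F t : ccont F t -> ccont (fun x => - F x) t.
Proof. by move=> [cF]; split; exact: (@cvgN _ (R[i]^o) _ _ _ (F : R -> R[i]^o) _ cF). Qed.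

Lemma ccontB F G t : ccont F t -> ccont G t -> ccont (fun x => F x - G x) t.
Proof. by move=> cF cG; exact: (ccontD cF (ccontN cG)). Qed.

Lemma ccontM F G t : ccont F t -> ccont G t -> ccont (fun x => F x * G x) t.
Proof.
by move=> [cF] [cG]; split; exact: (@cvgM _ _ _ _ (F : R -> R[i]^o) G _ _ cF cG).
Qed.

Lemma ccontV F t : F t != 0 -> ccont F t -> ccont (fun x => (F x)^-1) t.
Proof.
by move=> F0 [cF]; split; exact: (@cvgV _ _ _ _ (F : R -> R[i]^o) _ F0 cF).
Qed.

Lemma ccontJ F t : ccont F t -> ccont (fun x => (F x)^*%C) t.
Proof. by move=> [cF]; split; apply: (continuous_comp cF); exact: continuous_conj. Qed.

Lemma ccont_Re F t : ccont F t -> {for t, continuous (fun x => complex.Re (F x))}.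
Proof. by move=> [cF]; apply: (continuous_comp cF); exact: continuous_Re. Qed.

Lemma ccont_Im F t : ccont F t -> {for t, continuous (fun x => complex.Im (F x))}.
Proof. by move=> [cF]; apply: (continuous_comp cF); exact: continuous_Im. Qed.

Lemma ccont_modulus F t : ccont F t -> {for t, continuous (fun x => modulus (F x))}.
Proof. by move=> [cF]; apply: (continuous_comp cF); exact: continuous_modulus. Qed.

Lemma ccont_real (f : R -> R) t : {for t, continuous f} -> ccont (fun x => (f x)%:C%C) t.
Proof. by move=> cf; split; apply/(@cvg_ReImP _ _ (nbhs t)); split=> //=; exact: cvg_cst. Qed.

Lemma curve_derive_ccont F t v : curve_derive F t v -> ccont F t.
Proof. by move=> dF; split; exact: curve_derive_continuous dF. Qed.

Lemma ccont_expiM a t : ccont (fun x => expi (a * x)) t.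
Proof. exact: curve_derive_ccont (curve_derive_expiM a t). Qed.

Lemma ccont_comp (f : R[i]^o -> R[i]^o) F t :
  ccont F t -> {for (F t : R[i]^o), continuous f} -> ccont (fun x => f (F x)) t.
Proof. by move=> [cF] cf; split; exact: (continuous_comp cF cf). Qed.

End ComplexContinuity.

Section ComplexIntegral.
Context {R : realType}.
Implicit Types (F G : R -> R[i]) (a b : R).
Local Notation mu := (@lebesgue_measure R).

Definition ccont_on a b F : Prop := forall x, a <= x <= b -> ccont F x.

Definition cint a b F : R[i] :=
  ((\int[mu]_(x in `[a, b]) complex.Re (F x)) +i*
   (\int[mu]_(x in `[a, b]) complex.Im (F x)))%C.

Lemma segment_integrable (f : R -> R) a b :
  (forall x, a <= x <= b -> {for x, continuous f}) ->
  mu.-integrable `[a, b] (EFin \o f).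
Proof.
move=> cf; apply: continuous_compact_integrable; first exact: segment_compact.
apply: continuous_in_subspaceT => x; rewrite inE/= in_itv/=; exact: cf.
Qed.

Lemma integrable_Re F a b : ccont_on a b F ->
  mu.-integrable `[a, b] (EFin \o (fun x => complex.Re (F x))).
Proof. by move=> cF; apply: segment_integrable => x xab; apply: ccont_Re; exact: cF. Qed.

Lemma integrable_Im F a b : ccont_on a b F ->
  mu.-integrable `[a, b] (EFin \o (fun x => complex.Im (F x))).
Proof. by move=> cF; apply: segment_integrable => x xab; apply: ccont_Im; exact: cF. Qed.

Lemma eq_cint a b F G : (forall x, a <= x <= b -> F x = G x) -> cint a b F = cint a b G.
Proof.
move=> FG; congr (_ +i* _)%C; apply: eq_Rintegral => x; rewrite inE/= in_itv/= => xab;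
by rewrite FG.
Qed.

Lemma cintD a b F G : ccont_on a b F -> ccont_on a b G ->
  cint a b (fun x => F x + G x) = cint a b F + cint a b G.
Proof.
move=> cF cG; apply: complex_eqP => /=.
  rewrite -RintegralD//; [|exact: integrable_Re..].
  by apply: eq_Rintegral => x _; rewrite Re_add.
rewrite -RintegralD//; [|exact: integrable_Im..].
by apply: eq_Rintegral => x _; rewrite Im_add.
Qed.

Lemma cintZ a b (c : R[i]) F : ccont_on a b F ->
  cint a b (fun x => c * F x) = c * cint a b F.
Proof.
move=> cF; have iR := integrable_Re cF; have iI := integrable_Im cF.
have iZ (k : R) (f : R -> R) : mu.-integrable `[a, b] (EFin \o f) ->
    mu.-integrable `[a, b] (EFin \o (fun x => k * f x)).
  by move=> i_f; exact: (@integrableZl _ _ _ mu `[a, b] _ k (fun x => (f x)%:E)).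
apply: complex_eqP; rewrite [LHS]/=.
  rewrite [RHS]Re_mul [complex.Re (cint _ _ _)]/= [complex.Im (cint _ _ _)]/=.
  rewrite -(RintegralZl _ _ iR)// -(RintegralZl _ _ iI)// -RintegralB//; [|exact: iZ..].
  by apply: eq_Rintegral => x _; rewrite Re_mul.
rewrite [RHS]Im_mul [complex.Re (cint _ _ _)]/= [complex.Im (cint _ _ _)]/=.
rewrite -(RintegralZl _ _ iR)// -(RintegralZl _ _ iI)// -RintegralD//; [|exact: iZ..].
by apply: eq_Rintegral => x _; rewrite Im_mul.
Qed.

Lemma cintN a b F : ccont_on a b F -> cint a b (fun x => - F x) = - cint a b F.
Proof.
move=> cF; rewrite -mulN1r -cintZ//; apply: eq_cint => x _; by rewrite mulN1r.
Qed.

Lemma cintB a b F G : ccont_on a b F -> ccont_on a b G ->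
  cint a b (fun x => F x - G x) = cint a b F - cint a b G.
Proof.
move=> cF cG; rewrite (cintD cF (G := fun x => - G x)) ?cintN// => x xab.
by apply: ccontN; exact: cG.
Qed.

Lemma cintJ a b F : ccont_on a b F -> cint a b (fun x => (F x)^*%C) = (cint a b F)^*%C.
Proof.
move=> cF; apply: complex_eqP; rewrite ?Re_conjc ?Im_conjc/=.
  by apply: eq_Rintegral => x _; rewrite Re_conjc.
rewrite -mulN1r -RintegralZl//; last exact: integrable_Im.
by apply: eq_Rintegral => x _; rewrite Im_conjc mulN1r.
Qed.

Lemma Rintegral_le_cst (f : R -> R) (a b M : R) : a <= b ->
  (forall x, a <= x <= b -> {for x, continuous f}) ->
  (forall x, a <= x <= b -> `|f x| <= M) ->
  `|\int[mu]_(x in `[a, b]) f x| <= M * (b - a).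
Proof.
move=> ab cf fM; have intf := segment_integrable cf.
apply: (le_trans (le_normr_Rintegral _ intf)) => //.
have intn : mu.-integrable `[a, b] (EFin \o (fun x => `|f x|)).
  by apply: segment_integrable => x xab; apply: (continuous_comp (cf x xab)); exact: norm_continuous.
have intM : mu.-integrable `[a, b] (EFin \o (fun _ => M)).
  by apply: segment_integrable => x xab; exact: cvg_cst.
apply: (@le_trans _ _ (\int[mu]_(x in `[a, b]) M)).
  by apply: le_Rintegral => // x; rewrite /= in_itv/=; exact: fM.
rewrite Rintegral_cst//= lebesgue_measure_itv/= lte_fin.
by case: ltgtP ab => //= -> _; rewrite subrr.
Qed.

Lemma le_modulus_cint a b F M : a <= b -> ccont_on a b F ->
  (forall x, a <= x <= b -> modulus (F x) <= M) ->
  modulus (cint a b F) <= 2 * M * (b - a).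
Proof.
move=> ab cF FM; apply: (le_trans (modulus_le_ReIm _)) => /=.
have -> : 2 * M * (b - a) = M * (b - a) + M * (b - a) by ring.
rewrite lerD//; apply: Rintegral_le_cst => // x xab.
- by apply: ccont_Re; exact: cF.
- exact: le_trans (le_Re_modulus _) (FM x xab).
- by apply: ccont_Im; exact: cF.
- exact: le_trans (le_Im_modulus _) (FM x xab).
Qed.

Lemma Rintegral_FTC (f g : R -> R) a b : a <= b ->
  (forall x, a <= x <= b -> is_derive x 1 g (f x)) ->
  (forall x, a <= x <= b -> {for x, continuous f}) ->
  \int[mu]_(x in `[a, b]) f x = g b - g a.
Proof.
rewrite le_eqVlt => /predU1P[->|ab] dg cf.
  by rewrite set_itv1 Rintegral_set1 subrr.
have cg x : a <= x <= b -> {for x, continuous g}.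
  by move=> /dg[dgx _]; apply: differentiable_continuous; apply/derivable1_diffP.
rewrite /Rintegral (@continuous_FTC2 _ f g)//.
- by apply: continuous_in_subspaceT => x; rewrite inE/= in_itv/=; exact: cf.
- split.
  + by move=> x; rewrite in_itv/= => /andP[ax xb]; have [] := dg x; rewrite // !ltW.
  + by apply: cvg_at_right_filter; apply: cg; rewrite lexx ltW.
  + by apply: cvg_at_left_filter; apply: cg; rewrite lexx ltW.
- move=> x; rewrite in_itv/= => /andP[ax xb].
  have [|_ <-] := dg x; first by rewrite !ltW.
  by rewrite derive1E.
Qed.

Lemma cint_FTC (F G : R -> R[i]) a b : a <= b ->
  (forall x, a <= x <= b -> curve_derive G x (F x)) -> ccont_on a b F ->
  cint a b F = G b - G a.
Proof.
move=> ab dG cF; apply: complex_eqP; rewrite ?Re_add ?Re_opp ?Im_add ?Im_opp /=.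
  apply: (@Rintegral_FTC _ (fun x => complex.Re (G x))) => // x xab.
  - by have [] := dG x xab.
  - by apply: ccont_Re; exact: cF.
apply: (@Rintegral_FTC _ (fun x => complex.Im (G x))) => // x xab.
- by have [] := dG x xab.
- by apply: ccont_Im; exact: cF.
Qed.

Lemma Rintegral_cat (f : R -> R) a c b : a <= c <= b ->
  (forall x, a <= x <= b -> {for x, continuous f}) ->
  \int[mu]_(x in `[a, b]) f x = \int[mu]_(x in `[a, c]) f x + \int[mu]_(x in `[c, b]) f x.
Proof.
move=> /andP[ac cb] cf; have intf := segment_integrable cf.
have := @Rintegral_itvB R f (BLeft a) (BRight b) c intf.
rewrite !bnd_simp => /(_ ac cb) h.
have -> : \int[mu]_(x in `[c, b]) f x = \int[mu]_(x in `]c, b]) f x.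
  rewrite Rintegral_itv_obnd_cbnd//; apply: (integrableS _ _ _ intf) => //.
  by apply: subset_itvr; rewrite bnd_simp.
by rewrite -h addrC subrK.
Qed.

Lemma cint_cat F a c b : a <= c <= b -> ccont_on a b F ->
  cint a b F = cint a c F + cint c b F.
Proof.
move=> acb cF; apply: complex_eqP => /=; apply: Rintegral_cat => // x xab.
  by apply: ccont_Re; exact: cF.
by apply: ccont_Im; exact: cF.
Qed.

Lemma Rintegral_shift (f : R -> R) a b c : a <= b -> continuous f ->
  \int[mu]_(x in `[a + c, b + c]) f x = \int[mu]_(x in `[a, b]) f (x + c).
Proof.
rewrite le_eqVlt => /predU1P[->|ab] cf; first by rewrite !set_itv1 !Rintegral_set1.
have dF (x : R) : is_derive x 1 (fun x : R => x + c) 1.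
  by have := is_deriveD (is_derive_id x (1:R)) (is_derive_cst c x 1); rewrite addr0.
have F'E : ((fun x : R => x + c) : R -> R)^`()%classic = cst 1.
  by apply/funext => x; rewrite derive1E; have [_ ->] := dF x.
have cF x : {for x, continuous (fun x : R => x + c)}.
  by apply: differentiable_continuous; apply/derivable1_diffP; case: (dF x).
rewrite /Rintegral (@integration_by_substitution_increasing _ (fun x => x + c) f a b) ?(ltW ab)//.
- by congr fine; apply: eq_integral => x _; rewrite F'E/= fctE mulr1.
- by move=> x y _ _; rewrite ltrD2r.
- by move=> x _; rewrite F'E; exact: cvg_cst.
- by rewrite F'E; exact: is_cvg_cst.
- by rewrite F'E; exact: is_cvg_cst.
- split.
  + by move=> x _; case: (dF x).
  + by apply: cvg_at_right_filter; exact: cF.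
  + by apply: cvg_at_left_filter; exact: cF.
- by apply: continuous_subspaceT => x; exact: cf.
Qed.

(** The two windows overlap; what one has on the left is a translate, by a full
    period, of what the other has on the right. *)
Lemma Rintegral_period (f : R -> R) T a b : continuous f -> (forall x, f (x + T) = f x) ->
  a <= b <= a + T ->
  \int[mu]_(x in `[a, a + T]) f x = \int[mu]_(x in `[b, b + T]) f x.
Proof.
move=> cf fT /andP[ab baT].
rewrite (@Rintegral_cat f a b) => [||x _]; [|by rewrite ab baT|exact: cf].
rewrite (@Rintegral_cat f b (a + T) (b + T)) => [||x _]; [|by rewrite baT lerD2r ab|exact: cf].
rewrite Rintegral_shift// addrC; congr (_ + _).
by apply: eq_Rintegral => x _; rewrite fT.
Qed.

Lemma cint_period F T a b : (forall x, ccont F x) -> (forall x, F (x + T) = F x) ->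
  a <= b <= a + T -> cint a (a + T) F = cint b (b + T) F.
Proof.
move=> cF FT ab; congr (_ +i* _)%C; apply: Rintegral_period => // x.
- by apply: ccont_Re; exact: cF.
- by rewrite FT.
- by apply: ccont_Im; exact: cF.
- by rewrite FT.
Qed.

End ComplexIntegral.

(** * Fourier coefficients on an interval of length one period *)

Section Fourier.
Context {R : realType}.
Implicit Types (F G : R -> R[i]) (a b x : R) (k : int).

Definition wave k x : R[i] := expi (k%:~R * x).

Lemma ccont_wave k t : ccont (wave k) t.
Proof. exact: ccont_expiM. Qed.

Lemma wave_period k x : wave k (x + 2 * pi) = wave k x.
Proof. exact: expi_period. Qed.

Lemma waveD k l x : wave (k + l) x = wave k x * wave l x.
Proof. by rewrite /wave intrD mulrDl expiD. Qed.

Lemma wave0 x : wave 0 x = 1.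
Proof. by rewrite /wave mul0r expi0. Qed.

Lemma conj_wave k x : (wave k x)^*%C = wave (- k) x.
Proof. by rewrite /wave conj_expi mulrNz mulNr. Qed.

Lemma modulus_wave k x : modulus (wave k x) = 1.
Proof. exact: modulus_expi. Qed.

Lemma wave_nat (n : nat) x : wave n%:Z x = expi x ^+ n.
Proof. by rewrite /wave -pmulrn expiMn. Qed.

Lemma curve_derive_wave k t : curve_derive (wave k) t ('i%C * (k%:~R) * wave k t).
Proof. by rewrite -(@rmorph_int _ _ (real_complex R)); exact: curve_derive_expiM. Qed.

Definition fourier_form a F G : R[i] :=
  (2 * pi)^-1%:C%C * cint a (a + 2 * pi) (fun x => F x * (G x)^*%C).

Definition fourier a F k : R[i] := fourier_form a F (wave k).

Lemma pi20 : (2 * pi : R) != 0.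
Proof. by rewrite mulf_neq0// gt_eqF// pi_gt0. Qed.

Lemma pi2_ge0 : 0 <= 2 * pi :> R.
Proof. by rewrite mulr_ge0// pi_ge0. Qed.

(** A wave of nonzero frequency has a periodic primitive. *)
Lemma wave_orthonormal a k l : fourier_form a (wave k) (wave l) = (k == l)%:R.
Proof.
have E x : wave k x * (wave l x)^*%C = wave (k - l) x.
  by rewrite conj_wave waveD.
have le_a : a <= a + 2 * pi by rewrite lerDl pi2_ge0.
rewrite /fourier_form (eq_cint (G := wave (k - l))) => [|x _]; last exact: E.
have [->|kl] := eqVneq k l.
  rewrite subrr (@cint_FTC _ _ (fun x => x%:C%C))//.
  - rewrite -rmorphB/= addrAC subrr add0r -rmorphM/= mulVf ?pi20//.
  - move=> x _; rewrite wave0 -[1](rmorph1 (real_complex R)).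
    by apply: curve_derive_real; exact: is_derive_id.
  - by move=> x _; exact: ccont_wave.
pose c : R[i] := 'i%C * (k - l)%:~R.
have c0 : c != 0.
  rewrite mulf_neq0 ?intr_eq0 ?subr_eq0//.
  by rewrite -modulus_eq0 modulusi oner_eq0.
rewrite (@cint_FTC _ _ (fun x => c^-1 * wave (k - l) x))//.
- by rewrite wave_period subrr mulr0.
- move=> x _; apply: curve_derive_eq.
    exact: (curve_deriveM (curve_derive_cst _ _) (curve_derive_wave _ _)).
  by rewrite mul0r add0r mulrA mulVf// mul1r.
- by move=> x _; exact: ccont_wave.
Qed.

Section Form.
Variable a : R.
Let S F := ccont_on a (a + 2 * pi) F.

Lemma fourier_S_lin (c : R[i]) F G : S F -> S G -> S (c *: F + G).
Proof.
move=> cF cG x xab; apply: (ccontD _ (cG x xab)).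
by apply: (ccontM _ (cF x xab)); exact: ccont_cst.
Qed.

Lemma fourier_S0 : S 0.
Proof. by move=> x _; exact: ccont_cst. Qed.

Lemma fourier_form_lin (c : R[i]) F G H : S F -> S G -> S H ->
  fourier_form a (c *: F + G) H = c * fourier_form a F H + fourier_form a G H.
Proof.
move=> cF cG cH; have cJ x : a <= x <= a + 2 * pi -> ccont (fun x => (H x)^*%C) x.
  by move=> xab; apply: ccontJ; exact: cH.
rewrite /fourier_form [c * (_ * _)]mulrCA -mulrDr; congr (_ * _).
have cFH : ccont_on a (a + 2 * pi) (fun x => F x * (H x)^*%C).
  by move=> x xab; apply: (ccontM (cF x xab)); exact: cJ.
have cGH : ccont_on a (a + 2 * pi) (fun x => G x * (H x)^*%C).
  by move=> x xab; apply: (ccontM (cG x xab)); exact: cJ.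
rewrite -cintZ// -cintD//.
  by apply: eq_cint => x _; rewrite [(_ + _) x]/= mulrDl mulrA.
by move=> x xab; apply: (ccontM _ (cFH x xab)); exact: ccont_cst.
Qed.

Lemma fourier_form_herm F G : S F -> S G ->
  fourier_form a G F = (fourier_form a F G)^*%C.
Proof.
move=> cF cG; rewrite /fourier_form conjcM conj_real -cintJ.
  by congr (_ * _); apply: eq_cint => x _; rewrite conjcM conjcK mulrC.
by move=> x xab; apply: (ccontM (cF x xab)); apply: ccontJ; exact: cG.
Qed.

Lemma fourier_form_sqr F : complex.Re (fourier_form a F F) =
  (2 * pi)^-1 * \int[@lebesgue_measure R]_(x in `[a, a + 2 * pi]) modulus (F x) ^+ 2.
Proof.
rewrite /fourier_form Re_mul/= mul0r subr0; congr (_ * _).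
by apply: eq_Rintegral => x _; rewrite mulCJ.
Qed.

Lemma fourier_form_pos F : S F -> 0 <= complex.Re (fourier_form a F F).
Proof.
move=> _; rewrite fourier_form_sqr mulr_ge0 ?invr_ge0 ?pi2_ge0//.
by apply: Rintegral_ge0 => x _; rewrite sqr_ge0.
Qed.

Lemma fourier_bessel (r : seq int) F : uniq r -> S F ->
  \sum_(k <- r) modulus (fourier a F k) ^+ 2 <=
  (2 * pi)^-1 * \int[@lebesgue_measure R]_(x in `[a, a + 2 * pi]) modulus (F x) ^+ 2.
Proof.
move=> ur SF; rewrite -fourier_form_sqr.
apply: (bessel fourier_S_lin fourier_S0 fourier_form_lin fourier_form_herm fourier_form_pos) => //.
- by move=> k x _; exact: ccont_wave.
- exact: wave_orthonormal.
Qed.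

End Form.

Lemma fourier_base a b F k : (forall x, ccont F x) -> (forall x, F (x + 2 * pi) = F x) ->
  a <= b <= a + 2 * pi -> fourier a F k = fourier b F k.
Proof.
move=> cF FT ab; rewrite /fourier /fourier_form (@cint_period _ _ _ a b)//.
- by move=> x; apply: ccontM => //; apply: ccontJ; exact: ccont_wave.
- by move=> x; rewrite FT wave_period.
Qed.

End Fourier.

(** * Pointwise convergence of Fourier series *)

Section Chernoff.
Context {R : realType}.
Implicit Types (F h : R -> R[i]) (a b x : R) (k : int).

(** The Riemann-Lebesgue lemma, from Bessel's inequality; the frequencies are
    enumerated by [s] so that both directions are covered. *)
Lemma fourier_cvg0 a F (s : nat -> int) : injective s -> ccont_on a (a + 2 * pi) F ->
  modulus (fourier a F (s n)) @[n --> \oo] --> (0 : R).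
Proof.
move=> sI cF; pose u n := modulus (fourier a F (s n)) ^+ 2.
pose C := (2 * pi)^-1 * \int[@lebesgue_measure R]_(x in `[a, a + 2 * pi]) modulus (F x) ^+ 2.
have nd : nondecreasing_seq (series u).
  apply/nondecreasing_seqP => n.
  by rewrite /series/= big_nat_recr//= lerDl sqr_ge0.
have ub : has_ubound (range (series u)).
  exists C => _ [n _ <-]; rewrite /series/=.
  have := @fourier_bessel R a [seq s i | i <- index_iota 0 n] F.
  by rewrite big_map; apply => //; rewrite map_inj_uniq ?iota_uniq.
have u0 : u @ \oo --> (0 : R).
  by apply: cvg_series_cvg_0; exact: nondecreasing_is_cvgn.
apply/cvgrPdist_lt => e e0; have e2 : 0 < e ^+ 2 by rewrite exprn_gt0.
move/cvgrPdist_lt : u0 => /(_ _ e2); apply: filterS => n.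
rewrite !sub0r !normrN [`|u n|]ger0_norm ?sqr_ge0// [`|modulus _|]ger0_norm ?modulus_ge0//.
by rewrite ltr_sqr ?nnegrE ?modulus_ge0// ltW.
Qed.

(** The value [v] at [x] is meant to be the derivative, so that the difference
    quotient extends continuously. *)
Definition slope F x (v : R[i]) t : R[i] :=
  if t == x then v else (F t - F x) / (t - x)%:C%C.

Lemma slopeM F x v t : slope F x v t * (t - x)%:C%C = F t - F x.
Proof.
rewrite /slope; case: eqVneq => [->|tx]; first by rewrite !subrr mulr0.
by rewrite divfK// (inj_eq (@complexI R) _ 0) subr_eq0.
Qed.

Lemma ccont_slope F x v : (forall t, ccont F t) -> curve_derive F x v ->
  forall t, ccont (slope F x v) t.
Proof.
move=> cF /curve_deriveP dF t; have [->|tx] := eqVneq t x.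
  split; apply/(@cvg_modulusP _ _ (nbhs x)) => e e0.
  have e20 : 0 < e / 2 by rewrite divr_gt0.
  have [r r0 rP] := dF _ e20; apply/near_realP; exists r => // s sr.
  rewrite {1}/slope eqxx; have [->|sx] := eqVneq s x.
    by rewrite /slope eqxx subrr modulus0.
  have sx0 : 0 < `|s - x| by rewrite normr_gt0 subr_eq0.
  apply: (@le_lt_trans _ _ (e / 2)); last by rewrite ltr_pdivrMr// ltr_pMr// ltr1n.
  rewrite -(ler_pM2r sx0); apply: le_trans (rP s sr).
  by rewrite -[`|_|]modulus_real -modulusM modulusB mulrBl slopeM.
apply: (@ccont_near _ (fun t => (F t - F x) / (t - x)%:C%C)).
  have : \forall s \near t, s != x.
    apply/near_realP; exists `|t - x|; first by rewrite normr_gt0 subr_eq0.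
    by move=> s; apply: contraTneq => ->; rewrite distrC ltxx.
  by apply: filterS => s /negbTE sx; rewrite /slope sx.
apply: ccontM; first by apply: ccontB => //; exact: ccont_cst.
apply: ccontV; first by rewrite (inj_eq (@complexI R) _ 0) subr_eq0.
apply: ccont_real; apply: cvgB; [exact: cvg_id|exact: cvg_cst].
Qed.

Definition fourier_sum a F N x : R[i] :=
  \sum_(i < N.*2.+1) fourier a F (i%:Z - N%:Z) * wave (i%:Z - N%:Z) x.

(** Chernoff's proof that a Fourier series converges where the function is
    differentiable: dividing [F - F x] by [expi - expi x] leaves a continuous
    function, multiplying back shifts its coefficients by one, and the
    symmetric partial sums telescope to two coefficients that tend to [0]. *)
Lemma fourier_sum_cvg b F x v : (forall t, ccont F t) ->
  (forall t, F (t + 2 * pi) = F t) -> b <= x <= b + 2 * pi -> curve_derive F x v ->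
  (fourier_sum b F N x : R[i]^o) @[N --> \oo] --> (F x : R[i]^o).
Proof.
move=> cF FT /andP[bx xb] dF; pose a := x - pi.
have pi0 := pi_gt0 R.
have baE k : fourier b F k = fourier a F k.
  have [xb'|xb'] := leP x (b + pi).
    apply/esym/fourier_base => //; rewrite /a; lra.
  by apply: fourier_base => //; rewrite /a; lra.
pose q := slope (@expi R) x ('i%C * expi x).
have cq t : ccont q t.
  apply: ccont_slope => [s|]; last exact: curve_derive_expi.
  exact: curve_derive_ccont (curve_derive_expi s).
have q0 t : a <= t <= a + 2 * pi -> q t != 0.
  move=> /andP[]; rewrite /a => t1 t2.
  have [->|tx] := eqVneq t x.
    by rewrite /q /slope eqxx mulf_neq0 ?expi_neq0// -modulus_eq0 modulusi oner_eq0.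
  apply/eqP => qt0; have := slopeM (@expi R) x ('i%C * expi x) t.
  rewrite -/q qt0 mul0r => /esym/eqP; rewrite subr_eq0 => /eqP ext.
  have : t - x = 0.
    apply: expi_eq1; first by apply/andP; split; lra.
    by rewrite expiD ext expiN divff ?expi_neq0.
  by move/eqP; rewrite subr_eq0 (negbTE tx).
pose h t := slope F x v t / q t.
have ch : ccont_on a (a + 2 * pi) h.
  move=> t /q0 qt0; apply: ccontM; first exact: ccont_slope.
  exact: (ccontV qt0).
have hE t : a <= t <= a + 2 * pi -> F t - F x = h t * (expi t - expi x).
  move=> /q0 qt0; rewrite -(slopeM F x v) -(slopeM (@expi R) x ('i%C * expi x)).
  by rewrite -/q /h mulrA divfK.
pose h1 t := h t * wave 1 t.
have ch1 : ccont_on a (a + 2 * pi) h1.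
  by move=> t tab; apply: (ccontM (ch t tab)); exact: ccont_wave.
have h1E k : fourier a h1 k = fourier a h (k - 1).
  congr (_ * _); apply: eq_cint => t _.
  by rewrite /h1 -mulrA !conj_wave -waveD; congr (_ * wave _ _); ring.
have FE k : fourier a F k =
    F x * (k == 0)%:R + (fourier a h (k - 1) - expi x * fourier a h k).
  have -> : fourier a F k = fourier a (F x *: wave 0 + ((- expi x) *: h + h1)) k.
    congr (_ * _); apply: eq_cint => t /hE Ft; congr (_ * _).
    transitivity (F x * wave 0 t + (- expi x * h t + h t * wave 1 t)); last by [].
    by rewrite -[LHS](subrK (F x)) Ft wave0 /wave mul1r; ring.
  have c0 : ccont_on a (a + 2 * pi) (wave 0) by move=> t _; exact: ccont_wave.
  have ck : ccont_on a (a + 2 * pi) (wave k) by move=> t _; exact: ccont_wave.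
  rewrite /fourier (fourier_form_lin _ c0 (fourier_S_lin _ ch ch1) ck).
  rewrite (fourier_form_lin _ ch ch1 ck) wave_orthonormal eq_sym.
  by rewrite -!/(fourier _ _ _) h1E mulNr [- _ + _]addrC.
pose g (j : nat) N := - (wave (j%:Z - N%:Z) x * fourier a h (j%:Z - N%:Z - 1)).
have sumE N : fourier_sum b F N x - F x = g N.*2.+1 N - g 0 N.
  have -> : fourier_sum b F N x = \sum_(i < N.*2.+1) (F x * (i == N :> nat)%:R) +
      \sum_(0 <= i < N.*2.+1) (g i.+1 N - g i N).
    rewrite big_mkord -big_split/=; apply: eq_bigr => i _.
    rewrite baE FE mulrDl; congr (_ + _).
      rewrite subr_eq0 eqz_nat; case: eqP => [->|_]; last by rewrite !mulr0 mul0r.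
      by rewrite subrr wave0 mulr1.
    rewrite /g opprK (_ : i.+1%:Z - N%:Z = i%:Z - N%:Z + 1); last by rewrite intS; ring.
    have w1 : wave 1 x = expi x by rewrite /wave mul1r.
    by rewrite addrK (waveD (i%:Z - N%:Z)) w1; ring.
  rewrite telescope_sumr// (bigD1 (inord N))//= inordK ?ltnS -?addnn ?leq_addr//.
  rewrite eqxx mulr1 big1 ?addr0; first by rewrite addrAC subrr add0r.
  move=> i; rewrite -val_eqE/= inordK ?ltnS -?addnn ?leq_addr// => /negbTE ->.
  by rewrite mulr0.
apply/cvg_modulusP => e e0; have e20 : 0 < e / 2 by rewrite divr_gt0.
have f1 := @fourier_cvg0 a h (fun N => N%:Z) ltac:(by move=> i j []) ch.
have f2 := @fourier_cvg0 a h (fun N => - N%:Z - 1)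
  ltac:(by move=> i j /addIr/oppr_inj []) ch.
move/cvgrPdist_lt : f1 => /(_ _ e20) f1; move/cvgrPdist_lt : f2 => /(_ _ e20) f2.
near=> N.
rewrite modulusB sumE (splitr e); apply: (le_lt_trans (le_modulusD _ _)).
have mw k y : modulus (- (wave k x * y)) = modulus y.
  by rewrite modulusN modulusM modulus_wave mul1r.
rewrite ltrD//.
  rewrite /g mw (_ : N.*2.+1%:Z - N%:Z - 1 = N%:Z); last by rewrite intS -addnn PoszD; ring.
  have : `|0 - modulus (fourier a h N)| < e / 2 by near: N; exact: f1.
  by rewrite sub0r normrN ger0_norm ?modulus_ge0.
rewrite modulusN /g mw sub0r.
have : `|0 - modulus (fourier a h (- N%:Z - 1))| < e / 2 by near: N; exact: f2.
by rewrite sub0r normrN ger0_norm ?modulus_ge0.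
Unshelve. all: end_near. Qed.

End Chernoff.

(** * Goursat's theorem on polar rectangles *)

Section Bisection.
Context {R : realType}.
Variables (A B C D : R) (N : R -> R -> R -> R -> R).
Hypotheses (AB : A <= B) (CD : C <= D).

Definition in_box (r1 r2 t1 t2 : R) : Prop :=
  [/\ A <= r1, r1 <= r2, r2 <= B & [/\ C <= t1, t1 <= t2 & t2 <= D]].

Let mid (x y : R) := (x + y) / 2.

Hypothesis N_quarter : forall r1 r2 t1 t2, in_box r1 r2 t1 t2 ->
  N r1 r2 t1 t2 <= N r1 (mid r1 r2) t1 (mid t1 t2) + N r1 (mid r1 r2) (mid t1 t2) t2
    + N (mid r1 r2) r2 t1 (mid t1 t2) + N (mid r1 r2) r2 (mid t1 t2) t2.

Hypothesis N_small : forall r t, A <= r <= B -> C <= t <= D -> forall e : R, 0 < e ->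
  exists2 d : R, 0 < d & forall r1 r2 t1 t2, in_box r1 r2 t1 t2 ->
    r1 <= r <= r2 -> t1 <= t <= t2 -> r2 - r1 < d -> t2 - t1 < d ->
    N r1 r2 t1 t2 <= e * (r2 - r1 + (t2 - t1)) ^+ 2.

Let half (b : bool) (I : R * R) : R * R :=
  if b then (mid I.1 I.2, I.2) else (I.1, mid I.1 I.2).
Let box : Type := ((R * R) * (R * R))%type.
Let M (Q : box) := N Q.1.1 Q.1.2 Q.2.1 Q.2.2.
Let quarter b c (Q : box) : box := (half b Q.1, half c Q.2).
Let next (Q : box) : box :=
  if M Q <= 4 * M (quarter false false Q) then quarter false false Q
  else if M Q <= 4 * M (quarter false true Q) then quarter false true Q
  else if M Q <= 4 * M (quarter true false Q) then quarter true false Q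
  else quarter true true Q.
Let Q_ n : box := iter n next ((A, B), (C, D)).
Let inbox (Q : box) := in_box Q.1.1 Q.1.2 Q.2.1 Q.2.2.

Let next_quarter Q : inbox Q -> M Q <= 4 * M (next Q) /\ exists b c, next Q = quarter b c Q.
Proof.
move=> iQ; rewrite /next; case: ifP => [h|/negbT]; first by split=> //; exists false, false.
rewrite -ltNge => h1; case: ifP => [h|/negbT]; first by split=> //; exists false, true.
rewrite -ltNge => h2; case: ifP => [h|/negbT]; first by split=> //; exists true, false.
rewrite -ltNge => h3; split; last by exists true, true.
have := N_quarter iQ; move: h1 h2 h3; rewrite /M/=; lra.
Qed.

Let half_le b (I : R * R) : I.1 <= I.2 ->
  [/\ I.1 <= (half b I).1, (half b I).1 <= (half b I).2, (half b I).2 <= I.2 &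
      (half b I).2 - (half b I).1 = (I.2 - I.1) / 2].
Proof. by case: I => x y /= xy; case: b => /=; rewrite /mid; split; lra. Qed.

Let Q_inbox n : inbox (Q_ n).
Proof.
elim: n => [|n [a1 a2 a3 [a4 a5 a6]]]; first by split.
have [_ [b [c E]]] := next_quarter (And4 a1 a2 a3 (And3 a4 a5 a6)).
rewrite /inbox /= -/(Q_ n) E.
have [b1 b2 b3 _] := half_le b a2; have [c1 c2 c3 _] := half_le c a5.
by split; [| | |split]; rewrite /quarter //=; lra.
Qed.

Let Q_step n : exists b c, Q_ n.+1 = quarter b c (Q_ n).
Proof. by have [_] := next_quarter (Q_inbox n). Qed.

Let Q_size n : ((Q_ n).1.2 - (Q_ n).1.1 = (B - A) / 2 ^+ n) /\
  ((Q_ n).2.2 - (Q_ n).2.1 = (D - C) / 2 ^+ n).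
Proof.
elim: n => [|n [ih1 ih2]]; first by rewrite !expr0 !divr1.
have [b [c ->]] := Q_step n; have [_ a2 _ [_ a5 _]] := Q_inbox n.
have [_ _ _ ->] := half_le b a2; have [_ _ _ ->] := half_le c a5.
by rewrite ih1 ih2 exprS invfM !mulrA ![_ / 2]mulrC !mulrA.
Qed.

Let M_size n : M (Q_ 0) <= 4 ^+ n * M (Q_ n).
Proof.
elim: n => [|n ih]; first by rewrite mul1r.
apply: (le_trans ih); rewrite exprSr -mulrA ler_wpM2l ?exprn_ge0//.
by have [] := next_quarter (Q_inbox n).
Qed.

Let sub (f g : box -> R) : (forall n, f (Q_ n) <= f (Q_ n.+1)) ->
  (forall n, g (Q_ n.+1) <= g (Q_ n)) -> (forall n, f (Q_ n) <= g (Q_ n)) ->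
  exists x, forall n, f (Q_ n) <= x <= g (Q_ n).
Proof.
move=> f1 g1 fg.
have fm : {homo (fun n => f (Q_ n)) : n m / (n <= m)%N >-> n <= m} by exact/nondecreasing_seqP.
have gm : {homo (fun n => g (Q_ n)) : n m / (n <= m)%N >-> m <= n} by exact/nonincreasing_seqP.
have fgm n m : f (Q_ n) <= g (Q_ m).
  apply: (le_trans (fm _ _ (leq_maxl n m))); apply: (le_trans (fg _)).
  exact: (gm _ _ (leq_maxr n m)).
exists (sup (range (fun n => f (Q_ n)))) => n; apply/andP; split.
  apply: ub_le_sup; last by exists n.
  by exists (g (Q_ 0)) => _ [m _ <-].
by apply: ge_sup; [exists (f (Q_ 0)); exists 0%N|move=> _ [m _ <-]].
Qed.

(** One of the four quarters of a box carries at least a fourth of the value of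
    [N].  Boxes chosen in this way shrink to a point, where the bound of second
    order contradicts a positive value. *)
Lemma bisection_vanish : N A B C D <= 0.
Proof.
have [r rP] : exists x, forall n, (Q_ n).1.1 <= x <= (Q_ n).1.2.
  apply: (sub (f := fun Q => Q.1.1) (g := fun Q => Q.1.2)) => n.
  - have [b [c ->]] := Q_step n; have [_ a2 _ _] := Q_inbox n.
    by have [] := half_le b a2.
  - have [b [c ->]] := Q_step n; have [_ a2 _ _] := Q_inbox n.
    by have [] := half_le b a2.
  - by have [] := Q_inbox n.
have [t tP] : exists x, forall n, (Q_ n).2.1 <= x <= (Q_ n).2.2.
  apply: (sub (f := fun Q => Q.2.1) (g := fun Q => Q.2.2)) => n.
  - have [b [c ->]] := Q_step n; have [_ _ _ [_ a5 _]] := Q_inbox n.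
    by have [] := half_le c a5.
  - have [b [c ->]] := Q_step n; have [_ _ _ [_ a5 _]] := Q_inbox n.
    by have [] := half_le c a5.
  - by have [_ _ _ []] := Q_inbox n.
rewrite leNgt; apply/negP => N0.
pose L := (B - A + (D - C)) ^+ 2 + 1; have L0 : 0 < L by rewrite ltr_wpDl ?sqr_ge0.
have e0 : 0 < N A B C D / (2 * L) by rewrite divr_gt0 ?mulr_gt0.
have [d d0 dP] := N_small (rP 0) (tP 0) e0.
have [n [nB nD]] : exists n, (B - A) / 2 ^+ n < d /\ (D - C) / 2 ^+ n < d.
  have c1 : (B - A) / 2 ^+ n @[n --> \oo] --> (0 : R).
    rewrite -(mulr0 (B - A)); apply: cvgM; first exact: cvg_cst.
    under eq_fun do rewrite -exprVn.
    by apply: cvg_expr; rewrite ger0_norm ?invr_ge0// invf_lt1// ltr1n.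
  have c2 : (D - C) / 2 ^+ n @[n --> \oo] --> (0 : R).
    rewrite -(mulr0 (D - C)); apply: cvgM; first exact: cvg_cst.
    under eq_fun do rewrite -exprVn.
    by apply: cvg_expr; rewrite ger0_norm ?invr_ge0// invf_lt1// ltr1n.
  have [n [h1 h2]] : exists n, (`|0 - (B - A) / 2 ^+ n| < d) /\ (`|0 - (D - C) / 2 ^+ n| < d).
    move/cvgrPdist_lt : c1 => /(_ _ d0) c1; move/cvgrPdist_lt : c2 => /(_ _ d0) c2.
    by have [n _ nP] := filterI c1 c2; exists n; exact: nP n (leqnn n).
  exists n; move: h1 h2; rewrite !sub0r !normrN => h1 h2; split.
    exact: le_lt_trans (ler_norm _) h1.
  exact: le_lt_trans (ler_norm _) h2.
have [s1 s2] := Q_size n.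
have := dP _ _ _ _ (Q_inbox n) (rP n) (tP n); rewrite s1 s2 => /(_ nB nD) MQ.
have := M_size n; rewrite {1}/M/= => NQ.
have p0 : (0 : R) < 2 ^+ n by rewrite exprn_gt0.
have : N A B C D <= N A B C D / (2 * L) * (B - A + (D - C)) ^+ 2.
  apply: (le_trans NQ); rewrite -[leRHS]mul1r.
  have -> : N A B C D / (2 * L) * (B - A + (D - C)) ^+ 2 =
      4 ^+ n * (N A B C D / (2 * L) * ((B - A) / 2 ^+ n + (D - C) / 2 ^+ n) ^+ 2).
    rewrite -mulrDl expr_div_n -exprM mulnC exprM -[2 ^+ 2]/(2 * 2) (_ : 2 * 2 = 4 :> R); last by ring.
    by field; rewrite !gt_eqF// exprn_gt0.
  by rewrite mul1r ler_wpM2l// exprn_ge0.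
apply/negP; rewrite -ltNge -mulrA gtr_pMr// mulrC ltr_pdivrMr ?mulr_gt0// mul1r.
by rewrite /L; have := sqr_ge0 (B - A + (D - C)); lra.
Qed.

End Bisection.

Section Goursat.
Context {R : realType}.
Variable F : R[i] -> R[i].
Implicit Types (r t : R).

Definition polar r t : R[i] := r%:C%C * expi t.

Lemma modulus_polar r t : 0 <= r -> modulus (polar r t) = r.
Proof. by move=> r0; rewrite modulusM modulus_real modulus_expi mulr1 ger0_norm. Qed.

Lemma modulus_polarE r t : modulus (polar r t) = `|r|.
Proof. by rewrite modulusM modulus_real modulus_expi mulr1. Qed.

Lemma curve_derive_arc r t : curve_derive (polar r) t ('i%C * polar r t).
Proof.
apply: curve_derive_eq (curve_deriveM (curve_derive_cst _ _) (curve_derive_expi t)) _.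
by rewrite mul0r add0r /polar; ring.
Qed.

Lemma curve_derive_ray r t : curve_derive (polar^~ t) r (expi t).
Proof.
apply: curve_derive_eq.
  apply: (curve_deriveM (curve_derive_real (is_derive_id r (1 : R))) (curve_derive_cst _ _)).
by rewrite mulr0 addr0 mul1r.
Qed.

Definition arc_int G r t1 t2 : R[i] := cint t1 t2 (fun t => G (polar r t) * ('i%C * polar r t)).
Definition ray_int G t r1 r2 : R[i] := cint r1 r2 (fun r => G (polar r t) * expi t).
(** The integral of [G] along the boundary of a box in polar coordinates. *)
Definition around (G : R[i] -> R[i]) r1 r2 t1 t2 : R[i] :=
  arc_int G r2 t1 t2 - arc_int G r1 t1 t2 - ray_int G t2 r1 r2 + ray_int G t1 r1 r2.

(** Wrapped for the same reason as [ccont]. *)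
Variant polar_cont (G : R[i] -> R[i]) r t : Prop :=
  PolarCont of {for polar r t : R[i]^o, continuous (G : R[i]^o -> R[i]^o)}.

Lemma polar_contB G H r t : polar_cont G r t -> polar_cont H r t ->
  polar_cont (fun z => G z - H z) r t.
Proof. by move=> [cG] [cH]; split; exact: (@cvgB _ (R[i]^o) _ _ _ _ _ _ _ cG cH). Qed.

Lemma ccont_arc G r t : polar_cont G r t ->
  ccont (fun t => G (polar r t) * ('i%C * polar r t)) t.
Proof.
move=> [cG]; have cz := curve_derive_ccont (curve_derive_arc r t).
apply: ccontM; first exact: (ccont_comp cz cG).
by apply: (ccontM _ cz); exact: ccont_cst.
Qed.

Lemma ccont_ray G r t : polar_cont G r t -> ccont (fun r => G (polar r t) * expi t) r.
Proof.
move=> [cG]; have cz := curve_derive_ccont (curve_derive_ray r t).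
apply: ccontM; first exact: (ccont_comp cz cG).
exact: ccont_cst.
Qed.

Lemma aroundB (G H : R[i] -> R[i]) r1 r2 t1 t2 : r1 <= r2 -> t1 <= t2 ->
  (forall r t, r1 <= r <= r2 -> t1 <= t <= t2 -> polar_cont G r t /\ polar_cont H r t) ->
  around (fun z => G z - H z) r1 r2 t1 t2 = around G r1 r2 t1 t2 - around H r1 r2 t1 t2.
Proof.
move=> r12 t12 c.
have arcB r : r1 <= r <= r2 -> arc_int (fun z => G z - H z) r t1 t2 = arc_int G r t1 t2 - arc_int H r t1 t2.
  move=> rr; rewrite -cintB.
  - by apply: eq_cint => t _; rewrite mulrBl.
  - by move=> t tt; apply: ccont_arc; have [] := c r t rr tt.
  - by move=> t tt; apply: ccont_arc; have [] := c r t rr tt.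
have rayB t : t1 <= t <= t2 -> ray_int (fun z => G z - H z) t r1 r2 = ray_int G t r1 r2 - ray_int H t r1 r2.
  move=> tt; rewrite -cintB.
  - by apply: eq_cint => r _; rewrite mulrBl.
  - by move=> r rr; apply: ccont_ray; have [] := c r t rr tt.
  - by move=> r rr; apply: ccont_ray; have [] := c r t rr tt.
rewrite /around !arcB ?lexx ?r12// !rayB ?lexx ?t12//.
by move: (arc_int _ _ _ _) (arc_int _ _ _ _) (arc_int _ _ _ _) (arc_int _ _ _ _)
  (ray_int _ _ _ _) (ray_int _ _ _ _) (ray_int _ _ _ _) (ray_int _ _ _ _) => *; ring.
Qed.

Lemma around_quarter G r1 rm r2 t1 tm t2 : r1 <= rm <= r2 -> t1 <= tm <= t2 ->
  (forall r t, r1 <= r <= r2 -> t1 <= t <= t2 -> polar_cont G r t) ->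
  around G r1 r2 t1 t2 = around G r1 rm t1 tm + around G r1 rm tm t2
    + around G rm r2 t1 tm + around G rm r2 tm t2.
Proof.
move=> /andP[rm1 rm2] /andP[tm1 tm2] c.
have arcE r : r1 <= r <= r2 -> arc_int G r t1 t2 = arc_int G r t1 tm + arc_int G r tm t2.
  move=> rr; apply: cint_cat; first by rewrite tm1.
  by move=> t tt; apply: ccont_arc; exact: c.
have rayE t : t1 <= t <= t2 -> ray_int G t r1 r2 = ray_int G t r1 rm + ray_int G t rm r2.
  move=> tt; apply: cint_cat; first by rewrite rm1.
  by move=> r rr; apply: ccont_ray; exact: c.
have r12 := le_trans rm1 rm2; have t12 := le_trans tm1 tm2.
rewrite /around !arcE ?lexx ?r12// !rayE ?lexx ?t12//.
move: (arc_int G r1 t1 tm) (arc_int G r1 tm t2) (arc_int G rm t1 tm) (arc_int G rm tm t2)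
  (arc_int G r2 t1 tm) (arc_int G r2 tm t2) => a1 a2 a3 a4 a5 a6.
move: (ray_int G t1 r1 rm) (ray_int G t1 rm r2) (ray_int G tm r1 rm) (ray_int G tm rm r2)
  (ray_int G t2 r1 rm) (ray_int G t2 rm r2) => b1 b2 b3 b4 b5 b6.
ring.
Qed.

Lemma polar_cont_affine (c d z0 : R[i]) r t : polar_cont (fun z => c + d * (z - z0)) r t.
Proof.
split; apply: (@is_derive_complex_continuous _ _ _ d); apply/is_derive_complexP => e e0.
exists 1 => // w _; rewrite (_ : _ - _ - _ = 0); last by ring.
by rewrite modulus0 mulr_ge0 ?modulus_ge0// ltW.
Qed.

(** An affine function has a primitive, so its integral around a closed curve
    vanishes. *)
Lemma around_affine (c d z0 : R[i]) r1 r2 t1 t2 : r1 <= r2 -> t1 <= t2 ->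
  around (fun z => c + d * (z - z0)) r1 r2 t1 t2 = 0.
Proof.
move=> r12 t12; pose P z : R[i] := c * z + d / 2 * ((z - z0) * (z - z0)).
have dP (g : R -> R[i]) s v : curve_derive g s v ->
    curve_derive (fun s => P (g s)) s ((c + d * (g s - z0)) * v).
  move=> dg; have dz := curve_deriveD dg (curve_derive_cst (- z0) s).
  have := curve_deriveD (curve_deriveM (curve_derive_cst c s) dg)
    (curve_deriveM (curve_derive_cst (d / 2) s) (curve_deriveM dz dz)).
  by move/curve_derive_eq; apply; field.
have cA r t : polar_cont (fun z => c + d * (z - z0)) r t by exact: polar_cont_affine.
have arcE r : arc_int (fun z => c + d * (z - z0)) r t1 t2 = P (polar r t2) - P (polar r t1).
  apply: (cint_FTC (G := fun t => P (polar r t))) => // [t _|t _]; last exact: (ccont_arc (cA r t)).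
  by apply: dP; exact: curve_derive_arc.
have rayE t : ray_int (fun z => c + d * (z - z0)) t r1 r2 = P (polar r2 t) - P (polar r1 t).
  apply: (cint_FTC (G := fun r => P (polar r t))) => // [r _|r _]; last exact: (ccont_ray (cA r t)).
  by apply: (dP (polar^~ t)); exact: curve_derive_ray.
by rewrite /around !arcE !rayE; ring.
Qed.

Lemma le_modulus_around G M r1 r2 t1 t2 : 0 <= r1 -> r1 <= r2 -> r2 <= 1 -> t1 <= t2 ->
  (forall r t, r1 <= r <= r2 -> t1 <= t <= t2 -> polar_cont G r t) ->
  (forall r t, r1 <= r <= r2 -> t1 <= t <= t2 -> modulus (G (polar r t)) <= M) ->
  modulus (around G r1 r2 t1 t2) <= 4 * M * (r2 - r1 + (t2 - t1)).
Proof.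
move=> r0 r12 r21 t12 c GM.
have M0 : 0 <= M.
  by apply: le_trans (GM r1 t1 _ _); rewrite ?modulus_ge0 ?lexx.
have arcM r : r1 <= r <= r2 -> modulus (arc_int G r t1 t2) <= 2 * M * (t2 - t1).
  move=> rr; apply: le_modulus_cint => // t tt; first by apply: ccont_arc; exact: c.
  move: (rr) => /andP[rr1 rr2].
  rewrite modulusM modulusM modulusi mul1r modulus_polar ?(le_trans r0)//.
  by rewrite -[leRHS]mulr1 ler_pM ?modulus_ge0 ?GM// ?(le_trans r0)// (le_trans rr2).
have rayM t : t1 <= t <= t2 -> modulus (ray_int G t r1 r2) <= 2 * M * (r2 - r1).
  move=> tt; apply: le_modulus_cint => // r rr; first by apply: ccont_ray; exact: c.
  by rewrite modulusM modulus_expi mulr1 GM.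
rewrite /around; apply: (le_trans (le_modulusD _ _)).
have h1 := le_modulusD (arc_int G r2 t1 t2 - arc_int G r1 t1 t2) (- ray_int G t2 r1 r2).
have h2 := le_modulusD (arc_int G r2 t1 t2) (- arc_int G r1 t1 t2).
move: h1 h2; rewrite !modulusN.
have := arcM r1; have := arcM r2; have := rayM t1; have := rayM t2.
rewrite !lexx r12 t12 => /(_ isT) a1 /(_ isT) a2 /(_ isT) a3 /(_ isT) a4.
move: a1 a2 a3 a4; move: (modulus _) (modulus (_ - _)) (modulus _) (modulus _) (modulus _) (modulus _).
by move=> *; lra.
Qed.

Lemma le_modulus_polarB r t r' t' : 0 <= r <= 1 -> 
  modulus (polar r t - polar r' t') <= `|r - r'| + 2 * `|t - t'|.
Proof.
move=> /andP[r0 r1].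
have -> : polar r t - polar r' t' = (r - r')%:C%C * expi t' + r%:C%C * (expi t - expi t').
  by rewrite /polar rmorphB/=; ring.
apply: (le_trans (le_modulusD _ _)); rewrite !modulusM !modulus_real modulus_expi mulr1 lerD2l.
rewrite (ger0_norm r0); apply: (@le_trans _ _ (1 * modulus (expi t - expi t'))).
  by rewrite ler_wpM2r ?modulus_ge0.
rewrite mul1r.
wlog tt : t t' / t' <= t.
  move=> H; have [|/ltW] := leP t' t; first exact: H.
  by rewrite modulusB distrC; exact: H.
have cE s : ccont (fun s => 'i%C * expi s) s.
  by apply: ccontM; [exact: ccont_cst|exact: curve_derive_ccont (curve_derive_expi s)].
rewrite -(@cint_FTC _ (fun s => 'i%C * expi s) _ t' t)// => [|s _]; last exact: curve_derive_expi.
rewrite (ger0_norm (_ : 0 <= t - t')) ?subr_ge0//.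
apply: (le_trans (@le_modulus_cint _ _ _ _ 1 tt _ _)) => //; last by rewrite mulr1.
by move=> s _; rewrite modulusM modulusi modulus_expi mulr1.
Qed.

(** Close to a point [F] differs from its affine approximation by little
    compared with the size of the box, and the integral of the affine part
    vanishes: the hypotheses of [bisection_vanish] hold for the modulus of the
    integral around a box. *)
Lemma goursat A B C D : 0 <= A -> A <= B -> B <= 1 -> C <= D ->
  (forall r t, A <= r <= B -> C <= t <= D ->
     derivable (F : R[i]^o -> R[i]^o) (polar r t : R[i]^o) 1) ->
  around F A B C D = 0.
Proof.
move=> A0 AB B1 CD dF.
have cF r t : A <= r <= B -> C <= t <= D -> polar_cont F r t.
  by move=> rr tt; split; apply: differentiable_continuous; apply/derivable1_diffP; exact: dF.
apply/eqP; rewrite -modulus_eq0 eq_le modulus_ge0 andbT.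
apply: (@bisection_vanish R A B C D (fun r1 r2 t1 t2 => modulus (around F r1 r2 t1 t2))) => //.
  move=> r1 r2 t1 t2 [a1 a2 a3 [a4 a5 a6]].
  rewrite (@around_quarter F r1 ((r1 + r2) / 2) r2 t1 ((t1 + t2) / 2) t2); first 1 last.
  - by apply/andP; split; lra.
  - by apply/andP; split; lra.
  - by move=> r t /andP[? ?] /andP[? ?]; apply: cF; apply/andP; split; lra.
  do 3! (apply: (le_trans (le_modulusD _ _)); rewrite lerD2r).
  by [].
move=> r t rr tt e e0.
have [d dd] : exists d, is_derive (polar r t : R[i]^o) 1 (F : R[i]^o -> R[i]^o) d.
  by exists ('D_1 (F : R[i]^o -> R[i]^o) (polar r t : R[i]^o)); apply/derivableP; exact: dF.
move/is_derive_complexP : dd => /(_ (e / 8)); rewrite divr_gt0// => /(_ isT)[s s0 sP].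
exists (s / 4); first by rewrite divr_gt0.
move=> r1 r2 t1 t2 [a1 a2 a3 [a4 a5 a6]] /andP[rr1 rr2] /andP[tt1 tt2] ds dt.
pose L z := F (polar r t) + d * (z - polar r t).
have sz r' t' : r1 <= r' <= r2 -> t1 <= t' <= t2 ->
    modulus (polar r' t' - polar r t) <= (r2 - r1) + 2 * (t2 - t1).
  move=> /andP[b1 b2] /andP[b3 b4].
  apply: (le_trans (le_modulus_polarB _ _ _ _)); first by apply/andP; split; lra.
  by rewrite lerD ?ler_pM2l// ler_norml; apply/andP; split; lra.
have cF' r' t' : r1 <= r' <= r2 -> t1 <= t' <= t2 -> polar_cont F r' t'.
  by move=> /andP[? ?] /andP[? ?]; apply: cF; apply/andP; split; lra.
have cL r' t' : polar_cont L r' t' by exact: polar_cont_affine.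
have -> : around F r1 r2 t1 t2 = around (fun z => F z - L z) r1 r2 t1 t2.
  by rewrite aroundB// ?around_affine ?subr0// => r' t' ? ?; split; [exact: cF'|exact: cL].
have cE r' t' : r1 <= r' <= r2 -> t1 <= t' <= t2 -> polar_cont (fun z => F z - L z) r' t'.
  by move=> b1 b2; apply: polar_contB; [exact: cF'|exact: cL].
apply: (le_trans (@le_modulus_around _ (e / 8 * (r2 - r1 + 2 * (t2 - t1))) _ _ _ _ _ _ _ _ cE _)) => //.
- exact: le_trans A0 a1.
- exact: le_trans a3 B1.
- move=> r' t' b1 b2; have b3 := sz r' t' b1 b2.
  rewrite /L opprD addrA; apply: (le_trans (sP _ _)); last by rewrite ler_pM2l ?divr_gt0.
  by apply: (le_lt_trans b3); lra.
have x0 : 0 <= r2 - r1 by lra.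
have y0 : 0 <= t2 - t1 by lra.
move: x0 y0; set x := r2 - r1; set y := t2 - t1 => x0 y0.
rewrite -subr_ge0; have -> : e * (x + y) ^+ 2 - 4 * (e / 8 * (x + 2 * y)) * (x + y) =
    e / 2 * (x + y) * x by field.
have e2 : 0 <= e / 2 by rewrite divr_ge0 ?ltW.
exact: (mulr_ge0 (mulr_ge0 e2 (addr_ge0 x0 y0)) x0).
Qed.

End Goursat.

(** * Complex power series *)

Section PowerSeries.
Context {R : realType}.
Implicit Types (a : nat -> R[i]) (z w : R[i]).

(** Convergence of complex sequences, with the topology of the complex field
    unfolded. *)
Definition ccvg (u : nat -> R[i]) (l : R[i]) : Prop :=
  forall e : R, 0 < e -> \forall n \near \oo, modulus (l - u n) < e.

Lemma ccvgD u v l m : ccvg u l -> ccvg v m -> ccvg (fun n => u n + v n) (l + m).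
Proof.
move=> ul vm e e0; have e20 : 0 < e / 2 by rewrite divr_gt0.
apply: filterS2 (ul _ e20) (vm _ e20) => n h1 h2.
rewrite opprD addrACA (splitr e); apply: (le_lt_trans (le_modulusD _ _)).
exact: ltrD.
Qed.

Lemma ccvgM u l (c : R[i]) : ccvg u l -> ccvg (fun n => u n * c) (l * c).
Proof.
move=> ul e e0; have c0 : 0 < modulus c + 1 by rewrite ltr_wpDl ?modulus_ge0.
have e20 : 0 < e / (modulus c + 1) by rewrite divr_gt0.
apply: filterS (ul _ e20) => n; rewrite ltr_pdivlMr// -mulrBl modulusM => h.
by apply: le_lt_trans h; rewrite ler_wpM2l ?modulus_ge0// lerDl.
Qed.

Lemma ccvgN u l : ccvg u l -> ccvg (fun n => - u n) (- l).
Proof.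
move=> ul e e0; apply: filterS (ul e e0) => n.
by rewrite -opprD modulusN.
Qed.

Lemma ccvgS u l : ccvg u l -> ccvg (fun n => u n.+1) l.
Proof.
move=> ul e e0; have [n _ nP] := ul e e0; exists n => // m /= nm.
by apply: nP => /=; exact: leqW.
Qed.

Lemma ccvg_modulus_le u l (M : R) : ccvg u l ->
  (\forall n \near \oo, modulus (u n) <= M) -> modulus l <= M.
Proof.
move=> ul uM; apply/ler_addgt0Pr => e e0.
have [n _ nP] := filterI (ul e e0) uM; have [h1 h2] := nP n (leqnn n).
rewrite -[l](subrK (u n)); apply: (le_trans (le_modulusD _ _)).
by rewrite addrC lerD// ltW.
Qed.

Lemma ccvg_unique u l m : ccvg u l -> ccvg u m -> l = m.
Proof.
move=> ul um; apply/eqP; rewrite -subr_eq0 -modulus_eq0 eq_le modulus_ge0 andbT.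
apply: (@ccvg_modulus_le (fun n => u n - u n)); first exact: ccvgD ul (ccvgN um).
by apply: nearW => n; rewrite subrr modulus0.
Qed.

Definition psum a N z : R[i] := \sum_(i < N) a i * z ^+ i.

(** A radius of convergence of at least [1]. *)
Definition disc_coefs a : Prop := forall r : R, 0 < r < 1 ->
  exists M, forall n, modulus (a n) * r ^+ n <= M.

Definition dcoef a n : R[i] := n.+1%:R * a n.+1.

Definition psval a z : R[i] :=
  (lim ((fun N => complex.Re (psum a N z)) @ \oo) +i*
   lim ((fun N => complex.Im (psum a N z)) @ \oo))%C.

Lemma geometric_sum_le (q : R) N : 0 <= q < 1 -> \sum_(i < N) q ^+ i <= (1 - q)^-1.
Proof.
move=> /andP[q0 q1]; have q10 : 0 < 1 - q by rewrite subr_gt0.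
rewrite -[leRHS]mul1r ler_pdivlMr//.
have -> : (\sum_(i < N) q ^+ i) * (1 - q) = 1 - q ^+ N.
  by rewrite -[RHS]opprB subrX1; ring.
by rewrite gerBl exprn_ge0.
Qed.

Lemma disc_coefs_sum a (r : R) : disc_coefs a -> 0 <= r < 1 ->
  exists K, forall N, \sum_(i < N) modulus (a i) * r ^+ i <= K.
Proof.
move=> Ha /andP[r0 r1]; pose p := (r + 1) / 2.
have p01 : 0 < p < 1 by apply/andP; rewrite /p; split; lra.
have [M MP] := Ha p p01; move: p01 => /andP[p0 p1].
have M0 : 0 <= M by apply: le_trans (MP 0%N); rewrite mulr_ge0 ?modulus_ge0.
pose q := r / p; have q01 : 0 <= q < 1.
  by rewrite /q divr_ge0 ?(ltW p0)//= ltr_pdivrMr// mul1r /p; lra.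
exists (M * (1 - q)^-1) => N; apply: (@le_trans _ _ (\sum_(i < N) M * q ^+ i)).
  have rE : r = p * q by rewrite /q mulrCA divff ?mulr1 ?gt_eqF.
  apply: ler_sum => i _; rewrite [in leLHS]rE exprMn mulrA ler_wpM2r ?MP// exprn_ge0//.
  by case/andP : q01.
by rewrite -mulr_sumr ler_wpM2l// geometric_sum_le.
Qed.

Lemma psum_cvg a z : disc_coefs a -> modulus z < 1 ->
  ccvg (psum a ^~ z) (psval a z).
Proof.
move=> Ha z1; apply/cvg_modulusP; have z01 : 0 <= modulus z < 1 by rewrite modulus_ge0.
have [K KP] := disc_coefs_sum Ha z01.
have cabs (g : R[i] -> R) : (forall x, `|g x| <= modulus x) -> g 0 = 0 ->
    (forall x y, g (x + y) = g x + g y) -> cvgn (fun N => g (psum a N z)).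
  move=> gm g0 gD.
  have -> : (fun N => g (psum a N z)) = series (fun i => g (a i * z ^+ i)).
    apply/funext => N; rewrite /series/= big_mkord /psum.
    by elim: N => [|N ih]; rewrite ?big_ord0// !big_ord_recr/= gD ih.
  apply: normed_cvg; apply: (@series_le_cvg _ _ (fun i => modulus (a i) * modulus z ^+ i)).
  - by move=> i; rewrite normr_ge0.
  - by move=> i; rewrite mulr_ge0 ?modulus_ge0 ?exprn_ge0 ?modulus_ge0.
  - by move=> i /=; apply: (le_trans (gm _)); rewrite modulusM modulusX.
  - apply: nondecreasing_is_cvgn.
      apply/nondecreasing_seqP => n; rewrite /series/= big_nat_recr//= lerDl.
      by rewrite mulr_ge0 ?modulus_ge0 ?exprn_ge0 ?modulus_ge0.
    by exists K => _ [n _ <-]; rewrite /series/= big_mkord.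
apply/cvg_ReImP; split.
  by apply: cabs => //; [exact: le_Re_modulus|exact: Re_add].
by apply: cabs => //; [exact: le_Im_modulus|exact: Im_add].
Qed.

(** The factor [n + 1] is absorbed by a slightly larger radius. *)
Lemma disc_coefs_dcoef a : disc_coefs a -> disc_coefs (dcoef a).
Proof.
move=> Ha r /andP[r0 r1]; pose p := (r + 1) / 2.
have p01 : 0 < p < 1 by apply/andP; rewrite /p; split; lra.
have [M MP] := Ha p p01; move: p01 => /andP[p0 p1].
have M0 : 0 <= M by apply: le_trans (MP 0%N); rewrite mulr_ge0 ?modulus_ge0.
pose q := r / p; have q01 : 0 <= q < 1.
  by rewrite /q divr_ge0 ?(ltW p0) ?(ltW r0)//= ltr_pdivrMr// mul1r /p; lra.
have [q0 q1] := andP q01.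
exists (M / p * (1 - q)^-1) => n; rewrite /dcoef modulusM modulus_nat.
have nq : n.+1%:R * q ^+ n <= (1 - q)^-1.
  apply: le_trans (geometric_sum_le n.+1 q01).
  rewrite -[X in X%:R * _]card_ord -sum1_card natr_sum mulr_suml.
  apply: ler_sum => i _; rewrite mul1r ler_wiXn2l ?(ltW q1)//.
  by rewrite -ltnS.
have -> : n.+1%:R * modulus (a n.+1) * r ^+ n =
    modulus (a n.+1) * p ^+ n.+1 / p * (n.+1%:R * q ^+ n).
  have rE : r = p * q by rewrite /q mulrCA divff ?mulr1 ?gt_eqF.
  by rewrite [in LHS]rE exprMn exprSr [_ * (_ * p)]mulrA mulfK ?gt_eqF//; ring.
apply: ler_pM => //.
- by rewrite divr_ge0 ?(ltW p0)// mulr_ge0 ?modulus_ge0// exprn_ge0 ?ltW.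
- by rewrite mulr_ge0 ?exprn_ge0.
- by rewrite ler_wpM2r ?invr_ge0 ?(ltW p0).
Qed.

Lemma le_expr_remainder z w (r : R) n : modulus z <= r -> modulus w <= r ->
  modulus (w ^+ n - z ^+ n - n%:R * z ^+ n.-1 * (w - z)) <=
  (n * n.-1)%:R * r ^+ n.-2 * modulus (w - z) ^+ 2.
Proof.
move=> zr wr; have r0 : 0 <= r := le_trans (modulus_ge0 z) zr.
case: n => [|n]; first by rewrite !expr0 subrr mulr0n !mul0r subr0 modulus0.
elim: n => [|n ih].
  by rewrite !expr1 expr0 mulr1 mul1r subrr modulus0 muln0 !mul0r.
have -> : w ^+ n.+2 - z ^+ n.+2 - n.+2%:R * z ^+ n.+2.-1 * (w - z) =
   w * (w ^+ n.+1 - z ^+ n.+1 - n.+1%:R * z ^+ n * (w - z)) +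
   n.+1%:R * z ^+ n * (w - z) ^+ 2.
  by rewrite /= !exprS -[n.+2%:R]natr1 -[n.+1%:R]natr1; ring.
apply: (le_trans (le_modulusD _ _)); rewrite modulusM (modulusM (_ * _)) (modulusM _%:R) modulus_nat !modulusX.
have h1 : modulus w * modulus (w ^+ n.+1 - z ^+ n.+1 - n.+1%:R * z ^+ n * (w - z))
    <= (n.+1 * n)%:R * r ^+ n * modulus (w - z) ^+ 2.
  apply: le_trans (ler_pM (modulus_ge0 _) (modulus_ge0 _) wr ih) _.
  rewrite /= mulrA mulrCA; case: n {ih} => [|n]; first by rewrite muln0 !(mul0r, mulr0).
  by rewrite [n.+1.-1]/= exprS expr2 le_eqVlt; apply/orP; left; apply/eqP; ring.
have h2 : n.+1%:R * modulus z ^+ n * modulus (w - z) ^+ 2 <=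
    n.+1%:R * r ^+ n * modulus (w - z) ^+ 2.
  by rewrite ler_wpM2r ?sqr_ge0// ler_wpM2l// lerXn2r ?nnegrE ?modulus_ge0.
apply: (le_trans (lerD h1 h2)); rewrite -!mulrDl -natrD /= .
rewrite ler_wpM2r ?sqr_ge0// ler_wpM2r ?exprn_ge0// ler_nat.
by rewrite -mulnSr leq_mul2r leqnSn orbT.
Qed.

(** The remainders of the monomials are of second order, with coefficients that
    are those of the second derivative of the series of moduli, which
    converges. *)
Lemma is_derive_psval a (z : R[i]^o) : disc_coefs a -> modulus z < 1 ->
  is_derive z 1 (psval a : R[i]^o -> R[i]^o) (psval (dcoef a) z).
Proof.
move=> Ha z1; pose r := (modulus z + 1) / 2.
have r01 : 0 <= r < 1 by have := modulus_ge0 z; rewrite /r => ?; apply/andP; split; lra.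
have [K KP] := disc_coefs_sum (disc_coefs_dcoef (disc_coefs_dcoef Ha)) r01.
have K0 : 0 <= K by apply: le_trans (KP 0%N); rewrite big_ord0.
have key w : modulus (w - z) < r - modulus z ->
    modulus (psval a w - psval a z - psval (dcoef a) z * (w - z)) <= K * modulus (w - z) ^+ 2.
  move=> wz; have wr : modulus w <= r.
    rewrite -[w](subrK z); apply: (le_trans (le_modulusD _ _)).
    by rewrite -lerBrDr ltW.
  have w1 : modulus w < 1 by move: r01 => /andP[_]; exact: le_lt_trans.
  have cw := psum_cvg Ha w1; have cz := psum_cvg Ha z1.
  have cdz := psum_cvg (disc_coefs_dcoef Ha) z1.
  apply: (@ccvg_modulus_le (fun N => psum a N.+1 w - psum a N.+1 z -
     psum (dcoef a) N z * (w - z)) _ _).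
    exact: (ccvgD (ccvgD (ccvgS cw) (ccvgN (ccvgS cz))) (ccvgN (ccvgM (w - z) cdz))).
  apply: nearW => N.
  have -> : psum a N.+1 w - psum a N.+1 z - psum (dcoef a) N z * (w - z) =
      \sum_(i < N.+1) a i * (w ^+ i - z ^+ i - i%:R * z ^+ i.-1 * (w - z)).
    rewrite /psum mulr_suml [in RHS]big_ord_recl !big_ord_recl !expr0 /= mul0r mul0r.
    rewrite subr0 subrr mulr0 add0r !mulr1 opprD addrACA subrr add0r -!sumrB.
    by apply: eq_bigr => i _; rewrite /dcoef /bump/= add1n /=; ring.
  apply: (le_trans (le_modulus_sum _ _)).
  apply: (@le_trans _ _ ((\sum_(i < N.+1) modulus (a i) * ((i * i.-1)%:R * r ^+ i.-2)) * modulus (w - z) ^+ 2)).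
    rewrite mulr_suml; apply: ler_sum => i _; rewrite modulusM -[leRHS]mulrA.
    rewrite ler_wpM2l ?modulus_ge0//; apply: le_expr_remainder => //.
    by rewrite /r; lra.
  rewrite ler_wpM2r ?sqr_ge0//; apply: le_trans (KP N.-1).
  case: N => [|N]; first by rewrite big_ord_recl !big_ord0 mul0r mulr0 addr0.
  rewrite big_ord_recl mul0r mulr0 add0r big_ord_recl /= muln0 mul0r mulr0 add0r.
  apply: ler_sum => i _; rewrite /dcoef !modulusM !modulus_nat /bump/= !add1n /=.
  by rewrite natrM le_eqVlt; apply/orP; left; apply/eqP; ring.
apply/is_derive_complexP => e e0.
exists (Num.min (r - modulus z) (e / (K + 1))).
  rewrite lt_min; apply/andP; split; first by rewrite /r; lra.
  by rewrite divr_gt0 ?ltr_wpDl.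
move=> w; rewrite lt_min => /andP[w1 w2]; apply: (le_trans (key w w1)).
rewrite expr2 mulrA ler_wpM2r ?modulus_ge0//.
move: w2; rewrite ltr_pdivlMr ?ltr_wpDl// mulrC => w2.
by apply: le_trans (ltW w2); rewrite ler_wpM2r ?modulus_ge0// lerDl.
Qed.

End PowerSeries.

(** * The power series of a holomorphic function *)

Section Taylor.
Context {R : realType}.
Implicit Types (f : R[i] -> R[i]) (r t : R) (k : int).

Lemma polar_disc r t : `|r| < 1 -> unit_disc R (polar r t).
Proof. by rewrite /unit_disc/= modulus_polarE. Qed.

Lemma polar_period r t : polar r (t + 2 * pi) = polar r t.
Proof. by rewrite /polar expiD expi_2pi mulr1. Qed.

Lemma polarE (z : R[i]) : exists2 t, - pi <= t <= pi & z = polar (modulus z) t.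
Proof.
have [->|z0] := eqVneq z 0.
  exists 0; last by rewrite modulus0 /polar mul0r.
  by have := pi_ge0 R => h; apply/andP; split; lra.
have m0 : modulus z != 0 by rewrite modulus_eq0.
have mC : (modulus z)%:C%C != 0 by rewrite (inj_eq (@complexI R) _ 0).
have [|t tp tE] := @expi_surj R (z / (modulus z)%:C%C).
  by rewrite modulusM modulusV modulus_real ger0_norm ?modulus_ge0// divff.
by exists t => //; rewrite /polar -tE mulrCA divff ?mulr1.
Qed.

Lemma holomorphic_ccont f r t : holomorphic f -> `|r| < 1 -> ccont (fun t => f (polar r t)) t.
Proof.
move=> hf r1; have cz := curve_derive_ccont (curve_derive_arc r t).
apply: (ccont_comp cz); apply: differentiable_continuous; apply/derivable1_diffP.
exact/hf/polar_disc.
Qed.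

Lemma is_derive_holomorphic f z : holomorphic f -> unit_disc R z ->
  is_derive (z : R[i]^o) 1 (f : R[i]^o -> R[i]^o) (complex_derivative f z).
Proof. by move=> hf z1; apply/derivableP; exact: hf. Qed.

(** The circle integrals of [f z * z ^ (- k - 1)]: by Goursat's theorem they do
    not depend on the radius.  The power of [z] is passed as a function [g], so
    that positive and negative [k] are treated alike. *)
Lemma fourier_radius f (g : R[i] -> R[i]) (c : R -> R) k r1 r2 : holomorphic f ->
  0 < r1 -> r1 <= r2 -> r2 < 1 ->
  (forall r t, 0 < r < 1 -> derivable (g : R[i]^o -> R[i]^o) (polar r t : R[i]^o) 1) ->
  (forall r t, 0 < r < 1 -> g (polar r t) * polar r t = (c r)%:C%C * wave (- k) t) ->
  (c r1)%:C%C * fourier (- pi) (fun t => f (polar r1 t)) k =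
  (c r2)%:C%C * fourier (- pi) (fun t => f (polar r2 t)) k.
Proof.
move=> hf r10 r12 r21 dg gE.
have pi2 : - pi + 2 * pi = pi :> R by ring.
have G0 : around (fun z => f z * g z) r1 r2 (- pi) pi = 0.
  apply: goursat => //; [exact: ltW|exact: ltW|by have := pi_ge0 R; lra|].
  move=> r t /andP[ra rb] _.
  have r01 : 0 < r < 1 by apply/andP; split; [exact: lt_le_trans ra|exact: le_lt_trans r21].
  apply: derivableM; last exact: dg.
  by apply/hf/polar_disc; move: r01 => /andP[? ?]; rewrite gtr0_norm.
have arcE r : 0 < r < 1 -> arc_int (fun z => f z * g z) r (- pi) pi =
    'i%C * (2 * pi)%:C%C * ((c r)%:C%C * fourier (- pi) (fun t => f (polar r t)) k).
  move=> /andP[r0 r11]; rewrite /fourier /fourier_form pi2.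
  have p0 : (2 * pi)%:C%C * ((2 * pi)^-1)%:C%C = 1 :> R[i].
    by rewrite -rmorphM/= divff ?pi20.
  rewrite [X in _ = X](_ : _ = ('i%C * (c r)%:C%C) * cint (- pi) pi
     (fun x => f (polar r x) * (wave k x)^*%C)); last first.
    by rewrite -[RHS]mul1r -p0; ring.
  rewrite -cintZ.
    apply: eq_cint => t _; rewrite conj_wave [in LHS]mulrCA -!mulrA.
    by rewrite gE ?r0//; ring.
  move=> t _; apply: ccontM; first by apply: holomorphic_ccont => //; rewrite gtr0_norm.
  by apply: ccontJ; exact: ccont_wave.
have rayE : ray_int (fun z => f z * g z) pi r1 r2 = ray_int (fun z => f z * g z) (- pi) r1 r2.
  have eE : expi pi = expi (- pi) :> R[i] by rewrite -[in LHS]pi2 expiD expi_2pi mulr1.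
  by apply: eq_cint => r _; rewrite /polar eE.
move: G0; rewrite /around rayE subrK => /eqP; rewrite subr_eq0 => /eqP.
rewrite !arcE ?r10 ?(lt_le_trans r10) ?r21 ?(le_lt_trans r12)//.
have i0 : 'i%C * (2 * pi)%:C%C != 0 :> R[i].
  by rewrite -modulus_eq0 modulusM modulusi mul1r modulus_real normr_eq0 pi20.
by move=> /(mulfI i0) ->.
Qed.

(** Any other radius would do, by [fourier_circle]. *)
Definition coef f n : R[i] :=
  (2 ^+ n)%:C%C * fourier (- pi) (fun t => f (polar (1 / 2) t)) n%:Z.

Lemma polar_neq0 r t : 0 < r -> polar r t != 0.
Proof. by move=> r0; rewrite -modulus_eq0 modulus_polarE normr_eq0 gt_eqF. Qed.

Lemma derivable_exp (z : R[i]^o) n : derivable (fun z : R[i]^o => z ^+ n : R[i]^o) z 1.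
Proof. exact: (@exprn_derivable R[i] n z 1). Qed.

Lemma fourier_circle f r n : holomorphic f -> 0 < r < 1 ->
  fourier (- pi) (fun t => f (polar r t)) n%:Z = (r ^+ n)%:C%C * coef f n.
Proof.
move=> hf /andP[r0 r1].
have h12 : 0 < 1 / 2 :> R by rewrite divr_gt0.
have h21 : 1 / 2 < 1 :> R by rewrite ltr_pdivrMr// mul1r ltr1n.
pose g (z : R[i]) := (z ^+ n.+1)^-1; pose c (r : R) := (r ^+ n)^-1.
have dg s t : 0 < s < 1 -> derivable (g : R[i]^o -> R[i]^o) (polar s t : R[i]^o) 1.
  move=> /andP[s0 _]; apply: (@derivableV R[i] _ (fun z : R[i]^o => z ^+ n.+1 : R[i]^o)).
    by rewrite expf_neq0// polar_neq0.
  exact: derivable_exp.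
have gE s t : 0 < s < 1 -> g (polar s t) * polar s t = (c s)%:C%C * wave (- n%:Z) t.
  move=> /andP[s0 _]; rewrite /g exprS invfM mulrAC mulVf ?polar_neq0// mul1r.
  rewrite /polar exprMn invfM -rmorphXn/= -fmorphV/=; congr (_ * _).
  by rewrite -conj_wave wave_nat -expiMn conj_expi expiN expiMn.
have E : (c r)%:C%C * fourier (- pi) (fun t => f (polar r t)) n%:Z =
    (c (1 / 2))%:C%C * fourier (- pi) (fun t => f (polar (1 / 2) t)) n%:Z.
  have [rh|/ltW rh] := leP r (1 / 2); first exact: (fourier_radius hf r0 rh h21 dg gE).
  by apply/esym/(fourier_radius hf h12 rh r1 dg gE).
have c2 : c (1 / 2) = 2 ^+ n by rewrite /c div1r exprVn invrK.
rewrite /coef -c2 -E mulrA -rmorphM/= /c divff ?mul1r//.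
by rewrite gt_eqF// exprn_gt0.
Qed.

Lemma fourier_le f r k M : holomorphic f -> `|r| < 1 ->
  (forall t, modulus (f (polar r t)) <= M) ->
  modulus (fourier (- pi) (fun t => f (polar r t)) k) <= 2 * M.
Proof.
move=> hf r1 fM; rewrite /fourier /fourier_form modulusM modulus_real.
have p0 := pi_gt0 R; have p2 : 0 < 2 * pi :> R by rewrite mulr_gt0.
rewrite ger0_norm ?invr_ge0 ?(ltW p2)// mulrC ler_pdivrMr//.
apply: le_trans (@le_modulus_cint _ _ _ _ M _ _ _) _.
- by rewrite lerDl ltW.
- move=> t _; apply: ccontM; first exact: holomorphic_ccont.
  by apply: ccontJ; exact: ccont_wave.
- by move=> t _; rewrite modulusM modulus_conj modulus_wave mulr1.
- by rewrite addrAC subrr add0r.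
Qed.

Lemma holomorphic_bounded_near0 f (e : R) : holomorphic f -> 0 < e ->
  exists2 d, 0 < d < 1 & forall z, modulus z <= d -> modulus (f z - f 0) < e.
Proof.
move=> hf e0; have d0 : unit_disc R 0 by rewrite /unit_disc/= modulus0.
have /is_derive_complex_continuous c0 := is_derive_holomorphic hf d0.
move/(@cvg_modulusP _ _ (nbhs (0 : R[i]^o))) : c0 => /(_ e e0)/near_modulusP[d d1 dP].
have m0 : 0 < Num.min d (1 / 2) by rewrite lt_min d1 divr_gt0.
exists (Num.min d (1 / 2) / 2).
  rewrite divr_gt0//= ltr_pdivrMr// mul1r gt_min; apply/orP; right; lra.
move=> z zd; rewrite modulusB; apply: dP; rewrite subr0; apply: (le_lt_trans zd).
rewrite ltr_pdivrMr// ; have : Num.min d (1 / 2) <= d by rewrite ge_min lexx.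
lra.
Qed.

(** The coefficient times [r ^ (m + 1)] is the same on all circles, and small on
    small circles. *)
Lemma fourier_circle_neg f r m : holomorphic f -> 0 < r < 1 ->
  fourier (- pi) (fun t => f (polar r t)) (- m.+1%:Z) = 0.
Proof.
move=> hf /andP[r0 r1].
pose g (z : R[i]) := z ^+ m; pose c (r : R) := r ^+ m.+1.
have dg s t : 0 < s < 1 -> derivable (g : R[i]^o -> R[i]^o) (polar s t : R[i]^o) 1.
  by move=> _; exact: derivable_exp.
have gE s t : 0 < s < 1 -> g (polar s t) * polar s t = (c s)%:C%C * wave (- - m.+1%:Z) t.
  move=> _; rewrite opprK /g -exprSr /polar exprMn -rmorphXn/=; congr (_ * _).
  by rewrite wave_nat.
have [d /andP[d0 d1] dP] := holomorphic_bounded_near0 hf ltr01.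
pose M := modulus (f 0) + 1.
have M0 : 0 < M by rewrite ltr_wpDl ?modulus_ge0.
have small s : 0 < s -> s <= d -> s <= r ->
    modulus ((c r)%:C%C * fourier (- pi) (fun t => f (polar r t)) (- m.+1%:Z)) <= s * (2 * M).
  move=> s0 sd sr; have s1 : s < 1 := le_lt_trans sd d1.
  rewrite -(fourier_radius hf s0 sr r1 dg gE) modulusM modulus_real ger0_norm ?exprn_ge0 ?(ltW s0)//.
  apply: ler_pM; rewrite ?modulus_ge0 ?exprn_ge0 ?(ltW s0)//.
    by rewrite /c exprS ger_pMr// exprn_ile1 ?(ltW s0)// ltW.
  apply: fourier_le => // [|t]; first by rewrite gtr0_norm.
  rewrite -[f _](subrK (f 0)) addrC; apply: (le_trans (le_modulusD _ _)).
  rewrite lerD2l ltW// dP// modulus_polarE gtr0_norm//.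
have [//|n0] := eqVneq (fourier (- pi) (fun t => f (polar r t)) (- m.+1%:Z)) 0.
pose V := modulus ((c r)%:C%C * fourier (- pi) (fun t => f (polar r t)) (- m.+1%:Z)).
have V0 : 0 < V.
  rewrite /V modulusM mulr_gt0// lt_def modulus_ge0 modulus_eq0 ?n0//.
  by rewrite (inj_eq (@complexI R) _ 0) andbT expf_neq0// gt_eqF.
pose s := Num.min (Num.min d r) (V / (4 * M)).
have s0 : 0 < s by rewrite !lt_min d0 r0 divr_gt0 ?mulr_gt0.
have sd : s <= d by rewrite /s !ge_min lexx.
have sr : s <= r by rewrite /s !ge_min lexx orbT.
have := small s s0 sd sr; rewrite -/V => VM.
have : s * (2 * M) <= V / (4 * M) * (2 * M).
  by rewrite ler_wpM2r ?mulr_ge0 ?(ltW M0)// /s !ge_min lexx !orbT.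
rewrite (_ : V / (4 * M) * (2 * M) = V / 2); last by field; rewrite gt_eqF.
by move=> h; exfalso; have := le_trans VM h; lra.
Qed.

(** The mean of [f] over a circle does not depend on the radius, and tends to
    [f 0] as the circle shrinks. *)
Lemma coef_at0 f : holomorphic f -> coef f 0 = f 0.
Proof.
move=> hf; apply/eqP; rewrite -subr_eq0 -modulus_eq0 eq_le modulus_ge0 andbT.
apply/ler_addgt0Pr => e e0; rewrite add0r.
have e20 : 0 < e / 2 by rewrite divr_gt0.
have [d /andP[d0 d1] dP] := holomorphic_bounded_near0 hf e20.
have d01 : `|d| < 1 by rewrite gtr0_norm.
have -> : coef f 0 - f 0 = fourier (- pi) (fun t => f (polar d t) - f 0) 0.
  have := @fourier_circle f d 0 hf; rewrite d0 d1 expr0 mul1r => /(_ isT) <-.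
  have E := @fourier_form_lin R (- pi) (- f 0) (wave 0) (fun t => f (polar d t)) (wave 0).
  have cw : ccont_on (- pi) (- pi + 2 * pi) (wave 0 : R -> R[i]) by move=> x _; exact: ccont_wave.
  have cf : ccont_on (- pi) (- pi + 2 * pi) (fun t => f (polar d t)).
    by move=> x _; exact: holomorphic_ccont.
  transitivity (- f 0 * fourier_form (- pi) (wave 0) (wave 0) +
      fourier_form (- pi) (fun t => f (polar d t)) (wave 0)).
    by rewrite wave_orthonormal mulr1 addrC.
  rewrite -E//; congr (_ * _); apply: eq_cint => t _; congr (_ * _).
  transitivity (- f 0 * wave 0 t + f (polar d t)); first by [].
  by rewrite wave0 mulr1; exact: addrC.
have hg : holomorphic (fun z => f z - f 0).
  move=> z z1; apply: derivableB; [exact: hf|exact: derivable_cst].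
rewrite (_ : e = 2 * (e / 2)); last by field.
apply: (fourier_le (f := fun z => f z - f 0)) => // t.
by apply/ltW/dP; rewrite modulus_polarE gtr0_norm.
Qed.

(** On the circle through [z] the Fourier series has no negative frequencies, so
    its symmetric partial sums are those of the power series. *)
Lemma taylor f z : holomorphic f -> unit_disc R z -> ccvg (psum (coef f) ^~ z) (f z).
Proof.
move=> hf z1; have [z0|z0] := eqVneq z 0.
  rewrite z0 => e e0; near=> N.
  have N0 : (0 < N)%N by near: N; exact: nbhs_infty_gt.
  rewrite /psum -(prednK N0) big_ord_recl expr0 mulr1 big1 => [|i _]; last first.
    by rewrite expr0n mulr0.
  by rewrite addr0 coef_at0// subrr modulus0.
have [t /andP[t1 t2] zE] := polarE z; set r := modulus z in zE.
have r0 : 0 < r by rewrite lt_def modulus_ge0 modulus_eq0 z0.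
have r1 : r < 1 by [].
have dF : curve_derive (fun t => f (polar r t)) t (complex_derivative f z * ('i%C * polar r t)).
  apply: (curve_derive_comp (f := f) (g := polar r)); last exact: curve_derive_arc.
  by rewrite -zE; exact: is_derive_holomorphic.
have /cvg_modulusP H : (fourier_sum (- pi) (fun t => f (polar r t)) N t : R[i]^o) @[N --> \oo] --> (f (polar r t) : R[i]^o).
  apply: fourier_sum_cvg dF.
  - by move=> s; apply: holomorphic_ccont => //; rewrite gtr0_norm.
  - by move=> s; rewrite polar_period.
  - by apply/andP; split; lra.
have sumE N : fourier_sum (- pi) (fun t => f (polar r t)) N t = psum (coef f) N.+1 z.
  rewrite /fourier_sum -(big_mkord xpredT (fun i => fourier (- pi) (fun t => f (polar r t))
    (i%:Z - N%:Z) * wave (i%:Z - N%:Z) t)).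
  rewrite (big_cat_nat _ (n := N))//=; last by rewrite -addnn leqW// leq_addr.
  rewrite big_nat_cond big1 ?add0r => [|i /andP[/andP[_ iN] _]].
    rewrite -{1}[N]add0n big_addn -addnn -addSn addnK big_mkord.
    apply: eq_bigr => i _; rewrite PoszD addrK fourier_circle ?r0//.
    by rewrite wave_nat zE /polar exprMn -rmorphXn/=; ring.
  have -> : i%:Z - N%:Z = - (N - i).-1.+1%:Z.
    by rewrite prednK ?subn_gt0// -subzn ?(ltnW iN)// opprB.
  by rewrite fourier_circle_neg ?mul0r ?r0.
move=> e e0; have [n _ nP] := H e e0; exists n.+1 => // m /= nm.
have m0 : (0 < m)%N by exact: leq_ltn_trans nm.
rewrite -(prednK m0) -sumE {1}zE; apply: nP => /=.
by rewrite -ltnS prednK.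
Unshelve. all: end_near. Qed.

Lemma holomorphic_disc_coefs f : holomorphic f -> disc_coefs (coef f).
Proof.
move=> hf r /andP[r0 r1].
have z1 : unit_disc R r%:C%C by rewrite /unit_disc/= modulus_real gtr0_norm.
have cv := taylor hf z1; have cv1 := ccvgD (ccvgS cv) (ccvgN cv).
have [n _ nP] := cv1 _ ltr01.
exists (1 + \sum_(i < n) modulus (coef f i) * r ^+ i) => m.
have S0 (k : nat) : 0 <= \sum_(i < k) modulus (coef f i) * r ^+ i.
  by apply: sumr_ge0 => i _; rewrite mulr_ge0 ?modulus_ge0 ?exprn_ge0 ?(ltW r0).
have [nm|mn] := leqP n m.
  apply: (@le_trans _ _ 1); last by rewrite lerDl.
  have := nP m nm; rewrite subrr sub0r modulusN /psum big_ord_recr/= [X in modulus X]addrAC subrr add0r.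
  by rewrite modulusM modulusX modulus_real (gtr0_norm r0) => /ltW.
apply: ler_wpDl => //; rewrite (bigD1 (Ordinal mn))//= lerDl.
by apply: sumr_ge0 => i _; rewrite mulr_ge0 ?modulus_ge0 ?exprn_ge0 ?(ltW r0).
Qed.

Lemma psval_coef f z : holomorphic f -> unit_disc R z -> psval (coef f) z = f z.
Proof.
move=> hf z1; apply: ccvg_unique (taylor hf z1).
by apply: psum_cvg => //; exact: holomorphic_disc_coefs.
Qed.

Lemma near_disc (z : R[i]^o) : unit_disc R z -> \forall w \near z, unit_disc R w.
Proof.
move=> z1; apply/near_modulusP; exists (1 - modulus z); first by rewrite subr_gt0.
move=> w wz; rewrite /unit_disc/= -[w](subrK z); apply: (le_lt_trans (le_modulusD _ _)).
by rewrite -ltrBrDr.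
Qed.

Lemma complex_derivativeE f z : holomorphic f -> unit_disc R z ->
  complex_derivative f z = psval (dcoef (coef f)) z.
Proof.
move=> hf z1; have [_ <-] := is_derive_psval (holomorphic_disc_coefs hf) z1.
apply: (@near_eq_derive R[i] (R[i]^o) (R[i]^o)).
by apply: filterS (near_disc z1) => w w1; rewrite psval_coef.
Qed.

Lemma holomorphic_psval (a : nat -> R[i]) : disc_coefs a -> holomorphic (psval a).
Proof. by move=> Ha z z1; case: (is_derive_psval Ha z1). Qed.

Lemma holomorphic_eq f g : (forall z, unit_disc R z -> f z = g z) -> holomorphic f -> holomorphic g.
Proof.
move=> fg hf z z1; apply: near_eq_derivable (hf z z1).
by apply: filterS (near_disc z1) => w w1; rewrite fg.
Qed.

Lemma holomorphic_derivative f : holomorphic f -> holomorphic (complex_derivative f).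
Proof.
move=> hf; apply: (@holomorphic_eq (psval (dcoef (coef f)))).
  by move=> z z1; rewrite complex_derivativeE.
by apply: holomorphic_psval; apply: disc_coefs_dcoef; exact: holomorphic_disc_coefs.
Qed.

End Taylor.

(** * Polar coordinates *)

Section OneVariable.
Context {R : realType}.
Local Notation mu := (@lebesgue_measure R).


Lemma ge0_integral_opp (f : measurableTypeR R -> \bar R) : measurable_fun setT f -> (forall x, 0 <= f x)%E ->
  (\int[mu]_x f (- x)%R = \int[mu]_x f x)%E.
Proof.
move=> mf f0; have mopp : measurable_fun setT (-%R : measurableTypeR R -> measurableTypeR R).
  exact: oppr_measurable.
transitivity (\int[pushforward mu (-%R : measurableTypeR R -> measurableTypeR R)]_x f x)%E.
  by rewrite ge0_integral_pushforward.
apply: eq_measure_integral => A mA _; apply/esym/lebesgue_measure_unique => //.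
move=> X /ocitvP[->|[[a b] /= ab ->]]; first by rewrite !measure0.
rewrite /pushforward (_ : _ @^-1` _ = `[- b, - a[%classic); last first.
  by apply/seteqP; split=> x /=; rewrite !in_itv/= => /andP[h1 h2]; apply/andP; split; lra.
by rewrite !lebesgue_measure_itv/= !lte_fin ltrN2 -!EFinD opprK addrC.
Qed.

Lemma integral_substitution (F F' G : R -> R) a b : a <= b ->
  {in `[a, b] &, {homo F : x y / x < y}} ->
  (forall x, a <= x <= b -> is_derive x 1 F (F' x)) ->
  (forall x, a <= x <= b -> {for x, continuous F'}) ->
  (forall x, F a <= x <= F b -> {for x, continuous G}) ->
  (\int[mu]_(x in `[F a, F b]) (G x)%:E = \int[mu]_(x in `[a, b]) (G (F x) * F' x)%:E)%E.
Proof.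
rewrite le_eqVlt => /predU1P[->|ab] incF dF cF' cG.
  by rewrite !set_itv1 !integral_set1.
have FE x : x \in `]a, b[ -> F^`()%classic x = F' x.
  rewrite in_itv/= => /andP[ax xb]; rewrite derive1E.
  by have [|_ ->] := dF x; rewrite // !ltW.
have cF x : a <= x <= b -> {for x, continuous F}.
  by move=> /dF[dFx _]; apply: differentiable_continuous; apply/derivable1_diffP.
rewrite (@integration_by_substitution_increasing _ F) ?(ltW ab)//.
- rewrite integral_itv_bndoo; last first.
    apply/measurable_EFinP; apply: subspace_continuous_measurable_fun => //.
    apply: continuous_in_subspaceT => x /[!inE]/= xab; rewrite /continuous_at /=.
    have xab' : a <= x <= b by move: xab; rewrite in_itv/= => /andP[/ltW -> /ltW ->].
    have cGF : {for x, continuous (G \o F)}.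
      apply: continuous_comp; first exact: cF.
      by apply: cG; move: xab; rewrite in_itv/= => /andP[h1 h2];
         rewrite !ltW// incF// in_itv/= ?lexx ?(ltW ab) ?(ltW h1) ?(ltW h2).
    rewrite FE//; apply: cvgM; first exact: cGF.
    apply: cvg_trans (cF' _ xab'); apply: near_eq_cvg.
    by have := near_in_itvoo xab; apply: filterS => y yab; rewrite FE.
  rewrite [in RHS]integral_itv_bndoo; last first.
    apply/measurable_EFinP; apply: subspace_continuous_measurable_fun => //.
    apply: continuous_in_subspaceT => x /[!inE]/= xab; rewrite /continuous_at /=.
    have xab' : a <= x <= b by move: xab; rewrite in_itv/= => /andP[/ltW -> /ltW ->].
    have cGF : {for x, continuous (G \o F)}.
      apply: continuous_comp; first exact: cF.
      by apply: cG; move: xab; rewrite in_itv/= => /andP[h1 h2];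
         rewrite !ltW// incF// in_itv/= ?lexx ?(ltW ab) ?(ltW h1) ?(ltW h2).
    by apply: cvgM; [exact: cGF|exact: cF'].
  by apply: eq_integral => x; rewrite inE/= => xab; rewrite -(FE x xab).
- move=> x xab; have xab' : a <= x <= b by move: xab; rewrite in_itv/= => /andP[/ltW -> /ltW ->].
  rewrite /prop_for /continuous_at FE//; apply: cvg_trans (cF' _ xab'); apply: near_eq_cvg.
  by have := near_in_itvoo xab; apply: filterS => y yab; rewrite FE.
- apply/cvg_ex; exists (F' a); have : F' x @[x --> a^'+] --> F' a.
    by apply: cvg_at_right_filter; apply: cF'; rewrite lexx ltW.
  apply: cvg_trans; apply: near_eq_cvg; near=> x.
  by rewrite FE// in_itv/=; apply/andP; split; near: x; [exact: nbhs_right_gt|exact: nbhs_right_lt].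
- apply/cvg_ex; exists (F' b); have : F' x @[x --> b^'-] --> F' b.
    by apply: cvg_at_left_filter; apply: cF'; rewrite lexx ltW.
  apply: cvg_trans; apply: near_eq_cvg; near=> x.
  by rewrite FE// in_itv/=; apply/andP; split; near: x; [exact: nbhs_left_gt|exact: nbhs_left_lt].
- split.
  + move=> x; rewrite in_itv/= => /andP[ax xb]; have [|//] := dF x.
    by rewrite !ltW.
  + by apply: cvg_at_right_filter; apply: cF; rewrite lexx ltW.
  + by apply: cvg_at_left_filter; apply: cF; rewrite lexx ltW.
- by apply: continuous_in_subspaceT => x; rewrite inE/= in_itv/=; exact: cG.
Unshelve. all: end_near. Qed.

End OneVariable.

Section PolarCoordinates.
Context {R : realType}.
Local Notation mu := (@lebesgue_measure R).
Local Notation Rm := (measurableTypeR R).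

Lemma measurable_plane1 : measurable_fun setT (fun p : plane R => p.1).
Proof. exact: measurable_fst. Qed.

Lemma measurable_plane2 : measurable_fun setT (fun p : plane R => p.2).
Proof. exact: measurable_snd. Qed.

Definition plane_disc (rho : R) : set (plane R) := [set p | modulus (to_complex p) <= rho].

Lemma modulus_to_complex (p : plane R) : modulus (to_complex p) ^+ 2 = p.1 ^+ 2 + p.2 ^+ 2.
Proof. by rewrite modulus_sqr. Qed.

Lemma measurable_modulus : measurable_fun setT (fun p : plane R => modulus (to_complex p)).
Proof.
have -> : (fun p : plane R => modulus (to_complex p)) =
    (fun p => (p.1 ^+ 2 + p.2 ^+ 2) `^ (2^-1)).
  by apply/funext => p; rewrite -modulus_to_complex powR12_sqrt ?sqr_ge0// sqrtr_sqr ger0_norm// modulus_ge0.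
apply: (measurableT_comp (measurable_powR _)).
by apply: measurable_funD; apply: measurable_funX; [exact: measurable_plane1|exact: measurable_plane2].
Qed.

Lemma measurable_lt_set d (T : measurableType d) (f g : T -> R) :
  measurable_fun setT f -> measurable_fun setT g -> measurable [set x | f x < g x].
Proof.
move=> mf mg; have := measurable_fun_ltr mf mg measurableT (Y := [set true]).
by rewrite setTI; apply.
Qed.

Lemma measurable_le_set d (T : measurableType d) (f g : T -> R) :
  measurable_fun setT f -> measurable_fun setT g -> measurable [set x | f x <= g x].
Proof.
move=> mf mg; have := measurable_fun_ler mf mg measurableT (Y := [set true]).
by rewrite setTI; apply.
Qed.

Lemma measurable_plane_disc rho : measurable (plane_disc rho).
Proof. by apply: measurable_le_set; [exact: measurable_modulus|exact: measurable_cst]. Qed.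

Lemma measurable_cos : measurable_fun setT (cos : Rm -> Rm).
Proof. by apply: continuous_measurable_fun; exact: continuous_cos. Qed.

Lemma measurable_sin : measurable_fun setT (sin : Rm -> Rm).
Proof. by apply: continuous_measurable_fun; exact: continuous_sin. Qed.

Variables (rho : R) (G : R[i] -> R).
Hypothesis rho0 : 0 < rho.
Hypothesis G0 : forall z, 0 <= G z.
Hypothesis mG : measurable_fun setT (fun p : plane R => G (to_complex p)).
Hypothesis cG : forall z, modulus z <= rho ->
  {for (z : R[i]^o), continuous (G : R[i]^o -> R)}.

(* The secant, as a real power: powers are measurable on the whole line. *)
Let sec (t : R) := cos t `^ (- 1).
Let secE (t : R) : 0 < cos t -> sec t = (cos t)^-1.
Proof. by move=> c0; rewrite /sec powR_inv1// ltW. Qed.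

Let pt (p : plane R) : plane R := (p.1, p.1 * (sin p.2 * sec p.2)).
Let S : set (plane R) :=
  [set p | [/\ - (pi / 2) < p.2 < pi / 2, 0 < p.1 & p.1 <= rho * cos p.2]].
Let H : set (plane R) := [set p | 0 < p.1 /\ plane_disc rho p].
(* The integrand after the first substitution; its domain [H] becomes [S]. *)
Let K (p : plane R) : R := G (to_complex (pt p)) * (p.1 * sec p.2 ^+ 2).

Let m_sec : measurable_fun setT (fun p : plane R => sec p.2).
Proof.
apply: (measurableT_comp (measurable_powR _)).
by apply: (measurableT_comp measurable_cos); exact: measurable_plane2.
Qed.

Let mK : measurable_fun setT K.
Proof.
apply: measurable_funM; last first.
  by apply: measurable_funM; [exact: measurable_plane1|apply: measurable_funX; exact: m_sec].
have mpt : measurable_fun setT pt.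
  apply: measurable_fun_pair; first exact: measurable_plane1.
  apply: measurable_funM; first exact: measurable_plane1.
  apply: measurable_funM; last exact: m_sec.
  by apply: (measurableT_comp measurable_sin); exact: measurable_plane2.
exact: (measurableT_comp mG mpt).
Qed.

Let mS : measurable S.
Proof.
have -> : S = ([set p : plane R | - (pi / 2) < p.2] `&` [set p | p.2 < pi / 2]) `&`
    ([set p | 0 < p.1] `&` [set p | p.1 <= rho * cos p.2]).
  apply/seteqP; split=> p /=; rewrite /S/=; first by move=> [/andP[-> ->] -> ->].
  by move=> [[-> ->] [-> ->]].
apply: measurableI; apply: measurableI.
- by apply: measurable_lt_set; [exact: measurable_cst|exact: measurable_plane2].
- by apply: measurable_lt_set; [exact: measurable_plane2|exact: measurable_cst].
- by apply: measurable_lt_set; [exact: measurable_cst|exact: measurable_plane1].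
- apply: measurable_le_set; first exact: measurable_plane1.
  apply: measurable_funM; first exact: measurable_cst.
  by apply: (measurableT_comp measurable_cos); exact: measurable_plane2.
Qed.

Let mH : measurable H.
Proof.
apply: measurableI; last exact: measurable_plane_disc.
by apply: measurable_lt_set; [exact: measurable_cst|exact: measurable_plane1].
Qed.

Let cos_gt0 (t : R) : - (pi / 2) < t < pi / 2 -> 0 < cos t.
Proof. by move=> tp; apply: cos_gt0_pihalf. Qed.

(* On a vertical line the substitution [y = x * tan t]. *)
Let slice_x (x : R) : (\int[mu]_y ((fun p => (G (to_complex p))%:E) \_ H) (x, y) =
  \int[mu]_t ((fun p => (K p)%:E) \_ S) (x, t))%E.
Proof.
have pi0 := pi_gt0 R.
have [x0|x0] := leP x 0.
  rewrite !integral0_eq// => y _; rewrite patchE ifF//; apply/negbTE/negP; rewrite inE.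
    by rewrite /S/= => -[_]; rewrite ltNge x0.
  by rewrite /H/= => -[]; rewrite ltNge x0.
have [xr|xr] := ltP rho x.
  rewrite !integral0_eq// => y _; rewrite patchE ifF//; apply/negbTE/negP; rewrite inE.
    rewrite /S/= => -[_ _]; apply/negP; rewrite -ltNge (le_lt_trans _ xr)//.
    by rewrite ger_pMr// cos_le1.
  rewrite /H/= => -[_]; apply/negP; rewrite -ltNge (lt_le_trans xr)//.
  by have := le_Re_modulus (to_complex (x, y)); rewrite /= ger0_norm// ltW.
pose c := x / rho; have c0 : 0 < c by rewrite divr_gt0.
have c1 : c <= 1 by rewrite ler_pdivrMr// mul1r.
have c11 : -1 <= c <= 1 by rewrite c1 andbT (le_trans _ (ltW c0))// lerN10.
pose a := acos c.
have cosa : cos a = c by rewrite acosK// in_itv/= c11.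
have a0 : 0 <= a by exact: acos_ge0.
have ap : a < pi / 2.
  rewrite ltNge; apply/negP => pa; have : cos a <= cos (pi / 2).
    move: pa; rewrite le_eqVlt => /predU1P[->//|pa]; apply: ltW.
    by rewrite ltr_cos ?in_itv//=; apply/andP; split; have := acos_lepi c11; rewrite -/a; lra.
  by rewrite cosa cos_pihalf leNgt c0.
have in_S t : S (x, t) <-> - a <= t <= a.
  have cmono (u v : R) : 0 <= u <= pi -> 0 <= v <= pi -> (cos u <= cos v) = (v <= u).
    by move=> u0 v0; rewrite [LHS]leNgt [RHS]leNgt ltr_cos// in_itv.
  have tE : (cos t = cos `|t|) by have [t0|t0] := ler0P t; rewrite ?cosN.
  rewrite -ler_norml; split.
    move=> [/andP[t1 t2] _ xt]; rewrite -cmono.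
    - by rewrite -tE cosa /c ler_pdivrMr// mulrC.
    - by rewrite a0/=; lra.
    - by rewrite normr_ge0/= ler_norml; apply/andP; move: t1 t2 => /=; split; lra.
  move=> ta; have ta' : `|t| < pi / 2 := le_lt_trans ta ap.
  move: (ta'); rewrite ltr_norml => tp; split => //=.
  rewrite tE -ler_pdivrMl// mulrC -/c -cosa cmono//.
    by rewrite a0/=; lra.
  by rewrite normr_ge0/=; lra.
pose F t := x * tan t; pose F' t := x * (cos t) ^- 2.
have tin t : - a <= t <= a -> - (pi / 2) < t < pi / 2.
  by move=> /andP[? ?]; apply/andP; split; lra.
have FE t : - a <= t <= a -> F t = x * (sin t * sec t).
  by move=> /tin/cos_gt0 ct; rewrite secE.
have Fa : F a ^+ 2 = rho ^+ 2 - x ^+ 2.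
  rewrite /F exprMn; have := cos2_tan2 (lt0r_neq0 (cos_gt0 (tin a _))).
  rewrite lexx (le_trans _ a0) ?oppr_le0// => /(_ isT).
  rewrite cosa /c => h; have -> : tan a ^+ 2 = (x / rho) ^- 2 - 1 by rewrite h; ring.
  by field; rewrite !gt_eqF.
have Fa0 : 0 <= F a.
  rewrite FE ?lexx ?andbT ?(le_trans _ a0) ?oppr_le0// mulr_ge0 ?(ltW x0)//.
  rewrite mulr_ge0 ?powR_ge0// sin_ge0_pi// a0/=; lra.
have FN : F (- a) = - F a by rewrite /F tanN mulrN.
have in_H y : H (x, y) <-> F (- a) <= y <= F a.
  rewrite FN -ler_norml; rewrite /H/=; split.
    move=> [_ xy]; rewrite -(ler_pXn2r (n := 2))// ?nnegrE// real_normK ?num_real//.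
    rewrite Fa lerBrDr addrC -(modulus_to_complex (x, y)).
    by rewrite ler_pXn2r ?nnegrE ?modulus_ge0// ltW.
  move=> yF; split => //; rewrite /plane_disc/= -(ler_pXn2r (n := 2)) ?nnegrE ?modulus_ge0 ?(ltW rho0)//.
  rewrite modulus_to_complex/= addrC -lerBrDr -Fa -[y ^+ 2]real_normK ?num_real//.
  by rewrite ler_pXn2r ?nnegrE.
have -> : (\int[mu]_y ((fun p => (G (to_complex p))%:E) \_ H) (x, y) =
    \int[mu]_(y in `[F (- a)%R, F a]) (G (to_complex (x, y)))%:E)%E.
  rewrite [RHS]integral_mkcond; apply: eq_integral => y _; rewrite !patchE.
  congr (if _ then _ else _); apply/idP/idP; rewrite !inE/= in_itv/=.
    by move/in_H.
  by move=> h; apply/in_H.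
have -> : (\int[mu]_t ((fun p => (K p)%:E) \_ S) (x, t) =
    \int[mu]_(t in `[(- a)%R, a]) (G (to_complex (x, F t)) * F' t)%:E)%E.
  rewrite [RHS]integral_mkcond; apply: eq_integral => t _; rewrite !patchE.
  have [ta|ta] := boolP (- a <= t <= a).
    have tS : (x, t) \in S by rewrite inE; apply/in_S.
    have tI : t \in `[- a, a]%classic by rewrite inE/= in_itv.
    rewrite tS tI.
    by rewrite /K /pt/= FE// /F' secE ?cos_gt0 ?tin// exprVn.
  rewrite !ifF//; apply/negP; rewrite inE/=; last by move/in_S; exact/negP.
  by rewrite in_itv/=; exact/negP.
apply: (integral_substitution (F := F) (F' := F') (G := fun y => G (to_complex (x, y)))).
- by rewrite ge0_cp.
- move=> u v; rewrite !in_itv/= => /tin u1 /tin v1 uv.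
  by rewrite /F ltr_pM2l// ltr_tan ?in_itv.
- move=> t /tin/cos_gt0/lt0r_neq0 ct; rewrite /F'.
  have := is_deriveZ x (is_derive_tan ct); rewrite /GRing.scale/=; exact.
- move=> t /tin/cos_gt0/lt0r_neq0 ct; apply: cvgM; first exact: cvg_cst.
  apply: cvgV; first by rewrite expf_neq0.
  by apply: cvgM; exact: continuous_cos.
- move=> y /in_H [_ xy].
  apply: (@continuous_comp _ _ _ (fun y : R => to_complex (x, y) : R[i]^o) (G : R[i]^o -> R)).
    by apply/(@cvg_ReImP _ _ (nbhs y)); split; [exact: cvg_cst|exact: cvg_id].
  exact: cG.
Qed.

(* On a ray of the plane of the pairs [(x, t)] the substitution [x = r * cos t]. *)
Let slice_t (t : R) : - (pi / 2) < t < pi / 2 ->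
  (\int[mu]_x ((fun p => (K p)%:E) \_ S) (x, t) =
   \int[mu]_(r in `[0%R, rho]) (G (polar r t) * r)%:E)%E.
Proof.
move=> tp; have ct := cos_gt0 tp; have rc0 : 0 < rho * cos t by rewrite mulr_gt0.
pose k x := G (to_complex (x, x * (sin t * sec t))) * (x * sec t ^+ 2).
have -> : (\int[mu]_x ((fun p => (K p)%:E) \_ S) (x, t) =
    \int[mu]_(x in `]0%R, (rho * cos t)%R]) (k x)%:E)%E.
  rewrite [RHS]integral_mkcond; apply: eq_integral => x _; rewrite !patchE.
  congr (if _ then _ else _); apply/idP/idP; rewrite !inE/= in_itv/=.
    by move=> [_ /= -> ->].
  by move=> /andP[x0 x1]; split.
have mk : measurable_fun setT (fun x : Rm => k x).
  by have := measurable_fun_pair1 t mK.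
rewrite integral_itv_obnd_cbnd; last first.
  by apply/measurable_EFinP; apply: measurable_funTS.
pose F r := r * cos t.
have F0 : F 0 = 0 by rewrite /F mul0r.
have -> : (\int[mu]_(x in `[0%R, (rho * cos t)%R]) (k x)%:E)%E =
   (\int[mu]_(x in `[F 0%R, F rho]) (k x)%:E)%E by rewrite F0.
transitivity (\int[mu]_(r in `[0%R, rho]) (k (F r) * cos t)%:E)%E; last first.
  apply: eq_integral => r _; congr (_%:E); rewrite /k /F secE// (_ : to_complex _ = polar r t); last first.
    by apply: complex_eqP => /=; [ring|field; rewrite gt_eqF].
  by field; rewrite gt_eqF.
apply: (integral_substitution (F' := fun=> cos t)); first exact: ltW.
- by move=> u v _ _ uv; rewrite /F ltr_pM2r.
- move=> r _; have := is_deriveM (is_derive_id r (1 : R)) (is_derive_cst (cos t) r 1).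
  by rewrite /GRing.scale/= mulr0 mulr1 add0r; exact.
- by move=> r _; exact: cvg_cst.
- move=> x; rewrite F0 => /andP[x0 xr].
  apply: cvgM; last by apply: cvgM; [exact: cvg_id|exact: cvg_cst].
  apply: (@continuous_comp _ _ _ (fun x : R => to_complex (x, x * (sin t * sec t)) : R[i]^o) (G : R[i]^o -> R)).
    apply/(@cvg_ReImP _ _ (nbhs x)); split; first exact: cvg_id.
    by apply: cvgM; [exact: cvg_id|exact: cvg_cst].
  apply: cG; rewrite (_ : to_complex _ = polar (x / cos t) t); last first.
    by have s1 := secE ct; apply: complex_eqP; rewrite /= ?s1; field; rewrite gt_eqF.
  by rewrite modulus_polar ?divr_ge0 ?(ltW ct)// ler_pdivrMr.
Qed.

(** On the right half of the disc polar coordinates are reached by two changes of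
    one variable, [y = x * tan t] and then [x = r * cos t]; Tonelli's theorem
    allows to do them one after the other. *)
Lemma polar_right_half :
  (\int[planar_lebesgue]_(p in [set p : plane R | (0 < p.1)%R /\ plane_disc rho p]) (G (to_complex p))%:E =
   \int[mu]_(t in `](- (pi / 2))%R, (pi / 2)%R[)
     \int[mu]_(r in `[0%R, rho]) (G (polar r t) * r)%:E)%E.
Proof.
have mGH : measurable_fun setT ((fun p => (G (to_complex p))%:E) \_ H).
  by apply/(measurable_restrictT _ mH)/measurable_funTS/measurable_EFinP.
have mKS : measurable_fun setT ((fun p => (K p)%:E) \_ S).
  by apply/(measurable_restrictT _ mS)/measurable_funTS/measurable_EFinP.
have GH0 p : (0 <= ((fun p => (G (to_complex p))%:E) \_ H) p)%E.
  by apply: erestrict_ge0 => q _; rewrite lee_fin.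
have KS0 p : (0 <= ((fun p => (K p)%:E) \_ S) p)%E.
  apply: erestrict_ge0 => q [_ q0 _]; rewrite lee_fin mulr_ge0// mulr_ge0 ?(ltW q0)//.
  by rewrite sqr_ge0.
rewrite integral_mkcond /planar_lebesgue (fubini_tonelli1 _ mGH GH0).
under eq_integral do rewrite /fubini_F slice_x.
rewrite (fubini_tonelli _ mKS KS0).
rewrite [RHS]integral_mkcond; apply: eq_integral => t _; rewrite patchE.
have [tp|tp] := boolP (- (pi / 2) < t < pi / 2).
  by rewrite ifT ?slice_t// inE/= in_itv.
rewrite ifF; last by apply/negbTE; rewrite notin_setE/= in_itv/=; exact/negP.
rewrite integral0_eq// => x _; rewrite patchE ifF//; apply/negbTE; rewrite notin_setE.
by move=> [tp']; move: tp; rewrite tp'.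
Qed.

End PolarCoordinates.

Section Tonelli.
Context d1 d2 (X : measurableType d1) (Y : measurableType d2) (R : realType).
Variables (m1 : {sigma_finite_measure set X -> \bar R}) (m2 : {sigma_finite_measure set Y -> \bar R}).
Variables (A : set X) (B : set Y) (f : X * Y -> \bar R).
Hypotheses (mA : measurable A) (mB : measurable B).
Hypothesis mf : measurable_fun (A `*` B) f.
Hypothesis f0 : forall p, A p.1 -> B p.2 -> (0 <= f p)%E.

Let mg : measurable_fun setT (f \_ (A `*` B)).
Proof. exact/(measurable_restrictT _ (measurableX mA mB)). Qed.

Let g0 p : (0 <= (f \_ (A `*` B)) p)%E.
Proof. by apply: erestrict_ge0 => q [? ?]; exact: f0. Qed.

Let E1 x : (\int[m2]_y (f \_ (A `*` B)) (x, y) =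
    ((fun x => \int[m2]_(y in B) f (x, y)) \_ A) x)%E.
Proof.
rewrite patchE; case: ifPn => [/set_mem xA|/negP xA].
  rewrite [RHS]integral_mkcond; apply: eq_integral => y _; rewrite !patchE.
  by congr (if _ then _ else _); apply/idP/idP; rewrite !inE; [case|split].
rewrite integral0_eq// => y _; rewrite patchE ifF//; apply/negP.
by rewrite inE => -[xA' _]; apply: xA; rewrite inE.
Qed.

Let E2 y : (\int[m1]_x (f \_ (A `*` B)) (x, y) =
    ((fun y => \int[m1]_(x in A) f (x, y)) \_ B) y)%E.
Proof.
rewrite patchE; case: ifPn => [/set_mem yB|/negP yB].
  rewrite [RHS]integral_mkcond; apply: eq_integral => x _; rewrite !patchE.
  by congr (if _ then _ else _); apply/idP/idP; rewrite !inE; [case|split].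
rewrite integral0_eq// => x _; rewrite patchE ifF//; apply/negP.
by rewrite inE => -[_ yB']; apply: yB; rewrite inE.
Qed.

Lemma tonelli_rect : (\int[m1]_(x in A) \int[m2]_(y in B) f (x, y) =
  \int[m2]_(y in B) \int[m1]_(x in A) f (x, y))%E.
Proof.
rewrite integral_mkcond [RHS]integral_mkcond.
under eq_integral do rewrite -E1.
under [in RHS]eq_integral do rewrite -E2.
exact: fubini_tonelli.
Qed.

Lemma measurable_inner_integral : measurable_fun A (fun x => \int[m2]_(y in B) f (x, y))%E.
Proof.
have h := measurable_fun_fubini_tonelli_F (m2 := m2) _ mg g0.
apply: (eq_measurable_fun (fubini_F m2 (f \_ (A `*` B)))); last exact: measurable_funTS h.
by move=> x xA; rewrite /fubini_F E1 patchE xA.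
Qed.

End Tonelli.

Section PolarFormula.
Context {R : realType}.
Local Notation mu := (@lebesgue_measure R).
Local Notation Rm := (measurableTypeR R).

Lemma ge0_integral_half (f : Rm -> \bar R) : measurable_fun setT f -> (forall x, 0 <= f x)%E ->
  (\int[mu]_x f x = \int[mu]_(x in `]0%R, +oo[) f x + \int[mu]_(x in `]0%R, +oo[) f (- x)%R)%E.
Proof.
move=> mf f0.
have -> : [set: Rm] = `]0, +oo[%classic `|` `]-oo, 0]%classic.
  apply/seteqP; split=> x //= _; rewrite !in_itv/= andbT.
  by have [x0|x0] := ltP 0 x; [left|right].
rewrite ge0_integral_setU//; first last.
- rewrite disj_set2E; apply/eqP/seteqP; split=> x //=.
  by rewrite !in_itv/= andbT => -[x0]; rewrite leNgt x0.
- exact: measurable_funTS.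
congr (_ + _)%E; rewrite -integral_itv_bndo_bndc; last exact: measurable_funTS.
rewrite integral_mkcond -ge0_integral_opp.
- rewrite [RHS]integral_mkcond; apply: eq_integral => x _; rewrite !patchE.
  by congr (if _ then _ else _); apply/idP/idP; rewrite !inE/= !in_itv/= andbT oppr_lt0.
- have mI : measurable (`]-oo, 0[%classic : set Rm) by exact: measurable_itv.
  exact/(measurable_restrictT _ mI)/measurable_funTS.
- by move=> x; apply: erestrict_ge0.
Qed.

Lemma half_disc_fubini rho (G : R[i] -> R) : (forall z, 0 <= G z) ->
  measurable_fun setT (fun p : plane R => G (to_complex p)) ->
  (\int[planar_lebesgue]_(p in [set p : plane R | (0 < p.1)%R /\ plane_disc rho p])
     (G (to_complex p))%:E =
   \int[mu]_(x in `]0%R, +oo[) \int[mu]_y ((fun p => (G (to_complex p))%:E) \_ (plane_disc rho)) (x, y))%E.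
Proof.
move=> G0 mG; set H := [set p : plane R | _].
have mH : measurable H.
  apply: measurableI; last exact: measurable_plane_disc.
  by apply: measurable_lt_set; [exact: measurable_cst|exact: measurable_plane1].
have mGH : measurable_fun setT ((fun p => (G (to_complex p))%:E) \_ H).
  by apply/(measurable_restrictT _ mH)/measurable_funTS/measurable_EFinP.
have GH0 p : (0 <= ((fun p => (G (to_complex p))%:E) \_ H) p)%E.
  by apply: erestrict_ge0 => q _; rewrite lee_fin.
rewrite integral_mkcond /planar_lebesgue (fubini_tonelli1 _ mGH GH0).
rewrite [RHS]integral_mkcond; apply: eq_integral => x _; rewrite patchE /fubini_F.
case: ifPn => [|/negP x0].
  rewrite inE/= in_itv/= andbT => x0; apply: eq_integral => y _; rewrite !patchE.
  by congr (if _ then _ else _); apply/idP/idP; rewrite !inE; [case|split].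
rewrite integral0_eq// => y _; rewrite patchE ifF//; apply/negP.
by rewrite inE => -[x0' _]; apply: x0; rewrite inE/= in_itv/= andbT.
Qed.

Lemma measurable_polar (G : R[i] -> R) :
  measurable_fun setT (fun p : plane R => G (to_complex p)) ->
  measurable_fun setT (fun p : Rm * Rm => G (polar p.1 p.2)).
Proof.
move=> mG; pose q (p : plane R) : plane R := (p.1 * cos p.2, p.1 * sin p.2).
have mq : measurable_fun setT q.
  apply: measurable_fun_pair; apply: measurable_funM; try exact: measurable_plane1.
    by apply: (measurableT_comp measurable_cos); exact: measurable_plane2.
  by apply: (measurableT_comp measurable_sin); exact: measurable_plane2.
have -> : (fun p : Rm * Rm => G (polar p.1 p.2)) = (fun p => G (to_complex p)) \o q.
  apply/funext => p /=; congr G; apply: complex_eqP; rewrite ?Re_mul ?Im_mul/=; ring.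
exact: measurableT_comp.
Qed.

Variables (rho : R) (G : R[i] -> R).
Hypothesis rho0 : 0 < rho.
Hypothesis G0 : forall z, 0 <= G z.
Hypothesis mG : measurable_fun setT (fun p : plane R => G (to_complex p)).
Hypothesis cG : forall z, modulus z <= rho ->
  {for (z : R[i]^o), continuous (G : R[i]^o -> R)}.

Let circle_continuous r : 0 <= r <= rho -> continuous (fun t => G (polar r t)).
Proof.
move=> /andP[r0 r1] t; have [cz] := curve_derive_ccont (curve_derive_arc r t).
apply: (continuous_comp cz); apply: cG; by rewrite modulus_polar.
Qed.

Let circle_sum r : 0 <= r <= rho ->
  (\int[mu]_(t in `](- (pi / 2))%R, (pi / 2)%R[) (G (polar r t) * r)%:E +
   \int[mu]_(t in `](- (pi / 2))%R, (pi / 2)%R[) (G (polar r (pi - t)) * r)%:E =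
   (r * \int[mu]_(t in `[(- pi)%R, (- pi + 2 * pi)%R]) G (polar r t))%:E)%E.
Proof.
move=> rr; have cg := circle_continuous rr; have pi0 := pi_gt0 R.
pose g t := G (polar r t).
have E (h : R -> R) : continuous h ->
    (\int[mu]_(t in `](- (pi / 2))%R, (pi / 2)%R[) (h t * r)%:E =
     (r * \int[mu]_(t in `[(- (pi / 2))%R, (pi / 2)%R]) h t)%:E)%E.
  move=> ch; have ih : mu.-integrable `[(- (pi / 2)), (pi / 2)] (EFin \o h).
    by apply: segment_integrable => x _; exact: ch.
  have mh : measurable_fun setT (h : Rm -> Rm) by exact: continuous_measurable_fun.
  rewrite -(@integral_itv_bndoo R _ _ _ true false); last first.
    by apply/measurable_EFinP/measurable_funTS/measurable_funM => //; exact: measurable_cst.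
  rewrite /Rintegral EFinM fineK; last exact: integrable_fin_num.
  rewrite -integralZl//; apply: eq_integral => x _; by rewrite EFinM muleC.
rewrite (E g cg) (E (fun t => g (pi - t))); last first.
  move=> t; apply: (@continuous_comp _ _ _ (fun t : R => pi - t) g); last exact: cg.
  by apply: cvgB; [exact: cvg_cst|exact: cvg_id].
rewrite -EFinD -mulrDr; congr (r * _)%:E.
have -> : \int[mu]_(t in `[- (pi / 2), pi / 2]) g (pi - t) =
    \int[mu]_(t in `[pi / 2, pi / 2 + pi]) g t.
  have := @integration_by_substitution_oppr R (fun s => g (s + pi)) (- (pi / 2)) (pi / 2).
  rewrite opprK => h; rewrite (_ : pi / 2 = - (pi / 2) + pi) ?(Rintegral_shift (f := g) pi) //; last by field.
  - rewrite (_ : - (pi / 2) + pi = pi / 2); last by field.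
    rewrite /Rintegral h; first by congr fine; apply: eq_integral => x _ /=; rewrite addrC.
      by lra.
    apply: continuous_subspaceT => s; apply: (@continuous_comp _ _ _ (fun s : R => s + pi) g); last exact: cg.
    by apply: cvgD; [exact: cvg_id|exact: cvg_cst].
  - by lra.
rewrite -(@Rintegral_cat _ g (- (pi / 2)) (pi / 2)) => [||x _]; [|apply/andP; split; lra|exact: cg].
rewrite (_ : pi / 2 + pi = - (pi / 2) + 2 * pi); last by field.
apply/esym/Rintegral_period => //; first by move=> x; rewrite /g /polar expiD expi_2pi mulr1.
by apply/andP; split; lra.
Qed.

(** The left half of the disc is the mirror image of the right half, under which
    the angle [t] becomes [pi - t]; the two half circles make up a full period. *)
Theorem polar_integral :
  (\int[planar_lebesgue]_(p in plane_disc rho) (G (to_complex p))%:E =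
   \int[mu]_(r in `[0%R, rho])
     (r * \int[mu]_(t in `[(- pi)%R, (- pi + 2 * pi)%R]) G (polar r t))%:E)%E.
Proof.
pose f p := ((fun p : plane R => (G (to_complex p))%:E) \_ (plane_disc rho)) p.
have mf : measurable_fun setT f.
  by apply/(measurable_restrictT _ (measurable_plane_disc _))/measurable_funTS/measurable_EFinP.
have f0 p : (0 <= f p)%E by apply: erestrict_ge0 => q _; rewrite lee_fin.
pose G' z := G (- z^*%C).
have G'E (p : plane R) : G' (to_complex p) = G (to_complex (- p.1, p.2)).
  by congr G; apply: complex_eqP => /=; rewrite ?opprK.
have mG' : measurable_fun setT (fun p : plane R => G' (to_complex p)).
  under eq_fun do rewrite G'E.
  pose s (p : plane R) : plane R := (- p.1, p.2).
  suff ms : measurable_fun setT s by exact: (measurableT_comp mG ms).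
  apply: measurable_fun_pair; last exact: measurable_plane2.
  by apply: (measurableT_comp (@oppr_measurable _ _)); exact: measurable_plane1.
have cG' z : modulus z <= rho -> {for (z : R[i]^o), continuous (G' : R[i]^o -> R)}.
  move=> zr; apply: (@continuous_comp _ _ _ (fun z : R[i]^o => - z^*%C : R[i]^o) (G : R[i]^o -> R)).
    apply/(@cvg_modulusP _ _ (nbhs (z : R[i]^o))) => e e0.
    apply: filterS (near_modulus_lt z e0) => w.
    have -> : - conjc z - - conjc w = - conjc (z - w) by rewrite conjcB opprD.
    by rewrite modulusN modulus_conj.
  by apply: cG; rewrite modulusN modulus_conj.
have -> : (\int[planar_lebesgue]_(p in plane_disc rho) (G (to_complex p))%:E =
    \int[mu]_x \int[mu]_y f (x, y))%E.
  by rewrite integral_mkcond /planar_lebesgue (fubini_tonelli1 _ mf f0).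
rewrite ge0_integral_half; first last.
- by move=> x; apply: integral_ge0.
- exact: measurable_fun_fubini_tonelli_F.
rewrite -(half_disc_fubini _ G0 mG) (polar_right_half rho0 G0 mG cG).
have -> : (\int[mu]_(x in `]0%R, +oo[) \int[mu]_y f ((- x)%R, y) =
    \int[mu]_(x in `]0%R, +oo[) \int[mu]_y ((fun p => (G' (to_complex p))%:E) \_ (plane_disc rho)) (x, y))%E.
  apply: eq_integral => x _; apply: eq_integral => y _; rewrite /f !patchE G'E/=.
  congr (if _ then _ else _); rewrite /plane_disc/=; apply/idP/idP; rewrite !inE/=;
  by rewrite !modulusE/= sqrrN.
rewrite -half_disc_fubini//; last by move=> z; exact: G0.
rewrite (@polar_right_half _ rho G')//; last by move=> z; exact: G0.
have mP (K : R[i] -> R) : measurable_fun setT (fun p : plane R => K (to_complex p)) ->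
    measurable_fun setT (fun p : Rm * Rm => (K (polar p.2 p.1) * p.2)%:E).
  move=> mK; apply/measurable_EFinP/measurable_funM; last exact: measurable_plane2.
  have := measurable_polar mK => h.
  pose s (p : plane R) : plane R := (p.2, p.1).
  suff ms : measurable_fun setT s by exact: (measurableT_comp h ms).
  by apply: measurable_fun_pair; [exact: measurable_plane2|exact: measurable_plane1].
have swap (K : R[i] -> R) : (forall z, 0 <= K z) ->
    measurable_fun setT (fun p : plane R => K (to_complex p)) ->
    (\int[mu]_(t in `](- (pi / 2))%R, (pi / 2)%R[) \int[mu]_(r in `[0%R, rho]) (K (polar r t) * r)%:E =
     \int[mu]_(r in `[0%R, rho]) \int[mu]_(t in `](- (pi / 2))%R, (pi / 2)%R[) (K (polar r t) * r)%:E)%E.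
  move=> K0 mK; apply: (@tonelli_rect _ _ _ _ _ mu mu _ _ (fun p => (K (polar p.2 p.1) * p.2)%:E)).
  - exact: measurable_itv.
  - exact: measurable_itv.
  - by apply: measurable_funTS; exact: mP.
  - by move=> p _ /=; rewrite in_itv/= lee_fin => /andP[p0 _]; rewrite mulr_ge0.
rewrite !swap//; last by move=> z; exact: G0.
have mI (K : R[i] -> R) : (forall z, 0 <= K z) -> measurable_fun setT (fun p : plane R => K (to_complex p)) ->
    measurable_fun (`[0, rho]%classic : set Rm)
      (fun r => \int[mu]_(t in `](- (pi / 2))%R, (pi / 2)%R[) (K (polar r t) * r)%:E)%E.
  move=> K0 mK; apply: (@measurable_inner_integral _ _ _ _ _ mu _ _ (fun p => (K (polar p.1 p.2) * p.1)%:E)).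
  - exact: measurable_itv.
  - exact: measurable_itv.
  - apply: measurable_funTS; apply/measurable_EFinP.
    by apply: measurable_funM; [exact: measurable_polar|exact: measurable_plane1].
  - by move=> p /=; rewrite in_itv/= lee_fin => /andP[p0 _] _; rewrite mulr_ge0.
rewrite -ge0_integralD//.
- apply: eq_integral => r; rewrite inE/= in_itv/= => rr; rewrite -circle_sum//.
  congr (_ + _)%E; apply: eq_integral => t _; congr (G _ * _)%:E.
  have epi : expi pi = -1 :> R[i].
    by rewrite /expi cospi sinpi; apply: complex_eqP; rewrite /= ?oppr0.
  by rewrite /polar conjcM conj_real conj_expi expiD epi; ring.
- move=> r /=; rewrite in_itv/= => /andP[r0 _]; apply: integral_ge0 => t _.
  by rewrite lee_fin mulr_ge0.
- exact: mI.
- move=> r /=; rewrite in_itv/= => /andP[r0 _]; apply: integral_ge0 => t _.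
  by rewrite lee_fin mulr_ge0// G0.
- by apply: mI => // z; exact: G0.
Qed.

End PolarFormula.

(** * The Dirichlet space as an inner product space *)

Section Measurability.
Context {R : realType}.
Implicit Types (F G : plane R -> R[i]) (A : set (plane R)).

Definition cmeasurable A F : Prop :=
  measurable_fun A (fun p => complex.Re (F p)) /\ measurable_fun A (fun p => complex.Im (F p)).

Lemma cmeasurable_eq A F G : (forall p, A p -> F p = G p) -> cmeasurable A F -> cmeasurable A G.
Proof.
move=> FG [mr mi]; split.
  by apply: eq_measurable_fun mr => p /set_mem /FG ->.
by apply: eq_measurable_fun mi => p /set_mem /FG ->.
Qed.

Lemma cmeasurable_cst A (c : R[i]) : cmeasurable A (fun=> c).
Proof. by split; exact: measurable_cst. Qed.

Lemma cmeasurable_to_complex A : cmeasurable A to_complex.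
Proof. by split; apply: measurable_funTS; [exact: measurable_plane1|exact: measurable_plane2]. Qed.

Lemma cmeasurableD A F G : cmeasurable A F -> cmeasurable A G -> cmeasurable A (fun p => F p + G p).
Proof.
move=> [Fr Fi] [Gr Gi]; split.
  by under eq_fun do rewrite Re_add; exact: measurable_funD.
by under eq_fun do rewrite Im_add; exact: measurable_funD.
Qed.

Lemma cmeasurableM A F G : cmeasurable A F -> cmeasurable A G -> cmeasurable A (fun p => F p * G p).
Proof.
move=> [Fr Fi] [Gr Gi]; split.
  by under eq_fun do rewrite Re_mul; apply: measurable_funB; exact: measurable_funM.
by under eq_fun do rewrite Im_mul; apply: measurable_funD; exact: measurable_funM.
Qed.

Lemma cmeasurableJ A F : cmeasurable A F -> cmeasurable A (fun p => conjc (F p)).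
Proof.
move=> [Fr Fi]; split; first by under eq_fun do rewrite Re_conjc.
by under eq_fun do rewrite Im_conjc; exact: measurable_funN.
Qed.

Lemma cmeasurableX A F n : cmeasurable A F -> cmeasurable A (fun p => F p ^+ n).
Proof.
move=> mF; elim: n => [|n ih]; first exact: cmeasurable_cst.
by under eq_fun do rewrite exprS; exact: cmeasurableM.
Qed.

Lemma cmeasurable_sum A n (F : nat -> plane R -> R[i]) : (forall i, cmeasurable A (F i)) ->
  cmeasurable A (fun p => \sum_(i < n) F i p).
Proof.
move=> mF; elim: n => [|n ih].
  by under eq_fun do rewrite big_ord0; exact: cmeasurable_cst.
by under eq_fun do rewrite big_ord_recr/=; exact: cmeasurableD.
Qed.

Lemma cmeasurable_sqr A F : cmeasurable A F -> measurable_fun A (fun p => modulus (F p) ^+ 2).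
Proof.
move=> [Fr Fi]; under eq_fun do rewrite modulus_sqr.
by apply: measurable_funD; exact: measurable_funX.
Qed.

Lemma cmeasurable_cvg A (F : nat -> plane R -> R[i]) G : (forall n, cmeasurable A (F n)) ->
  (forall p, A p -> ccvg (F ^~ p) (G p)) -> cmeasurable A G.
Proof.
move=> mF FG; split.
- apply: (@measurable_fun_cvg _ _ _ _ (fun n p => complex.Re (F n p))) => [n|p Ap].
    by case: (mF n).
  apply/cvgrPdist_lt => e e0; apply: filterS (FG p Ap e e0) => n; apply: le_lt_trans.
  by rewrite -Re_opp -Re_add le_Re_modulus.
- apply: (@measurable_fun_cvg _ _ _ _ (fun n p => complex.Im (F n p))) => [n|p Ap].
    by case: (mF n).
  apply/cvgrPdist_lt => e e0; apply: filterS (FG p Ap e e0) => n; apply: le_lt_trans.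
  by rewrite -Im_opp -Im_add le_Im_modulus.
Qed.

Lemma cmeasurable_psum A a N F : cmeasurable A F -> cmeasurable A (fun p => psum a N (F p)).
Proof.
move=> mF; apply: (@cmeasurable_sum _ _ (fun i p => a i * F p ^+ i)) => i.
by apply: cmeasurableM; [exact: cmeasurable_cst|exact: cmeasurableX].
Qed.

Definition disc : set (plane R) := to_complex @^-1` unit_disc R.

Lemma measurable_disc : measurable disc.
Proof. by apply: measurable_lt_set; [exact: measurable_modulus|exact: measurable_cst]. Qed.

Lemma cmeasurable_holomorphic f A F : holomorphic f -> cmeasurable A F ->
  (forall p, A p -> unit_disc R (F p)) -> cmeasurable A (fun p => f (F p)).
Proof.
move=> hf mF FA; apply: (@cmeasurable_cvg _ (fun N p => psum (coef f) N (F p))).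
  by move=> n; exact: cmeasurable_psum.
by move=> p /FA; exact: taylor.
Qed.

Lemma cmeasurable_disc f : holomorphic f -> cmeasurable disc (fun p => f (to_complex p)).
Proof. by move=> hf; apply: cmeasurable_holomorphic => //; exact: cmeasurable_to_complex. Qed.

End Measurability.

Section PlaneIntegral.
Context {R : realType}.
Variables (mu : {measure set (plane R) -> \bar R}) (A : set (plane R)).
Hypothesis mA : measurable A.
Implicit Types (F G : plane R -> R[i]).

Definition pintegrable F : Prop :=
  mu.-integrable A (EFin \o (fun p => complex.Re (F p))) /\
  mu.-integrable A (EFin \o (fun p => complex.Im (F p))).

Definition pint F : R[i] :=
  ((\int[mu]_(p in A) complex.Re (F p)) +i* (\int[mu]_(p in A) complex.Im (F p)))%C.

Lemma Re_pint F : complex.Re (pint F) = \int[mu]_(p in A) complex.Re (F p). Proof. by []. Qed.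
Lemma Im_pint F : complex.Im (pint F) = \int[mu]_(p in A) complex.Im (F p). Proof. by []. Qed.

Lemma eq_pint F G : (forall p, A p -> F p = G p) -> pint F = pint G.
Proof.
by move=> FG; congr (_ +i* _)%C; apply: eq_Rintegral => p /set_mem /FG ->.
Qed.

Let integrable_lin2 (k l : R) (u v : plane R -> R) :
  mu.-integrable A (EFin \o u) -> mu.-integrable A (EFin \o v) ->
  mu.-integrable A (EFin \o (fun x => k * u x + l * v x)).
Proof.
move=> iu iv.
by have := integrableD mA (integrableZl mA k iu) (integrableZl mA l iv).
Qed.

Let Rintegral_lin2 (k l : R) (u v : plane R -> R) :
  mu.-integrable A (EFin \o u) -> mu.-integrable A (EFin \o v) ->
  \int[mu]_(p in A) (k * u p + l * v p) =
  k * \int[mu]_(p in A) u p + l * \int[mu]_(p in A) v p.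
Proof.
move=> iu iv; rewrite -!RintegralZl// -RintegralD//.
  by have := integrableZl mA k iu.
by have := integrableZl mA l iv.
Qed.

Lemma pintegrableD F G : pintegrable F -> pintegrable G -> pintegrable (fun p => F p + G p).
Proof.
move=> [Fr Fi] [Gr Gi]; split.
  have -> : (fun p => complex.Re (F p + G p)) = (fun p => 1 * complex.Re (F p) + 1 * complex.Re (G p)).
    by apply/funext => p; rewrite Re_add !mul1r.
  exact: integrable_lin2.
have -> : (fun p => complex.Im (F p + G p)) = (fun p => 1 * complex.Im (F p) + 1 * complex.Im (G p)).
  by apply/funext => p; rewrite Im_add !mul1r.
exact: integrable_lin2.
Qed.

Lemma pintegrableZ (a : R[i]) F : pintegrable F -> pintegrable (fun p => a * F p).
Proof.
move=> [Fr Fi]; split.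
  have -> : (fun p => complex.Re (a * F p)) =
      (fun p => complex.Re a * complex.Re (F p) + (- complex.Im a) * complex.Im (F p)).
    by apply/funext => p; rewrite Re_mul mulNr.
  exact: integrable_lin2.
have -> : (fun p => complex.Im (a * F p)) =
    (fun p => complex.Re a * complex.Im (F p) + complex.Im a * complex.Re (F p)).
  by apply/funext => p; rewrite Im_mul.
exact: integrable_lin2.
Qed.

Lemma pintD F G : pintegrable F -> pintegrable G -> pint (fun p => F p + G p) = pint F + pint G.
Proof.
move=> [Fr Fi] [Gr Gi]; apply: complex_eqP; rewrite ?Re_add ?Im_add ?Re_pint ?Im_pint.
  rewrite -[X in X + _]mul1r -[X in _ + X]mul1r -Rintegral_lin2//.
  by apply: eq_Rintegral => p _; rewrite Re_add !mul1r.
rewrite -[X in X + _]mul1r -[X in _ + X]mul1r -Rintegral_lin2//.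
by apply: eq_Rintegral => p _; rewrite Im_add !mul1r.
Qed.

Lemma pintZ (a : R[i]) F : pintegrable F -> pint (fun p => a * F p) = a * pint F.
Proof.
move=> [Fr Fi]; apply: complex_eqP; rewrite ?Re_mul ?Im_mul ?Re_pint ?Im_pint.
  rewrite -mulNr -Rintegral_lin2//.
  by apply: eq_Rintegral => p _; rewrite Re_mul mulNr.
rewrite -Rintegral_lin2//.
by apply: eq_Rintegral => p _; rewrite Im_mul.
Qed.

Lemma pintJ F : pintegrable F -> pint (fun p => conjc (F p)) = conjc (pint F).
Proof.
move=> [Fr Fi]; apply: complex_eqP; rewrite ?Re_conjc ?Im_conjc ?Re_pint ?Im_pint.
  by apply: eq_Rintegral => p _; rewrite Re_conjc.
rewrite -mulN1r -RintegralZl//.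
by apply: eq_Rintegral => p _; rewrite Im_conjc mulN1r.
Qed.

Lemma pintegrable_le F (g : plane R -> R) : cmeasurable A F -> mu.-integrable A (EFin \o g) ->
  (forall p, A p -> modulus (F p) <= g p) -> pintegrable F.
Proof.
move=> [Fr Fi] ig Fg.
split; apply: (le_integrable mA _ _ ig); try exact/measurable_EFinP; move=> p Ap.
- rewrite /= lee_fin (le_trans _ (ler_norm _))//.
  exact: le_trans (le_Re_modulus _) (Fg p Ap).
- rewrite /= lee_fin (le_trans _ (ler_norm _))//.
  exact: le_trans (le_Im_modulus _) (Fg p Ap).
Qed.

Lemma ge0_integrable (u : plane R -> R) : measurable_fun A u -> (forall p, 0 <= u p) ->
  (\int[mu]_(p in A) (u p)%:E < +oo)%E -> mu.-integrable A (EFin \o u).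
Proof.
move=> mu_ u0 uoo; apply/integrableP; split; first exact/measurable_EFinP.
apply: le_lt_trans uoo; rewrite le_eqVlt; apply/orP; left; apply/eqP.
by apply: eq_integral => p _; rewrite /= ger0_norm.
Qed.

End PlaneIntegral.

Section DirichletForm.
Context {R : realType}.
Local Notation lam := (@planar_lebesgue R).
Local Notation D' := complex_derivative.
Implicit Types (f g h : R[i] -> R[i]).

Definition gradient_integral f : \bar R :=
  (\int[lam]_(p in disc) (modulus (D' f (to_complex p)) ^+ 2)%:E)%E.

Lemma gradient_integral_ge0 f : (0 <= gradient_integral f)%E.
Proof. by apply: integral_ge0 => p _; rewrite lee_fin sqr_ge0. Qed.

Lemma dirichlet_integralE f : dirichlet_integral f = ((pi^-1)%:E * gradient_integral f)%E.
Proof. by []. Qed.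

Lemma dirichlet_integral_lty f : (dirichlet_integral f < +oo)%E = (gradient_integral f < +oo)%E.
Proof.
have p0 : 0 < pi^-1 :> R by rewrite invr_gt0 pi_gt0.
rewrite dirichlet_integralE; have := gradient_integral_ge0 f.
case: (gradient_integral f) => [r| |]//= _; first by rewrite -EFinM !ltry.
by rewrite mulry gtr0_sg// mul1e.
Qed.

Lemma complex_derivative_lin (a : R[i]) f g z : holomorphic f -> holomorphic g -> unit_disc R z ->
  D' (a *: f + g) z = a * D' f z + D' g z /\
  derivable (a *: f + g : R[i]^o -> R[i]^o) (z : R[i]^o) 1.
Proof.
move=> hf hg z1; have df := is_derive_holomorphic hf z1; have dg := is_derive_holomorphic hg z1.
have d : is_derive (z : R[i]^o) 1 (a *: f + g : R[i]^o -> R[i]^o) (a * D' f z + D' g z).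
  exact: (is_deriveD (is_deriveZ a df) dg).
by split; [rewrite /complex_derivative; case: d|case: d].
Qed.

Lemma holomorphic_lin (a : R[i]) f g : holomorphic f -> holomorphic g -> holomorphic (a *: f + g).
Proof. by move=> hf hg z z1; have [] := complex_derivative_lin a hf hg z1. Qed.

Lemma measurable_derivative_sqr f : holomorphic f ->
  measurable_fun disc (fun p => (modulus (D' f (to_complex p)) ^+ 2)%:E).
Proof.
move=> hf; apply/measurable_EFinP; apply: cmeasurable_sqr.
by apply: (@cmeasurable_disc R (D' f)); exact: holomorphic_derivative.
Qed.

(** The parallelogram law, without the other diagonal. *)
Lemma modulus_sqrD (x y : R[i]) : modulus (x + y) ^+ 2 <= 2 * (modulus x ^+ 2 + modulus y ^+ 2).
Proof.
apply: (@le_trans _ _ ((modulus x + modulus y) ^+ 2)).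
  by rewrite lerXn2r ?nnegrE ?addr_ge0 ?modulus_ge0// le_modulusD.
by have := sqr_ge0 (modulus x - modulus y); nra.
Qed.

Lemma dirichlet_space_lin (a : R[i]) f g : dirichlet_space f -> dirichlet_space g ->
  dirichlet_space (a *: f + g).
Proof.
move=> [hf]; rewrite dirichlet_integral_lty => Df [hg]; rewrite dirichlet_integral_lty => Dg.
have hfg : holomorphic (a *: f + g) by exact: holomorphic_lin.
split => //; rewrite dirichlet_integral_lty.
pose u p := (modulus (D' f (to_complex p)) ^+ 2)%:E; pose v p := (modulus (D' g (to_complex p)) ^+ 2)%:E.
apply: (@le_lt_trans _ _ ((2 * modulus a ^+ 2)%:E * \int[lam]_(p in disc) u p +
    2%:E * \int[lam]_(p in disc) v p)%E).
  rewrite -!ge0_integralZl//; first last.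
  - by rewrite lee_fin mulr_ge0 ?sqr_ge0.
  - by move=> p _; rewrite lee_fin sqr_ge0.
  - exact: measurable_derivative_sqr.
  - exact: measurable_disc.
  - by move=> p _; rewrite lee_fin sqr_ge0.
  - exact: measurable_derivative_sqr.
  - exact: measurable_disc.
  rewrite -ge0_integralD//; first last.
  - by apply: measurable_funeM; exact: measurable_derivative_sqr.
  - by move=> p _; rewrite -EFinM lee_fin mulr_ge0 ?sqr_ge0.
  - by apply: measurable_funeM; exact: measurable_derivative_sqr.
  - by move=> p _; rewrite mule_ge0// lee_fin ?sqr_ge0// mulr_ge0 ?sqr_ge0.
  - exact: measurable_disc.
  apply: ge0_le_integral.
  - exact: measurable_disc.
  - by move=> p _; rewrite lee_fin sqr_ge0.
  - exact: measurable_derivative_sqr.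
  - by apply: emeasurable_funD; apply: measurable_funeM; exact: measurable_derivative_sqr.
  - move=> p pD; rewrite -!EFinM -EFinD lee_fin (complex_derivative_lin a hf hg pD).1.
    apply: (le_trans (modulus_sqrD _ _)); by rewrite modulusM exprMn mulrDr mulrA lexx.
apply: lte_add_pinfty.
  apply: lte_mul_pinfty; [by rewrite lee_fin mulr_ge0 ?sqr_ge0|by []|exact: Df].
by apply: lte_mul_pinfty; [rewrite lee_fin|by []|exact: Dg].
Qed.

Lemma complex_derivative_cst (c : R[i]) z : D' (fun=> c) z = 0.
Proof. by rewrite /complex_derivative derive_cst. Qed.

Lemma dirichlet_space0 : dirichlet_space (0 : R[i] -> R[i]).
Proof.
split; first by move=> z _; exact: derivable_cst.
rewrite dirichlet_integral_lty /gradient_integral integral0_eq ?ltry// => p _.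
by rewrite complex_derivative_cst modulus0 expr0n.
Qed.

Lemma integrable_product f g : dirichlet_space f -> dirichlet_space g ->
  pintegrable lam disc (fun p => D' f (to_complex p) * conjc (D' g (to_complex p))).
Proof.
move=> [hf]; rewrite dirichlet_integral_lty => Df [hg]; rewrite dirichlet_integral_lty => Dg.
have mf := cmeasurable_disc (holomorphic_derivative hf).
have mg := cmeasurable_disc (holomorphic_derivative hg).
have i_f := ge0_integrable (cmeasurable_sqr mf) (fun p => sqr_ge0 _) Df.
have i_g := ge0_integrable (cmeasurable_sqr mg) (fun p => sqr_ge0 _) Dg.
apply: (pintegrable_le measurable_disc (cmeasurableM mf (cmeasurableJ mg))
  (integrableD measurable_disc i_f i_g)) => p _.
rewrite /=; move: (D' f _) (D' g _) => z w; rewrite modulusM modulus_conj.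
move: (modulus z) (modulus w) => x y.
by have := sqr_ge0 (x - y); have := sqr_ge0 x; have := sqr_ge0 y; nra.
Qed.

Definition derivative_form f g : R[i] :=
  pint lam disc (fun p => D' f (to_complex p) * conjc (D' g (to_complex p))).

Lemma dirichlet_innerE f g : dirichlet_inner f g =
  f 0 * conjc (g 0) + (pi^-1)%:C%C * derivative_form f g.
Proof. by []. Qed.

Lemma derivative_form_lin (a : R[i]) f g h : dirichlet_space f -> dirichlet_space g ->
  dirichlet_space h -> derivative_form (a *: f + g) h = a * derivative_form f h + derivative_form g h.
Proof.
move=> Df Dg Dh; have mD := @measurable_disc R.
have iF := integrable_product Df Dh; have iG := integrable_product Dg Dh.
have iaF := pintegrableZ mD a iF.
rewrite /derivative_form -(pintZ mD a iF) -(pintD mD iaF iG); apply: eq_pint => p pD.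
by rewrite (complex_derivative_lin a Df.1 Dg.1 pD).1 mulrDl mulrA.
Qed.

Lemma dirichlet_inner_lin (a : R[i]) f g h : dirichlet_space f -> dirichlet_space g ->
  dirichlet_space h -> dirichlet_inner (a *: f + g) h = a * dirichlet_inner f h + dirichlet_inner g h.
Proof.
move=> Df Dg Dh; rewrite !dirichlet_innerE derivative_form_lin//.
have -> : (a *: f + g) 0 = a * f 0 + g 0 by [].
move: (derivative_form _ _) (derivative_form _ _) (f 0) (g 0) (conjc _) _%:C%C => x y u v w c.
ring.
Qed.

Lemma dirichlet_inner_herm f g : dirichlet_space f -> dirichlet_space g ->
  dirichlet_inner g f = conjc (dirichlet_inner f g).
Proof.
move=> Df Dg; have iF := integrable_product Df Dg.
rewrite !dirichlet_innerE conjcD !conjcM conjcK conj_real; congr (_ + _ * _).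
  by rewrite mulrC.
rewrite /derivative_form -(pintJ measurable_disc iF); apply: eq_pint => p _.
by rewrite conjcM conjcK mulrC.
Qed.

Lemma dirichlet_sqnormE f : dirichlet_space f ->
  dirichlet_sqnorm f = (complex.Re (dirichlet_inner f f))%:E.
Proof.
move=> Df; rewrite dirichlet_innerE Re_add (Re_mul (pi^-1)%:C%C) (mulCJ (f 0)).
rewrite (_ : complex.Re (pi^-1)%:C%C = pi^-1)// (_ : complex.Im (pi^-1)%:C%C = 0)//.
rewrite mul0r subr0 (_ : complex.Re (modulus (f 0) ^+ 2)%:C%C = modulus (f 0) ^+ 2)//.
suff -> : complex.Re (derivative_form f f) = fine (gradient_integral f).
  rewrite EFinD (EFinM pi^-1) fineK; first by rewrite /dirichlet_sqnorm dirichlet_integralE.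
  by rewrite ge0_fin_numE ?gradient_integral_ge0// -dirichlet_integral_lty Df.2.
rewrite /derivative_form Re_pint /Rintegral; congr fine.
by apply: eq_integral => p _; rewrite mulCJ.
Qed.

Lemma dirichlet_sqnorm_ge0 f : (0 <= dirichlet_sqnorm f)%E.
Proof.
rewrite /dirichlet_sqnorm adde_ge0 ?lee_fin ?sqr_ge0// dirichlet_integralE.
by rewrite mule_ge0 ?gradient_integral_ge0// lee_fin invr_ge0 pi_ge0.
Qed.

Lemma dirichlet_inner_pos f : dirichlet_space f -> 0 <= complex.Re (dirichlet_inner f f).
Proof. by move=> Df; rewrite -lee_fin -dirichlet_sqnormE// dirichlet_sqnorm_ge0. Qed.

End DirichletForm.

(** * Integrals over circles and discs *)

Section CircleIntegrals.
Context {R : realType}.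
Local Notation mu := (@lebesgue_measure R).
Implicit Types (G : R[i] -> R) (rho r t : R).

Definition circle_integral G r : R := \int[mu]_(t in `[- pi, - pi + 2 * pi]) G (polar r t).

Lemma polar_continuous : continuous (fun p : R * R => polar p.1 p.2 : R[i]^o).
Proof.
move=> p; apply/cvg_ReImP.
have c1 : (fst : R * R -> R) q @[q --> p] --> p.1 by exact: cvg_fst.
have c2 : (snd : R * R -> R) q @[q --> p] --> p.2 by exact: cvg_snd.
have cc : (fun q : R * R => cos q.2) @ p --> cos p.2.
  exact: (@continuous_comp _ _ _ (snd : R * R -> R) (cos : R -> R) p c2 (@continuous_cos R _)).
have cs : (fun q : R * R => sin q.2) @ p --> sin p.2.
  exact: (@continuous_comp _ _ _ (snd : R * R -> R) (sin : R -> R) p c2 (@continuous_sin R _)).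
have eR (q : R * R) : complex.Re (polar q.1 q.2) = q.1 * cos q.2 by rewrite Re_mul/= mul0r subr0.
have eI (q : R * R) : complex.Im (polar q.1 q.2) = q.1 * sin q.2 by rewrite Im_mul/= mul0r addr0.
by split; rewrite ?eR ?eI; under eq_fun do rewrite ?eR ?eI; exact: cvgM.
Qed.

(** The closed disc is the image of a rectangle under polar coordinates. *)
Lemma disc_bounded G rho : (forall z, modulus z <= rho -> {for (z : R[i]^o), continuous (G : R[i]^o -> R)}) ->
  exists M, forall z, modulus z <= rho -> `|G z| <= M.
Proof.
move=> cG; pose A := `[0, rho]%classic `*` `[- pi, pi]%classic : set (R * R).
have cA : compact A by apply: compact_setX; exact: segment_compact.
have cF : {within A, continuous (fun p : R * R => G (polar p.1 p.2))}.
  apply: continuous_in_subspaceT => p /set_mem [/=]; rewrite in_itv/= => /andP[p0 pr] _.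
  apply: (@continuous_comp _ _ _ (fun p : R * R => polar p.1 p.2 : R[i]^o) (G : R[i]^o -> R)).
    exact: polar_continuous.
  by apply: cG; rewrite modulus_polarE ger0_norm.
have [M [_ MP]] := compact_bounded (continuous_compact cF cA).
exists (M + 1) => z zr; have [t tpi ->] := polarE z.
apply: (MP (M + 1)); first by rewrite ltrDl.
by exists (modulus z, t) => //; split => /=; rewrite in_itv//= modulus_ge0.
Qed.

Lemma circle_continuous G rho r : (forall z, modulus z < rho -> {for (z : R[i]^o), continuous (G : R[i]^o -> R)}) ->
  `|r| < rho -> continuous (fun t => G (polar r t)).
Proof.
move=> cG r1 t; have [cz] := curve_derive_ccont (curve_derive_arc r t).
by apply: (continuous_comp cz); apply: cG; rewrite modulus_polarE.
Qed.

Lemma ray_continuous G rho r t : (forall z, modulus z < rho -> {for (z : R[i]^o), continuous (G : R[i]^o -> R)}) ->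
  `|r| < rho -> {for r, continuous (fun r => G (polar r t))}.
Proof.
move=> cG r1; have [cz] := curve_derive_ccont (curve_derive_ray r t).
by apply: (continuous_comp cz); apply: cG; rewrite modulus_polarE.
Qed.

Lemma itv_cst_integrable a b (M : R) : mu.-integrable `[a, b] (EFin \o cst M).
Proof. by apply: segment_integrable => x _; exact: cvg_cst. Qed.

(** Dominated convergence at [r] needs a bound on a neighbourhood of the circle. *)
Lemma circle_room G rho r : (forall z, modulus z < rho -> {for (z : R[i]^o), continuous (G : R[i]^o -> R)}) ->
  `|r| < rho -> exists rho1, [/\ `|r| < rho1, rho1 < rho &
    exists M, forall z, modulus z <= rho1 -> `|G z| <= M].
Proof.
move=> cG r1; exists ((`|r| + rho) / 2); split; [lra|lra|].
apply: disc_bounded => z zr; apply: cG; lra.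
Qed.

Lemma circle_integral_continuous G rho r : (forall z, modulus z < rho -> {for (z : R[i]^o), continuous (G : R[i]^o -> R)}) ->
  `|r| < rho -> {for r, continuous (circle_integral G)}.
Proof.
move=> cG r1; have [s [rs srho [M MP]]] := circle_room cG r1.
apply: (@continuity_under_integral R _ _ mu (fun r t => G (polar r t)) `[- pi, - pi + 2 * pi]
  (measurable_itv _) (- s) s _ _ (cst M) (itv_cst_integrable _ _ _)).
- move=> x /=; rewrite in_itv/= -ltr_norml => xs; apply: segment_integrable => t _.
  by apply: (circle_continuous cG); exact: lt_trans srho.
- apply: aeW => t _ x /set_mem/=; rewrite in_itv/= -ltr_norml => xs.
  by apply: (ray_continuous (rho := rho)) => //; exact: lt_trans srho.
- move=> x /=; rewrite in_itv/= -ltr_norml => xs; apply: aeW => t _.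
  by apply: MP; rewrite modulus_polarE ltW.
- by rewrite inE/= in_itv/= -ltr_norml.
Qed.

(** [polar_integral] is applied to the extension of [G] by [0] outside of the
    larger disc, which is continuous on the smaller one. *)
Lemma disc_integral G rho rho1 : 0 < rho < rho1 -> (forall z, modulus z < rho1 -> 0 <= G z) ->
  measurable_fun [set p : plane R | modulus (to_complex p) < rho1] (fun p => G (to_complex p)) ->
  (forall z, modulus z < rho1 -> {for (z : R[i]^o), continuous (G : R[i]^o -> R)}) ->
  (\int[planar_lebesgue]_(p in plane_disc rho) (G (to_complex p))%:E =
   (\int[mu]_(r in `[0, rho]) (r * circle_integral G r))%:E)%E.
Proof.
move=> /andP[r0 r1] G0 mG cG.
pose G1 z := if modulus z < rho1 then G z else 0.
have near_G1 (z : R[i]^o) : modulus z < rho1 -> \forall w \near z, G1 w = G w.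
  move=> z1; apply/near_modulusP; exists (rho1 - modulus z); first by rewrite subr_gt0.
  move=> w wz; rewrite /G1 ifT// -[w](subrK z); apply: (le_lt_trans (le_modulusD _ _)).
  by rewrite -ltrBrDr.
have mD : measurable [set p : plane R | modulus (to_complex p) < rho1].
  by apply: measurable_lt_set; [exact: measurable_modulus|exact: measurable_cst].
transitivity (\int[planar_lebesgue]_(p in plane_disc rho) (G1 (to_complex p))%:E)%E.
  apply: eq_integral => p /set_mem /= pr; rewrite /G1 ifT//.
  exact: le_lt_trans pr r1.
rewrite polar_integral//; first last.
- move=> z zr; have z1 : modulus z < rho1 by exact: le_lt_trans zr r1.
  have -> : {for (z : R[i]^o), continuous (G1 : R[i]^o -> R)} = (G1 @ nbhs (z : R[i]^o) --> G z).
    by rewrite /prop_for /continuous_at (_ : G1 z = G z)// /G1 z1.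
  apply: cvg_trans (cG z z1); apply: near_eq_cvg.
  by apply: filterS (near_G1 z z1) => w ->.
- have -> : (fun p : plane R => G1 (to_complex p)) =
      (fun p => G (to_complex p)) \_ [set p : plane R | modulus (to_complex p) < rho1].
    by apply/funext => p; rewrite patchE /G1 mem_setE.
  exact/(measurable_restrictT _ mD).
- by move=> z; rewrite /G1; case: ifP => // /G0.
have i_c : mu.-integrable `[0, rho] (EFin \o (fun r => r * circle_integral G r)).
  apply: segment_integrable => x /andP[x0 xr]; apply: cvgM; first exact: cvg_id.
  by apply: (circle_integral_continuous cG); rewrite ger0_norm// (le_lt_trans xr).
rewrite /Rintegral fineK; last exact: integrable_fin_num.
apply: eq_integral => r; rewrite inE/= in_itv/= => /andP[x0 xr]; congr (_ * _)%:E.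
apply: eq_Rintegral => t _; rewrite /G1 ifT// modulus_polar//.
exact: le_lt_trans r1.
Qed.

End CircleIntegrals.

Section FourierDerivative.
Context {R : realType}.
Implicit Types (F : R -> R[i]) (f : R[i] -> R[i]).
Local Notation D' := complex_derivative.

(** Integration by parts: the boundary terms cancel by periodicity. *)
Lemma fourier_derive a F F' k : (forall t, curve_derive F t (F' t)) -> (forall t, ccont F' t) ->
  (forall t, F (t + 2 * pi) = F t) -> fourier a F' k = 'i%C * k%:~R * fourier a F k.
Proof.
move=> dF cF' FT; have cF t : ccont F t by exact: curve_derive_ccont (dF t).
pose c : R[i] := 'i%C * (- k)%:~R.
have h1 : ccont_on a (a + 2 * pi) (fun t => F' t * wave (- k) t).
  by move=> t _; apply: ccontM (cF' t) (ccont_wave _ _).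
have h2 : ccont_on a (a + 2 * pi) (fun t => F t * wave (- k) t).
  by move=> t _; apply: ccontM (cF t) (ccont_wave _ _).
have h3 : ccont_on a (a + 2 * pi) (fun t => c * (F t * wave (- k) t)).
  by move=> t tI; apply: ccontM (ccont_cst _ _) (h2 t tI).
have := @cint_FTC R (fun t => F' t * wave (- k) t + c * (F t * wave (- k) t))
  (fun t => F t * wave (- k) t) a (a + 2 * pi).
rewrite FT wave_period subrr cintD// cintZ// => E.
have {}E : cint a (a + 2 * pi) (fun t => F' t * wave (- k) t) =
    - (c * cint a (a + 2 * pi) (fun t => F t * wave (- k) t)).
  apply/eqP; rewrite -addr_eq0 E//.
  - by rewrite lerDl pi2_ge0.
  - move=> t _; apply: curve_derive_eq; first exact: curve_deriveM (dF t) (curve_derive_wave _ _).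
    by rewrite mulrCA.
  - by move=> t tI; apply: ccontD; [exact: h1|exact: h3].
rewrite /fourier /fourier_form.
under eq_cint do rewrite conj_wave.
rewrite E; under [X in _ = _ * (_ * X)]eq_cint do rewrite conj_wave.
rewrite /c mulrNz; move: (cint _ _ _) ('i%C : R[i]) (k%:~R : R[i]) (_%:C%C) => x y z u; ring.
Qed.

Lemma coef_derivative f m : holomorphic f -> coef (D' f) m = dcoef (coef f) m.
Proof.
move=> hf; pose r : R := 1 / 2.
have r01 : 0 < r < 1 by rewrite /r; apply/andP; split; lra.
have [r0 r1] := andP r01; have rn : `|r| < 1 by rewrite ger0_norm// ltW.
have hf' := holomorphic_derivative hf.
pose F t := f (polar r t); pose F' t := D' f (polar r t) * ('i%C * polar r t).
have dF t : curve_derive F t (F' t).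
  apply: (curve_derive_comp (g := polar r)); last exact: curve_derive_arc.
  by apply: is_derive_holomorphic => //; exact: polar_disc.
have cF' t : ccont F' t.
  apply: ccontM; first exact: holomorphic_ccont.
  by apply: ccontM; [exact: ccont_cst|exact: curve_derive_ccont (curve_derive_arc r t)].
have FT t : F (t + 2 * pi) = F t by rewrite /F polar_period.
have := fourier_derive (- pi) m.+1%:Z dF cF' FT.
rewrite (fourier_circle _ hf)//.
have -> : fourier (- pi) F' m.+1%:Z =
    ('i%C * r%:C%C) * fourier (- pi) (fun t => D' f (polar r t)) m%:Z.
  rewrite /fourier /fourier_form mulrCA.
  rewrite -(@cintZ R _ _ ('i%C * r%:C%C) (fun t => D' f (polar r t) * conjc (wave m t))); last first.
    move=> t _; apply: ccontM; first exact: holomorphic_ccont.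
    by apply: ccontJ; exact: ccont_wave.
  congr (_ * _); apply: eq_cint => t _; rewrite /F' /polar !conj_wave.
  rewrite intS opprD addrC waveD [wave (-1) t]/wave mulN1r -conj_expi.
  rewrite -[in RHS](mulr1 (wave _ _)) -[in RHS](_ : expi t * conjc (expi t) = 1).
    move: 'i%C (wave _ _) r%:C%C (expi t) (conjc (expi t)) (D' f _) => x y z u v w; ring.
  by rewrite mulCJ modulus_expi expr1n.
rewrite (fourier_circle _ hf')// /dcoef => E.
have rC0 : ('i%C * r%:C%C) * (r ^+ m)%:C%C != 0 :> R[i].
  rewrite -modulus_eq0 !modulusM modulusi !modulus_real mul1r mulf_neq0// normr_eq0 ?expf_neq0// gt_eqF//.
apply: (mulfI rC0); rewrite -[LHS]mulrA E exprS rmorphM/=.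
rewrite (_ : m.+1%:~R = m.+1%:R :> R[i])//.
move: 'i%C r%:C%C (_%:C%C) (coef f _) (_%:R) => x y z u v; ring.
Qed.

End FourierDerivative.

Section GradientBounds.
Context {R : realType}.
Implicit Types (f : R[i] -> R[i]).
Local Notation D' := complex_derivative.
Local Notation mu := (@lebesgue_measure R).
Local Notation lam := (@planar_lebesgue R).

Lemma holomorphic_continuous f (z : R[i]^o) : holomorphic f -> unit_disc R z ->
  {for z, continuous (f : R[i]^o -> R[i]^o)}.
Proof. by move=> hf z1; exact: is_derive_complex_continuous (is_derive_holomorphic hf z1). Qed.

Lemma holomorphic_sqr_continuous f (z : R[i]^o) : holomorphic f -> unit_disc R z ->
  {for z, continuous (fun z : R[i]^o => modulus (f z) ^+ 2)}.
Proof.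
move=> hf z1; have c : {for z, continuous (fun z : R[i]^o => modulus (f z))}.
  apply: (@continuous_comp _ _ _ (f : R[i]^o -> R[i]^o) (modulus : R[i]^o -> R)).
    exact: holomorphic_continuous.
  exact: continuous_modulus.
exact: (cvgM c c).
Qed.

Lemma Rintegral_pow (c : R) n rho : 0 <= rho ->
  \int[mu]_(r in `[0, rho]) (c * r ^+ n) = c * rho ^+ n.+1 / n.+1%:R.
Proof.
move=> r0; pose g r := c / n.+1%:R * r ^+ n.+1.
transitivity (g rho - g 0); last by rewrite /g expr0n/= mulr0 subr0 mulrAC.
apply: Rintegral_FTC; first exact: r0.
- move=> x _; have d : is_derive x (1 : R) (fun r : R => r ^+ n.+1) (n.+1%:R * x ^+ n).
    by split; [exact: exprn_derivable|rewrite exp_derive /GRing.scale/= mulr1].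
  apply: (is_derive_eq (is_deriveZ (c / n.+1%:R) d)).
  have n0 : n.+1%:R != 0 :> R by rewrite pnatr_eq0.
  by rewrite /GRing.scale/= mulrA divfK.
- move=> x _; apply: cvgM; first exact: cvg_cst.
  exact: exprn_continuous.
Qed.

Lemma gradient_disc f rho : holomorphic f -> 0 < rho < 1 ->
  (\int[lam]_(p in plane_disc rho) (modulus (D' f (to_complex p)) ^+ 2)%:E =
   (\int[mu]_(r in `[0, rho]) (r * circle_integral (fun z => modulus (D' f z) ^+ 2) r))%:E)%E.
Proof.
move=> hf r01; have hf' := holomorphic_derivative hf.
apply: (disc_integral r01 (G := fun z => modulus (D' f z) ^+ 2)).
- by move=> z _; rewrite sqr_ge0.
- exact: cmeasurable_sqr (cmeasurable_disc hf').
- by move=> z z1; exact: holomorphic_sqr_continuous.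
Qed.

(** Bessel's inequality, for a single frequency. *)
Lemma circle_coef f r m : holomorphic f -> 0 < r < 1 ->
  2 * pi * (modulus (coef f m) ^+ 2 * r ^+ m.*2) <= circle_integral (fun z => modulus (f z) ^+ 2) r.
Proof.
move=> hf r01; have [r0 r1] := andP r01.
have cF : ccont_on (- pi) (- pi + 2 * pi) (fun t => f (polar r t)).
  by move=> t _; apply: holomorphic_ccont; rewrite // ger0_norm// ltW.
have := @fourier_bessel R (- pi) [:: m%:Z] _ isT cF.
rewrite big_seq1 fourier_circle// ler_pdivlMl ?mulr_gt0 ?pi_gt0//.
rewrite modulusM modulus_real ger0_norm ?exprn_ge0 ?(ltW r0)//.
by rewrite exprMn -exprM muln2 [_ * modulus _ ^+ 2]mulrC.
Qed.

(** Each Taylor coefficient contributes at least its own share to the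
    area of the image, counted with multiplicity. *)
Lemma gradient_integral_coef f rho m : holomorphic f -> 0 < rho < 1 ->
  ((pi * m.+1%:R * modulus (coef f m.+1) ^+ 2 * rho ^+ m.*2.+2)%:E <= gradient_integral f)%E.
Proof.
move=> hf r01; have [r0 r1] := andP r01; have hf' := holomorphic_derivative hf.
apply: (@le_trans _ _ (\int[lam]_(p in plane_disc rho) (modulus (D' f (to_complex p)) ^+ 2)%:E)%E).
  have key (r : R) : 0 <= r <= rho -> 2 * pi * modulus (coef (D' f) m) ^+ 2 * r ^+ m.*2.+1 <=
      r * circle_integral (fun z => modulus (D' f z) ^+ 2) r.
    rewrite le_eqVlt => /andP[/predU1P[<-|x0] xr]; first by rewrite mul0r expr0n/= mulr0.
    by rewrite [r ^+ _]exprS mulrCA ler_pM2l// -[leLHS]mulrA circle_coef// x0/=; exact: le_lt_trans r1.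
  rewrite gradient_disc// lee_fin.
  have -> : pi * m.+1%:R * modulus (coef f m.+1) ^+ 2 * rho ^+ m.*2.+2 =
      \int[mu]_(r in `[0, rho]) (2 * pi * modulus (coef (D' f) m) ^+ 2 * r ^+ m.*2.+1).
    rewrite Rintegral_pow ?(ltW r0)// coef_derivative// /dcoef modulusM modulus_nat exprMn.
    rewrite -doubleS -[m.+1.*2]muln2 natrM.
    have : m.+1%:R != 0 :> R by rewrite pnatr_eq0.
    move: (m.+1%:R) (modulus _) (rho ^+ _) (pi : R) => n x y p n0; field; exact: n0.
  apply: le_Rintegral.
  - exact: measurable_itv.
  - by apply: segment_integrable => x _; apply: cvgM; [exact: cvg_cst|exact: exprn_continuous].
  - apply: segment_integrable => x /andP[x0 xr]; apply: cvgM; first exact: cvg_id.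
    apply: (@circle_integral_continuous _ _ 1); last by rewrite ger0_norm// (le_lt_trans xr).
    by move=> z z1; exact: holomorphic_sqr_continuous.
  - move=> r /=; rewrite in_itv/= => rr; exact: key.
apply: ge0_subset_integral.
- exact: measurable_plane_disc.
- exact: measurable_disc.
- exact: measurable_derivative_sqr.
- by move=> p _; rewrite lee_fin sqr_ge0.
- by move=> p /= pr; exact: le_lt_trans r1.
Qed.

End GradientBounds.

(** * Limits of Taylor coefficients *)

Section CoefficientLimits.
Context {R : realType}.
Implicit Types (a b : nat -> R[i]) (u : nat -> R[i]) (f g : R[i] -> R[i]).

Lemma cauchy_ccvg u : (forall e : R, 0 < e -> exists N, forall n, (N <= n)%N -> modulus (u n - u N) <= e) ->
  exists l, ccvg u l.
Proof.
move=> uC; have H (h : R[i] -> R) : (forall z w, `|h z - h w| <= modulus (z - w)) ->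
    cvgn (fun n => h (u n)).
  move=> hm; apply/cauchy_cvgP/cauchy_ballP => e e0.
  have e20 : 0 < e / 3 by rewrite divr_gt0.
  have [N NP] := uC _ e20; exists ([set h (u n) | n in [set n | (N <= n)%N]], [set h (u n) | n in [set n | (N <= n)%N]]).
    by split; exists N => // n /= Nn; exists n.
  move=> [x y] [/= [n /= Nn <-] [m /= Nm <-]]; rewrite /ball/=.
  have := le_trans (hm (u n) (u N)) (NP n Nn); have := le_trans (hm (u m) (u N)) (NP m Nm).
  rewrite -[h (u n) - h (u m)](subrKA (h (u N))) => h1 h2.
  apply: (le_lt_trans (ler_normD _ _)); rewrite [`|h (u N) - _|]distrC; lra.
exists ((lim ((fun n => complex.Re (u n)) @ \oo) +i* lim ((fun n => complex.Im (u n)) @ \oo))%C).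
apply/cvg_modulusP/cvg_ReImP; split.
  by apply: H => z w; rewrite -Re_opp -Re_add le_Re_modulus.
by apply: H => z w; rewrite -Im_opp -Im_add le_Im_modulus.
Qed.

Lemma ccvg_modulus_shift_le u l (M : R) N : ccvg u l -> (forall n, (N <= n)%N -> modulus (u n) <= M) ->
  modulus l <= M.
Proof. by move=> ul uM; apply: (ccvg_modulus_le ul); exists N. Qed.

Lemma ccvgB u v (l m : R[i]) : ccvg u l -> ccvg v m -> ccvg (fun n => u n - v n) (l - m).
Proof. by move=> ul vm; apply: ccvgD ul (ccvgN vm). Qed.

Lemma ccvg_cst (l : R[i]) : ccvg (fun=> l) l.
Proof. by move=> e e0; apply: nearW => n; rewrite subrr modulus0. Qed.

Lemma sum_natS_expr_bounded (q : R) : 0 <= q < 1 -> exists C, 0 <= C /\ forall N, \sum_(i < N) i.+1%:R * q ^+ i <= C.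
Proof.
move=> q01; have h1 : disc_coefs (fun=> 1 : R[i]).
  move=> r /andP[r0 r1]; exists 1 => n; rewrite modulus1 mul1r exprn_ile1// ltW//.
have [K KP] := disc_coefs_sum (disc_coefs_dcoef h1) q01.
exists K; split; first by have := KP 0%N; rewrite big_ord0.
move=> N; apply: le_trans (KP N); rewrite le_eqVlt; apply/orP; left; apply/eqP.
by apply: eq_bigr => i _; rewrite /dcoef mulr1 modulus_nat.
Qed.

Lemma psval0 a : disc_coefs a -> psval a 0 = a 0%N.
Proof.
move=> ha; apply: (@ccvg_unique _ (psum a ^~ 0)); first by apply: psum_cvg; rewrite ?modulus0.
move=> e e0; exists 1%N => // -[//|n] _ /=.
rewrite /psum big_ord_recl/= expr0 mulr1 big1 ?addr0 ?subrr ?modulus0// => i _.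
by rewrite exprS mul0r mulr0.
Qed.

(** Differentiation is continuous for weighted sup-norms of the coefficients, on smaller discs. *)
Lemma psval_dcoef_lipschitz (z : R[i]) : modulus z < 1 -> exists C, 0 < C /\
  forall a b (e : R), disc_coefs a -> disc_coefs b ->
  (forall rho, 0 < rho < 1 -> forall m, modulus (a m - b m) * rho ^+ m <= e) ->
  modulus (psval (dcoef a) z - psval (dcoef b) z) <= C * e.
Proof.
move=> z1; pose rho := (modulus z + 1) / 2.
have z0 := modulus_ge0 z; have rho01 : 0 < rho < 1 by apply/andP; rewrite /rho; split; lra.
have [rho0 rho1] := andP rho01; pose q := modulus z / rho.
have q01 : 0 <= q < 1.
  by rewrite /q divr_ge0 ?(ltW rho0)//= ltr_pdivrMr// mul1r /rho; lra.
have [C [C0 CP]] := sum_natS_expr_bounded q01.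
have Cr : 0 <= C / rho by rewrite divr_ge0// ltW.
exists (C / rho + 1); split; first by lra.
move=> a b e ha hb ab; have e0 : 0 <= e.
  by apply: le_trans (ab _ rho01 0%N); rewrite mulr_ge0 ?modulus_ge0.
apply: (@le_trans _ _ (C / rho * e)); last by rewrite ler_wpM2r// lerDl.
apply: ccvg_modulus_le.
  exact: ccvgB (psum_cvg (disc_coefs_dcoef ha) z1) (psum_cvg (disc_coefs_dcoef hb) z1).
apply: nearW => N; rewrite /psum -sumrB; apply: (le_trans (le_modulus_sum _ _)).
apply: (@le_trans _ _ (\sum_(i < N) (i.+1%:R * q ^+ i) * (e / rho))); last first.
  by rewrite -mulr_suml mulrAC -mulrA ler_wpM2r ?CP// divr_ge0// ltW.
apply: ler_sum => i _; rewrite -mulrBl /dcoef -mulrBr !modulusM modulus_nat modulusX.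
rewrite -!mulrA ler_wpM2l// /q expr_div_n.
have y0 : 0 < rho ^+ i by rewrite exprn_gt0.
have x0 : 0 <= modulus z ^+ i by rewrite exprn_ge0.
have := ab _ rho01 i.+1; rewrite exprS.
move: (modulus (_ - _)) (modulus z ^+ i) (rho ^+ i) x0 y0 => d x y x0 y0.
move: rho rho0 {ab q q01 CP Cr rho1 rho01} => r rp; rewrite -ler_pdivlMr; last exact: mulr_gt0.
move=> h.
rewrite mulrC (le_trans (ler_wpM2l x0 h))// le_eqVlt; apply/orP; left; apply/eqP.
have r0 := gt_eqF rp; have yn0 := gt_eqF y0.
by field; rewrite r0 yn0.
Qed.

Lemma holomorphicB f g : holomorphic f -> holomorphic g -> holomorphic (f - g).
Proof.
move=> hf hg z z1; have := (complex_derivative_lin (-1) hg hf z1).2.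
by rewrite scaleN1r addrC.
Qed.

Lemma complex_derivativeB f g z : holomorphic f -> holomorphic g -> unit_disc R z ->
  complex_derivative (f - g) z = complex_derivative f z - complex_derivative g z.
Proof.
move=> hf hg z1; have := (complex_derivative_lin (-1) hg hf z1).1.
by rewrite scaleN1r addrC mulN1r addrC => ->; rewrite addrC.
Qed.

Lemma coefB f g m : holomorphic f -> holomorphic g -> coef (fun z => f z - g z) m = coef f m - coef g m.
Proof.
move=> hf hg; rewrite /coef -mulrBr; congr (_ * _).
have r1 : `|1 / 2| < 1 :> R by rewrite ger0_norm//; lra.
have cS (h : R[i] -> R[i]) : holomorphic h -> ccont_on (- pi) (- pi + 2 * pi) (fun t => h (polar (1 / 2) t)).
  by move=> hh t _; exact: holomorphic_ccont.
have cw (h : R[i] -> R[i]) : holomorphic h ->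
    ccont_on (- pi) (- pi + 2 * pi) (fun t => h (polar (1 / 2) t) * conjc (wave m%:Z t)).
  by move=> hh t tI; apply: ccontM (cS h hh t tI) _; apply: ccontJ; exact: ccont_wave.
rewrite /fourier /fourier_form -mulrBr -(cintB (cw f hf) (cw g hg)); congr (_ * _).
by apply: eq_cint => t _; rewrite mulrBl.
Qed.

End CoefficientLimits.

(** * Completeness of the Dirichlet space *)

Section RieszFischer.
Context {R : realType}.
Implicit Types (f g h p : R[i] -> R[i]).
Local Notation D' := complex_derivative.
Local Notation lam := (@planar_lebesgue R).
Local Notation S := (@dirichlet_space R).
Local Notation B := (@dirichlet_inner R).

Definition dirichlet_sqr f : R := complex.Re (B f f).

Lemma dirichlet_sqr_gradient f : S f ->
  gradient_integral f = (pi * (dirichlet_sqr f - modulus (f 0) ^+ 2))%:E.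
Proof.
move=> Sf; have := dirichlet_sqnormE Sf; rewrite /dirichlet_sqnorm dirichlet_integralE -/(dirichlet_sqr f).
have : gradient_integral f \is a fin_num.
  by rewrite ge0_fin_numE ?gradient_integral_ge0// -dirichlet_integral_lty Sf.2.
case: (gradient_integral f) => [r| |]// _; rewrite -EFinM -EFinD => -[<-].
by congr EFin; rewrite addrAC subrr add0r mulrA divff ?mul1r// gt_eqF// pi_gt0.
Qed.

Lemma modulus0_le_dirichlet f : S f -> modulus (f 0) ^+ 2 <= dirichlet_sqr f.
Proof.
move=> Sf; have := gradient_integral_ge0 f; rewrite dirichlet_sqr_gradient// lee_fin.
by rewrite pmulr_rge0 ?pi_gt0// subr_ge0.
Qed.

Lemma coef_le_dirichlet f rho m : S f -> 0 < rho < 1 ->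
  (modulus (coef f m) * rho ^+ m) ^+ 2 <= dirichlet_sqr f.
Proof.
move=> Sf r01; have [r0 r1] := andP r01; case: m => [|m].
  by rewrite expr0 mulr1 coef_at0 ?modulus0_le_dirichlet//; case: Sf.
have := gradient_integral_coef m Sf.1 r01; rewrite dirichlet_sqr_gradient// lee_fin.
rewrite -!(mulrA pi) ler_pM2l ?pi_gt0// -mulrA => h; rewrite exprMn -exprM muln2 doubleS.
apply: (@le_trans _ _ (dirichlet_sqr f - modulus (f 0) ^+ 2)); last by rewrite gerBl sqr_ge0.
apply: le_trans h; apply: ler_peMl; last by rewrite ler1n.
by rewrite mulr_ge0 ?sqr_ge0 ?exprn_ge0// ltW.
Qed.

(** Fatou's lemma for the squares of the derivatives. *)
Lemma gradient_limit (u : nat -> R[i] -> R[i]) f (K : R) : holomorphic f -> (forall n, holomorphic (u n)) ->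
  (forall z, unit_disc R z -> ccvg (fun n => D' (u n) z) (D' f z)) ->
  (forall n, (gradient_integral (u n) <= K%:E)%E) -> (gradient_integral f <= K%:E)%E.
Proof.
move=> hf hu uf uK.
pose v n (p : plane R) := (modulus (D' (u n) (to_complex p)) ^+ 2)%:E.
have E : gradient_integral f = (\int[lam]_(p in disc) limn_einf (v ^~ p))%E.
  apply: eq_integral => p /set_mem pD; apply/esym.
  suff /cvg_limn_einf_sup[] : (v ^~ p) n @[n --> \oo] --> (modulus (D' f (to_complex p)) ^+ 2)%:E by [].
  apply: cvg_EFin; first exact: nearW.
  have c : modulus (D' (u n) (to_complex p)) @[n --> \oo] --> modulus (D' f (to_complex p)).
    apply: (@cvg_comp _ _ _ (fun n => D' (u n) (to_complex p) : R[i]^o) (modulus : R[i]^o -> R)).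
      by apply/(@cvg_modulusP _ _ \oo); exact: uf.
    exact: continuous_modulus.
  exact: (cvgM c c).
rewrite E; apply: (le_trans (fatou _ _ _ _)).
- exact: measurable_disc.
- by move=> n; exact: (measurable_derivative_sqr (hu n)).
- by move=> n p _; rewrite lee_fin sqr_ge0.
- rewrite limn_einf_lim; apply: lime_le; first exact: is_cvg_einfs.
  by apply: nearW => n; apply: (le_trans (@ereal_inf_lbound _ _ _ _)); [exists n => //=|exact: uK].
Qed.

Variable e : nat -> R[i] -> R[i].
Hypothesis onb : dirichlet_onb e.
Variable p : R[i] -> R[i].
Hypothesis Sp : S p.

Let Se n : S (e n). Proof. have [h _ _] := onb; exact: h. Qed.
Let e_orth i j : B (e i) (e j) = (i == j)%:R. Proof. have [_ h _] := onb; exact: h. Qed.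
Let c n := B p (e n).
Let s N := \sum_(i <- iota 0 N) c i *: e i.

Let S_lin := @dirichlet_space_lin R.
Let S0 := @dirichlet_space0 R.
Let B_lin := @dirichlet_inner_lin R.
Let B_herm := @dirichlet_inner_herm R.
Let B_pos := @dirichlet_inner_pos R.

Let Ss N : S (s N). Proof. exact: (hermitian_set_sum S_lin S0 Se). Qed.

Let S_sub f g : S f -> S g -> S (f - g).
Proof. by move=> Sf Sg; rewrite addrC -scaleN1r; exact: S_lin. Qed.

Let sub_lin f g h : S f -> S g -> S h -> B (f - g) h = B f h - B g h.
Proof. by move=> Sf Sg Sh; rewrite addrC -scaleN1r B_lin// mulN1r addrC. Qed.

Let sqr_sub N M : dirichlet_sqr (s (N + M) - s N) = \sum_(i <- iota N M) modulus (c i) ^+ 2.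
Proof.
rewrite /s iotaD add0n big_cat/= addrAC subrr add0r /dirichlet_sqr.
by rewrite (hermitian_pythagoras S_lin S0 B_lin B_herm Se e_orth)// iota_uniq.
Qed.

Let sum_le N : \sum_(i <- iota 0 N) modulus (c i) ^+ 2 <= dirichlet_sqr p.
Proof. by apply: (bessel S_lin S0 B_lin B_herm B_pos Se e_orth) => //; exact: iota_uniq. Qed.

(* The partial sums form a Cauchy sequence, by the inequality of Bessel. *)
Let tail (d : R) : 0 < d -> exists N0, forall N M, (N0 <= N)%N -> dirichlet_sqr (s (N + M) - s N) <= d ^+ 2.
Proof.
move=> d0; pose t N := \sum_(i <- iota 0 N) modulus (c i) ^+ 2.
have tN : nondecreasing_seq t.
  by apply/nondecreasing_seqP => n; rewrite /t -[n.+1]addn1 iotaD big_cat/= lerDl sumr_ge0// => i _; rewrite sqr_ge0.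
have tc : cvgn t by apply: nondecreasing_is_cvgn => //; exists (dirichlet_sqr p) => _ [n _ <-]; exact: sum_le.
have d20 : 0 < d ^+ 2 by rewrite exprn_gt0.
have [N0 _ N0P] := (cvgrPdist_le _ _).1 tc _ d20.
exists N0 => N M NN; rewrite sqr_sub.
have -> : \sum_(i <- iota N M) modulus (c i) ^+ 2 = t (N + M)%N - t N.
  by rewrite /t iotaD add0n big_cat/= addrAC subrr add0r.
have := N0P N NN; have := nondecreasing_cvgn_le tN tc (N + M); have := nondecreasing_cvgn_le tN tc N.
by rewrite ler_norml => h1 h2 /andP[h3 h4]; lra.
Qed.

Let coef_sub f g m : S f -> S g -> coef (f - g) m = coef f m - coef g m.
Proof. by move=> Sf Sg; apply: coefB; [case: Sf|case: Sg]. Qed.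

(* Weighted by [rho ^ m], the Taylor coefficients inherit this, uniformly in [m]. *)
Let coef_tail (d : R) : 0 < d -> exists N0, forall N M rho m, (N0 <= N)%N -> 0 < rho < 1 ->
  modulus (coef (s (N + M)) m - coef (s N) m) * rho ^+ m <= d.
Proof.
move=> d0; have [N0 NP] := tail d0; exists N0 => N M rho m NN r01.
have [r0 _] := andP r01.
have := coef_le_dirichlet m (S_sub (Ss (N + M)) (Ss N)) r01.
rewrite (coef_sub m (Ss (N + M)) (Ss N)) => h.
have := le_trans h (NP _ _ NN); rewrite ler_pXn2r// ?nnegrE ?(ltW d0)//.
by rewrite mulr_ge0 ?modulus_ge0 ?exprn_ge0// ltW.
Qed.

Let limit_coefs : exists b, forall m, ccvg (fun N => coef (s N) m) (b m).
Proof.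
suff H m : exists l, ccvg (fun N => coef (s N) m) l by have [b] := choice H; exists b.
apply: cauchy_ccvg => d d0; pose r : R := 1 / 2.
have r01 : 0 < r < 1 by rewrite /r; apply/andP; split; lra.
have [r0 r1] := andP r01.
have [N0 NP] := @coef_tail (d * r ^+ m) (mulr_gt0 d0 (exprn_gt0 m r0)).
exists N0 => n Nn; have := NP N0 (n - N0)%N r m (leqnn _) r01.
by rewrite subnKC// ler_pM2r// exprn_gt0.
Qed.

Lemma ccvg_const_le (u : nat -> R[i]) l x (M rho : R) N : ccvg u l -> 0 < rho ->
  (forall n, (N <= n)%N -> modulus (u n - x) * rho <= M) -> modulus (l - x) * rho <= M.
Proof.
move=> ul r0 uM; rewrite -ler_pdivlMr//.
apply: (ccvg_modulus_shift_le (N := N) (ccvgB ul (ccvg_cst x))) => n Nn.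
by rewrite ler_pdivlMr// uM.
Qed.

(** Completeness of the space.  The Taylor coefficients of the partial sums
    converge, to the coefficients of a function [g]; by Fatou's lemma [g] lies in
    the space and the partial sums converge to it in norm.  Hence [g] and [p]
    have the same inner products with the basis and coincide on the disc. *)
Lemma onb_derivative_cvg z : unit_disc R z ->
  ccvg (fun N => D' (s N) z) (D' p z).
Proof.
have [b bP] := limit_coefs.
have hs N : holomorphic (s N) by case: (Ss N).
have cs N := holomorphic_disc_coefs (hs N).
have hb : disc_coefs b.
  move=> r r01; have [N0 NP] := coef_tail ltr01; have [M MP] := cs N0 r r01; have [r0 _] := andP r01.
  exists (1 + M) => m.
  have h : modulus (b m - coef (s N0) m) * r ^+ m <= 1.
    apply: (ccvg_const_le (N := N0) (bP m) (exprn_gt0 m r0)) => n Nn.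
    by have := NP N0 (n - N0)%N r m (leqnn _) r01; rewrite subnKC.
  rewrite -[b m](subrK (coef (s N0) m)).
  apply: (@le_trans _ _ ((modulus (b m - coef (s N0) m) + modulus (coef (s N0) m)) * r ^+ m)).
    by rewrite ler_wpM2r ?le_modulusD// exprn_ge0// ltW.
  by rewrite mulrDl lerD.
pose g := psval b; have hg : holomorphic g by exact: holomorphic_psval.
have D'g w : unit_disc R w -> D' g w = psval (dcoef b) w.
  by move=> w1; have [_] := is_derive_psval hb w1.
have s_g w : unit_disc R w -> ccvg (fun N => D' (s N) w) (D' g w).
  move=> w1; have [C [C0 CP]] := psval_dcoef_lipschitz w1.
  move=> d d0; have d20 : 0 < d / 2 / C by rewrite !divr_gt0.
  have [N0 NP] := coef_tail d20; exists N0 => // N /= NN.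
  rewrite (D'g w w1) (complex_derivativeE (hs N) w1); apply: (@le_lt_trans _ _ (C * (d / 2 / C))); last first.
    by rewrite mulrC divfK ?gt_eqF// ltr_pdivrMr// mulr_natr mulr2n ltrDl.
  apply: CP => // rho r01 m; have [r0 _] := andP r01.
  apply: (ccvg_const_le (N := N) (bP m) (exprn_gt0 m r0)) => n Nn.
  by have := NP N (n - N)%N rho m NN r01; rewrite subnKC.
have s0_g : ccvg (fun N => s N 0) (g 0).
  move=> d d0; have [N0 _ NP] := bP 0%N _ d0; exists N0 => // N NN.
  rewrite /g (psval0 hb) -(coef_at0 (hs N)); exact: NP.
have gradient_tail (d : R) : 0 < d -> exists N0, forall N, (N0 <= N)%N ->
    (gradient_integral (g - s N)%R <= (pi * d ^+ 2)%:E)%E /\ modulus (g 0 - s N 0) <= d.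
  move=> d0; have [N0 NP] := tail d0; exists N0 => N NN; split.
    apply: (@gradient_limit (fun M => s (N + M) - s N)).
    - exact: holomorphicB hg (hs N).
    - by move=> M; exact: holomorphicB (hs (N + M)) (hs N).
    - move=> w w1; rewrite (complex_derivativeB hg (hs N) w1).
      have -> : (fun n => D' (s (N + n) - s N) w) = (fun n => D' (s (N + n)) w - D' (s N) w).
        by apply/funext => n; rewrite (complex_derivativeB (hs (N + n)) (hs N) w1).
      apply: ccvgB (ccvg_cst _) => d' d'0; have [K _ KP] := s_g w w1 d' d'0.
      exists K; first by [].
      move=> n Kn; exact: (KP _ (leq_trans Kn (leq_addl N n))).
    - move=> M; rewrite (dirichlet_sqr_gradient (S_sub (Ss (N + M)) (Ss N))).
      rewrite lee_fin (ler_pM2l (pi_gt0 R)).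
      by apply: (le_trans _ (NP N M NN)); rewrite gerBl sqr_ge0.
  apply: (ccvg_modulus_shift_le (N := N) (ccvgB s0_g (ccvg_cst (s N 0)))) => n Nn.
  have := le_trans (modulus0_le_dirichlet (S_sub (Ss (N + (n - N))) (Ss N))) (NP N (n - N)%N NN).
  rewrite (subnKC Nn) ler_pXn2r ?nnegrE ?modulus_ge0 ?(ltW d0)//; exact.
have Sg : S g.
  have [N0 NP] := gradient_tail _ ltr01; have [gN _] := NP N0 (leqnn _).
  have -> : g = 1 *: (g - s N0) + s N0 by rewrite scale1r subrK.
  apply: S_lin (Ss N0); split; last by rewrite dirichlet_integral_lty (le_lt_trans gN (ltry _)).
  exact: holomorphicB hg (hs N0).
have g_e n : B (g - p) (e n) = 0.
  rewrite (sub_lin Sg Sp (Se n)); apply/eqP; rewrite -modulus_eq0 eq_le modulus_ge0 andbT.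
  apply/ler_addgt0Pr => d d0; rewrite add0r.
  have d20 : 0 < d / 2 by rewrite divr_gt0.
  have [N0 NP] := gradient_tail _ d20.
  pose N := maxn N0 n.+1; have [gN g0] := NP N (leq_maxl _ _).
  have -> : B p (e n) = B (s N) (e n).
    rewrite (hermitian_coef S_lin S0 B_lin Se e_orth c (iota_uniq _ _)) //.
    by rewrite mem_iota/= add0n leq_maxr.
  rewrite -(sub_lin Sg (Ss N) (Se n)); have Sgs := S_sub Sg (Ss N).
  have := bessel S_lin S0 B_lin B_herm B_pos Se e_orth (r := [:: n]) isT Sgs.
  rewrite big_seq1 -/(dirichlet_sqr _) => h; rewrite -(@ler_pXn2r _ 2) ?nnegrE ?modulus_ge0 ?(ltW d0)//.
  apply: (le_trans h); move: gN; rewrite (dirichlet_sqr_gradient Sgs) lee_fin (ler_pM2l (pi_gt0 R)).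
  have : modulus ((g - s N) 0) ^+ 2 <= (d / 2) ^+ 2.
    by rewrite lerXn2r ?nnegrE ?modulus_ge0 ?(ltW d20).
  rewrite lerBlDr => h1 h2; apply: (le_trans h2); apply: (le_trans (lerD (lexx _) h1)).
  by rewrite -subr_ge0; have := sqr_ge0 d; nra.
have gp w : unit_disc R w -> g w = p w.
  move=> w1; have [_ _ /(_ _ (S_sub Sg Sp) g_e w w1)] := onb.
  by move/eqP; rewrite subr_eq0 => /eqP.
move=> z1; have <- : D' g z = D' p z.
  apply: (@near_eq_derive R[i] (R[i]^o) (R[i]^o)).
  by apply: filterS (near_disc z1) => w w1; rewrite gp.
exact: s_g.
Qed.

End RieszFischer.

(** * The reproducing kernel bound and the Hilbert-Schmidt condition *)

Section TestPolynomials.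
Context {R : realType}.
Variables (w : R[i]) (M : nat).
Implicit Types (f : R[i] -> R[i]).
Local Notation D' := complex_derivative.
Local Notation mu := (@lebesgue_measure R).
Local Notation lam := (@planar_lebesgue R).

(** The truncated kernel of the functional [f |-> f' w]. *)
Definition kernel_poly (z : R[i]) : R[i] := \sum_(k < M) conjc w ^+ k * z ^+ k.+1.
Definition kernel_poly' (z : R[i]) : R[i] := \sum_(k < M) (k.+1%:R * conjc w ^+ k) * z ^+ k.
(** Both the value of [kernel_poly'] at [w] and a bound for the squared norm of
    [kernel_poly]; it tends to [1 / (1 - |w|^2)^2] as [M] grows. *)
Definition kernel_sum : R := \sum_(k < M) k.+1%:R * (modulus w ^+ 2) ^+ k.

Lemma is_derive_kernel_poly (z : R[i]^o) : is_derive z 1 (kernel_poly : R[i]^o -> R[i]^o) (kernel_poly' z).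
Proof.
have E n : is_derive z 1 (fun z : R[i]^o => \sum_(k < n) conjc w ^+ k * z ^+ k.+1 : R[i]^o)
    (\sum_(k < n) (k.+1%:R * conjc w ^+ k) * z ^+ k).
  elim: n => [|n ih].
    under eq_fun do rewrite big_ord0; rewrite big_ord0; exact: is_derive_cst.
  under eq_fun do rewrite big_ord_recr/=; rewrite big_ord_recr/=.
  have d : is_derive z (1 : R[i]^o) (fun z : R[i]^o => z ^+ n.+1 : R[i]^o) (n.+1%:R * z ^+ n).
    by split; [exact: exprn_derivable|rewrite exp_derive /GRing.scale/= mulr1].
  have := is_deriveD ih (is_deriveZ (conjc w ^+ n) d).
  by rewrite /GRing.scale/= mulrCA mulrA.
exact: E.
Qed.

Lemma holomorphic_kernel_poly : holomorphic kernel_poly.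
Proof. by move=> z _; case: (is_derive_kernel_poly z). Qed.

Lemma derivative_kernel_poly z : D' kernel_poly z = kernel_poly' z.
Proof. by case: (is_derive_kernel_poly z). Qed.

Lemma kernel_poly'_continuous : continuous (kernel_poly' : R[i]^o -> R[i]^o).
Proof.
move=> z; suff E n : exists d : R[i]^o, is_derive z 1
    (fun z : R[i]^o => \sum_(k < n) (k.+1%:R * conjc w ^+ k) * z ^+ k : R[i]^o) d.
  by have [d dE] := E M; exact: is_derive_complex_continuous dE.
elim: n => [|n [d ih]].
  exists 0; rewrite (_ : (fun _ => _) = (fun=> 0)); first exact: is_derive_cst.
  by apply/funext => y; rewrite big_ord0.
eexists; rewrite (_ : (fun _ => _) = (fun y : R[i]^o => \sum_(k < n) (k.+1%:R * conjc w ^+ k) * y ^+ k +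
  (n.+1%:R * conjc w ^+ n) * y ^+ n)); last by apply/funext => y; rewrite big_ord_recr.
have d' : is_derive z (1 : R[i]^o) (fun z : R[i]^o => z ^+ n : R[i]^o) (n%:R * z ^+ n.-1).
  by split; [exact: exprn_derivable|rewrite exp_derive /GRing.scale/= mulr1].
exact: (is_deriveD ih (is_deriveZ (n.+1%:R * conjc w ^+ n) d')).
Qed.

Lemma kernel_poly'_w : kernel_poly' w = (kernel_sum)%:C%C.
Proof.
rewrite /kernel_sum rmorph_sum; apply: eq_bigr => k _.
rewrite -mulrA -exprMn [conjc w * w]mulrC mulCJ -(rmorphXn (real_complex R)) rmorphM.
by congr (_ * _); rewrite (rmorph_nat (real_complex R)).
Qed.

Lemma circle_kernel_poly' r : 0 <= r ->
  circle_integral (fun z => modulus (kernel_poly' z) ^+ 2) r =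
  \sum_(k < M) 2 * pi * (k.+1%:R * modulus w ^+ k) ^+ 2 * r ^+ k.*2.
Proof.
move=> r0; pose c (k : nat) : R[i] := k.+1%:R * conjc w ^+ k * (r ^+ k)%:C%C.
pose F := (\sum_(k <- iota 0 M) c k *: wave (R := R) k%:Z) : R -> R[i].
have FE t : F t = kernel_poly' (polar r t).
  rewrite /F /kernel_poly' -(big_mkord xpredT (fun k => (k.+1%:R * conjc w ^+ k) * polar r t ^+ k)).
  rewrite /index_iota subn0; elim: (iota 0 M) => [|k s ih]; first by rewrite !big_nil.
  rewrite !big_cons -ih -[LHS]/(c k * wave k t + (\sum_(j <- s) c j *: wave j%:Z) t); congr (_ + _).
  by rewrite /c wave_nat /polar exprMn -(rmorphXn (real_complex R)) !mulrA.
have orth (i j : nat) : fourier_form (- pi) (wave (R := R) i%:Z) (wave j%:Z) = (i == j)%:R.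
  exact: wave_orthonormal.
have Sw (i : nat) : ccont_on (- pi) (- pi + 2 * pi) (wave (R := R) i%:Z).
  by move=> t _; exact: ccont_wave.
have := hermitian_pythagoras (@fourier_S_lin R (- pi)) (@fourier_S0 R (- pi)) (@fourier_form_lin R (- pi))
  (@fourier_form_herm R (- pi)) Sw orth c (iota_uniq 0 M).
move=> /(congr1 (@complex.Re R)); rewrite fourier_form_sqr -/F.
rewrite -[complex.Re _%:C%C]/(\sum_(i <- iota 0 M) modulus (c i) ^+ 2) => E.
have -> : circle_integral (fun z => modulus (kernel_poly' z) ^+ 2) r =
    \int[mu]_(t in `[- pi, - pi + 2 * pi]) modulus (F t) ^+ 2.
  by apply: eq_Rintegral => t _; rewrite FE.
rewrite -[LHS](mulVKf (@pi20 R)) E mulr_sumr -(big_mkord xpredT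
  (fun k => 2 * pi * (k.+1%:R * modulus w ^+ k) ^+ 2 * r ^+ k.*2)) /index_iota subn0.
apply: eq_bigr => k _; rewrite /c !modulusM modulus_nat modulusX modulus_conj modulus_real.
by rewrite ger0_norm ?exprn_ge0// [(_ * r ^+ k) ^+ 2]exprMn -exprM muln2 mulrA.
Qed.

Lemma Rintegral_sum_pow (c : nat -> R) (n : nat -> nat) N :
  \int[mu]_(r in `[0, 1]) (\sum_(k < N) c k * r ^+ n k) = \sum_(k < N) c k / (n k).+1%:R.
Proof.
have cp k (x : R) : {for x, continuous (fun r : R => c k * r ^+ n k)}.
  by apply: cvgM; [exact: cvg_cst|exact: exprn_continuous].
have cs m : continuous (fun r : R => \sum_(k < m) c k * r ^+ n k).
  elim: m => [|m ih]; first by under eq_fun do rewrite big_ord0; move=> x; exact: cvg_cst.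
  by under eq_fun do rewrite big_ord_recr/=; move=> x; apply: cvgD; [exact: ih|exact: cp].
elim: N => [|N ih].
  by rewrite big_ord0; under eq_Rintegral do rewrite big_ord0; rewrite Rintegral_cst// mul0r.
under eq_Rintegral do rewrite big_ord_recr/=.
rewrite RintegralD//; first last.
- by apply: segment_integrable => x _; exact: cp.
- by apply: segment_integrable => x _; exact: cs.
by rewrite ih Rintegral_pow// expr1n mulr1 big_ord_recr.
Qed.

Lemma gradient_kernel_poly : (gradient_integral kernel_poly <= (pi * kernel_sum)%:E)%E.
Proof.
have cq (z : R[i]^o) : {for z, continuous (fun z : R[i]^o => modulus (kernel_poly' z) ^+ 2)}.
  have c : {for z, continuous (fun z : R[i]^o => modulus (kernel_poly' z))}.
    apply: (@continuous_comp _ _ _ (kernel_poly' : R[i]^o -> R[i]^o) (modulus : R[i]^o -> R)).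
      exact: kernel_poly'_continuous.
    exact: continuous_modulus.
  exact: (cvgM c c).
have mq A : measurable_fun A (fun p : plane R => modulus (kernel_poly' (to_complex p)) ^+ 2).
  apply: cmeasurable_sqr; apply: (@cmeasurable_psum _ _ (fun k => k.+1%:R * conjc w ^+ k)).
  exact: cmeasurable_to_complex.
apply: (@le_trans _ _ (\int[lam]_(p in plane_disc 1) (modulus (kernel_poly' (to_complex p)) ^+ 2)%:E)%E).
  rewrite /gradient_integral; under eq_integral do rewrite derivative_kernel_poly.
  apply: ge0_subset_integral.
  - exact: measurable_disc.
  - exact: measurable_plane_disc.
  - by apply/measurable_EFinP; exact: mq.
  - by move=> p _; rewrite lee_fin sqr_ge0.
  - by move=> p /ltW.
rewrite (@disc_integral _ (fun z => modulus (kernel_poly' z) ^+ 2) 1 2); first last.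
- by move=> z _; exact: cq.
- exact: mq.
- by move=> z _; rewrite sqr_ge0.
- by apply/andP; split; lra.
rewrite lee_fin; apply: (@le_trans _ _ (\int[mu]_(r in `[0, 1])
    (\sum_(k < M) (2 * pi * (k.+1%:R * modulus w ^+ k) ^+ 2) * r ^+ k.*2.+1))).
  rewrite le_eqVlt; apply/orP; left; apply/eqP; apply: eq_Rintegral => r; rewrite inE/= in_itv/=.
  move=> /andP[r0 _]; rewrite circle_kernel_poly'// mulr_sumr; apply: eq_bigr => k _.
  by rewrite mulrCA -exprS.
rewrite (@Rintegral_sum_pow (fun k => 2 * pi * (k.+1%:R * modulus w ^+ k) ^+ 2) (fun k => k.*2.+1)).
rewrite /kernel_sum mulr_sumr; apply: ler_sum => k _.
have -> : (modulus w ^+ 2) ^+ k = (modulus w ^+ k) ^+ 2 by rewrite -!exprM mulnC.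
rewrite -doubleS -muln2 natrM le_eqVlt; apply/orP; left; apply/eqP.
have : k.+1%:R != 0 :> R by rewrite pnatr_eq0.
move: (k.+1%:R) (_ ^+ k) (pi : R) => n x p n0; field; exact: n0.
Qed.

Lemma dirichlet_kernel_poly : dirichlet_space kernel_poly.
Proof.
split; first exact: holomorphic_kernel_poly.
by rewrite dirichlet_integral_lty (le_lt_trans gradient_kernel_poly)// ltry.
Qed.

Lemma dirichlet_sqr_kernel_poly : dirichlet_sqr kernel_poly <= kernel_sum.
Proof.
have := gradient_kernel_poly; rewrite (dirichlet_sqr_gradient dirichlet_kernel_poly) lee_fin.
rewrite (ler_pM2l (pi_gt0 R)) [kernel_poly 0]big1 ?modulus0 ?expr0n/= ?subr0// => k _.
by rewrite exprS mul0r mulr0.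
Qed.

End TestPolynomials.

Section Kernel.
Context {R : realType}.
Local Notation D' := complex_derivative.

Lemma kernel_sum_closed (w : R[i]) M : (1 - modulus w ^+ 2) ^+ 2 * kernel_sum w M =
  1 - M.+1%:R * (modulus w ^+ 2) ^+ M + M%:R * (modulus w ^+ 2) ^+ M.+1.
Proof.
rewrite /kernel_sum; move: (modulus w ^+ 2) => x.
elim: M => [|M ih]; first by rewrite big_ord0 mulr0 expr0 mulr1 mul0r addr0 subrr.
rewrite big_ord_recr/= mulrDr ih !exprS -!natr1; move: (x ^+ M) (M%:R) => y n; ring.
Qed.

(** The limit is not attained, but a fixed fraction of it is enough. *)
Lemma kernel_sum_large (w : R[i]) : modulus w < 1 ->
  exists M, (4 * (1 - modulus w ^+ 2) ^+ 2)^-1 <= kernel_sum w M.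
Proof.
move=> w1; have w0 := modulus_ge0 w; pose x := modulus w ^+ 2.
have x01 : 0 <= x < 1 by rewrite /x sqr_ge0/= expr_lt1.
have [x0 x1] := andP x01.
have [M MP] : exists M, x ^+ M <= 1 / 2.
  have := cvg_expr (_ : `|x| < 1); rewrite ger0_norm// => /(_ x1)/cvgrPdist_le/(_ (1 / 2)).
  case=> [|N _ NP]; first by lra.
  by exists N; have := NP N (leqnn N); rewrite sub0r normrN ger0_norm// exprn_ge0.
(* The closed form is nonnegative at [M], which bounds [M * x ^ M]; at [2 M] the
   terms to be subtracted carry one more factor [x ^ M], at most [1 / 2]. *)
exists M.*2; rewrite invfM ler_pdivrMr; last by rewrite exprn_gt0// subr_gt0.
rewrite mulrC kernel_sum_closed -/x; have := kernel_sum_closed w M; rewrite -/x.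
have : 0 <= (1 - x) ^+ 2 * kernel_sum w M.
  rewrite mulr_ge0 ?sqr_ge0// sumr_ge0// => k _; rewrite mulr_ge0// exprn_ge0// -/x.
move=> /[swap] ->; rewrite -addnn !exprS !exprD -(natr1 M) -(natr1 (M + M)) natrD.
have y0 : 0 <= x ^+ M by exact: exprn_ge0.
move: (x ^+ M) (M%:R : R) MP y0 => y n y2 y0 h.
have h2 := mulr_ge0 y0 h; have h3 : 0 <= (1 / 2 - y) * (3 / 2 - y) by rewrite mulr_ge0//; lra.
by nra.
Qed.

Lemma derivative_sum (e : nat -> R[i] -> R[i]) (c : nat -> R[i]) (r : seq nat) w :
  (forall n, holomorphic (e n)) -> unit_disc R w ->
  D' (\sum_(i <- r) c i *: e i) w = \sum_(i <- r) c i * D' (e i) w.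
Proof.
move=> he w1; have h0 : holomorphic (0 : R[i] -> R[i]) by case: (@dirichlet_space0 R).
have hl (a : R[i]) (f g : R[i] -> R[i]) : holomorphic f -> holomorphic g -> holomorphic (a *: f + g) by exact: holomorphic_lin.
elim: r => [|i r ih]; first by rewrite !big_nil; exact: complex_derivative_cst.
have hs := hermitian_set_sum hl h0 he r c.
by rewrite !big_cons (complex_derivative_lin (c i) (he i) hs w1).1 ih.
Qed.

(** For the kernel polynomial [p] at [w] both [p' w] and a bound of the squared
    norm are equal to [kernel_sum].  Expanding [p' w] in the basis and applying
    [x y <= (x^2 + y^2) / 2] leaves at least half of [kernel_sum] to the sum of
    the squares of the derivatives of the basis. *)
Lemma onb_kernel (e : nat -> R[i] -> R[i]) (w : R[i]) : dirichlet_onb e -> unit_disc R w ->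
  (((4 * (1 - modulus w ^+ 2) ^+ 2)^-1)%:E <= \sum_(0 <= n <oo) (modulus (D' (e n) w) ^+ 2)%:E)%E.
Proof.
move=> onb w1; have [M MP] := kernel_sum_large w1.
apply: (@le_trans _ _ (kernel_sum w M)%:E); first by rewrite lee_fin.
pose p := kernel_poly w M; have Sp : dirichlet_space p by exact: dirichlet_kernel_poly.
have [Se e_orth _] := onb.
set S := (\sum_(0 <= n <oo) _)%E.
have S0 : (0 <= S)%E by apply: nneseries_ge0 => n _ _; rewrite lee_fin sqr_ge0.
have SN N : (\sum_(0 <= n < N) (modulus (D' (e n) w) ^+ 2)%:E <= S)%E.
  by apply: nneseries_lim_ge => n _; rewrite lee_fin sqr_ge0.
clearbody S; case: S S0 SN => [S| |] S0 SN; [|by rewrite leey|by []].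
move: S0; rewrite lee_fin => S0; rewrite lee_fin.
have lim := onb_derivative_cvg onb Sp w1.
pose c n := dirichlet_inner p (e n).
have K0 : 0 <= kernel_sum w M by apply: le_trans MP; rewrite invr_ge0 mulr_ge0 ?sqr_ge0.
suff : kernel_sum w M <= 2^-1 * kernel_sum w M + 2^-1 * S by lra.
have {1}-> : kernel_sum w M = modulus (D' p w) :> R.
  by rewrite derivative_kernel_poly kernel_poly'_w modulus_real ger0_norm.
apply: (ccvg_modulus_le lim); apply: nearW => N.
rewrite derivative_sum//; last by move=> n; have [] := Se n.
apply: (le_trans (le_modulus_sum _ _)).
apply: (@le_trans _ _ (\sum_(i <- iota 0 N) (2^-1 * modulus (c i) ^+ 2 + 2^-1 * modulus (D' (e i) w) ^+ 2))).
  apply: ler_sum => i _; rewrite modulusM -/(c i); move: (modulus _) (modulus _) => x y.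
  by have := sqr_ge0 (x - y); nra.
rewrite big_split/= -!mulr_sumr lerD// ler_pM2l ?invr_gt0//.
  apply: le_trans (dirichlet_sqr_kernel_poly w M).
  exact: (bessel (@dirichlet_space_lin R) (@dirichlet_space0 R) (@dirichlet_inner_lin R)
    (@dirichlet_inner_herm R) (@dirichlet_inner_pos R) Se e_orth (iota_uniq 0 N) Sp).
by have := SN N; rewrite /index_iota subn0 sumEFin lee_fin.
Qed.

End Kernel.

Lemma measurable_fun_inv {R : realType} d (X : measurableType d) (A : set X) (u : X -> R) :
  measurable_fun A u -> (forall p, A p -> 0 <= u p) -> measurable_fun A (fun p => (u p)^-1).
Proof.
move=> mu_ u0; apply: (@eq_measurable_fun _ _ _ _ _ (fun p => u p `^ (- 1))).
  by move=> p /set_mem pA; rewrite powR_inv1// u0.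
exact: (measurableT_comp (@measurable_powR R (- 1)) mu_).
Qed.

Section HilbertSchmidt.
Context {R : realType}.
Local Notation D' := complex_derivative.
Local Notation lam := (@planar_lebesgue R).
Variable phi : R[i] -> R[i].
Hypothesis phi_holo : holomorphic phi.
Hypothesis phi_self : forall z, unit_disc R z -> unit_disc R (phi z).
Hypothesis phi_HS : hilbert_schmidt (composition_operator phi).

Lemma curve_derive_unique (g : R -> R[i]) t u v : curve_derive g t u -> curve_derive g t v -> u = v.
Proof.
rewrite /curve_derive => -[[_ ur] [_ ui]] [[_ vr] [_ vi]].
by apply: complex_eqP; rewrite -?ur -?ui ?vr ?vi.
Qed.

(** The chain rule is available along curves, which suffices: the derivative is
    tested along the horizontal line through [z]. *)
Lemma derivative_comp f z : holomorphic f -> holomorphic (f \o phi) -> unit_disc R z ->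
  D' (f \o phi) z = D' f (phi z) * D' phi z.
Proof.
move=> hf hfp z1; pose g (t : R) : R[i] := z + t%:C%C.
have g0 : g 0 = z by rewrite /g addr0.
have dg : curve_derive g 0 1.
  apply: curve_derive_eq; first exact: (curve_deriveD (curve_derive_cst z 0) (curve_derive_real (is_derive_id _ _))).
  by rewrite add0r.
have dp : is_derive (g 0 : R[i]^o) 1 (phi : R[i]^o -> R[i]^o) (D' phi z).
  by rewrite g0; exact: is_derive_holomorphic.
have df : is_derive (phi (g 0) : R[i]^o) 1 (f : R[i]^o -> R[i]^o) (D' f (phi z)).
  by rewrite g0; apply: is_derive_holomorphic; last exact: phi_self.
have dfp : is_derive (g 0 : R[i]^o) 1 (f \o phi : R[i]^o -> R[i]^o) (D' (f \o phi) z).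
  by rewrite g0; exact: is_derive_holomorphic.
have h1 := curve_derive_comp dfp dg.
have h2 := curve_derive_comp (g := phi \o g) df (curve_derive_comp dp dg).
rewrite -[LHS]mulr1 -[RHS]mulr1 -mulrA; exact: curve_derive_unique h1 h2.
Qed.

(** The energy of [phi] with respect to the hyperbolic metric of the disc; up to
    constants and the values at [0] it is the squared Hilbert-Schmidt norm of the
    composition operator. *)
Definition hyperbolic_integral : \bar R :=
  (\int[lam]_(p in disc)
     (modulus (D' phi (to_complex p)) ^+ 2 / (1 - modulus (phi (to_complex p)) ^+ 2) ^+ 2)%:E)%E.

(** [onb_kernel] at [phi z], multiplied by [|phi' z|^2], bounds the integrand by
    four times the sum of the squares of the derivatives of the [e n \o phi]. *)
Lemma hyperbolic_integral_lty : (hyperbolic_integral < +oo)%E.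
Proof.
have [[Sphi _ _] [e onb HS]] := phi_HS; have [Se _ _] := onb.
have hc n : holomorphic (e n \o phi) by case: (Sphi _ (Se n)).
have mf := cmeasurable_disc phi_holo.
have m1 : measurable_fun disc (fun p : plane R => (1 - modulus (phi (to_complex p)) ^+ 2) ^- 2).
  apply: measurable_fun_inv; last by move=> p _; rewrite sqr_ge0.
  apply: measurable_funX; apply: measurable_funB; first exact: measurable_cst.
  exact: cmeasurable_sqr mf.
have m2 : measurable_fun disc (fun p : plane R => modulus (D' phi (to_complex p)) ^+ 2).
  exact: cmeasurable_sqr (cmeasurable_disc (holomorphic_derivative phi_holo)).
have le : (hyperbolic_integral <= 4%:E * \int[lam]_(p in disc)
    \sum_(0 <= n <oo) (modulus (D' (e n \o phi) (to_complex p)) ^+ 2)%:E)%E.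
  rewrite -ge0_integralZl; first last.
  - by rewrite lee_fin.
  - by move=> p _; apply: nneseries_ge0 => n _ _; rewrite lee_fin sqr_ge0.
  - apply: ge0_emeasurable_sum => n; last by move=> _; exact: (measurable_derivative_sqr (hc n)).
    by move=> p _ _; rewrite lee_fin sqr_ge0.
  - exact: measurable_disc.
  apply: ge0_le_integral.
  - exact: measurable_disc.
  - by move=> p _; rewrite lee_fin mulr_ge0 ?invr_ge0 ?sqr_ge0.
  - by apply/measurable_EFinP; exact: measurable_funM.
  - apply: measurable_funeM; apply: ge0_emeasurable_sum => n; last by move=> _; exact: (measurable_derivative_sqr (hc n)).
    by move=> p _ _; rewrite lee_fin sqr_ge0.
  - move=> p pD; have pp : unit_disc R (phi (to_complex p)) by exact: phi_self.
    have -> : (\sum_(0 <= n <oo) (modulus (D' (e n \o phi) (to_complex p)) ^+ 2)%:E =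
        (modulus (D' phi (to_complex p)) ^+ 2)%:E *
        \sum_(0 <= n <oo) (modulus (D' (e n) (phi (to_complex p))) ^+ 2)%:E)%E.
      rewrite -nneseriesZl; last by move=> n _; rewrite lee_fin sqr_ge0.
      apply: eq_eseriesr => n _.
      by rewrite (derivative_comp (Se n).1 (hc n) pD) modulusM exprMn mulrC EFinM.
    have := onb_kernel onb pp; move: (\sum_(0 <= n <oo) _)%E => S.
    move: (modulus (phi _)) (modulus (D' _ _)) => x y h.
    apply: (@le_trans _ _ (4%:E * ((y ^+ 2)%:E * ((4 * (1 - x ^+ 2) ^+ 2)^-1)%:E))%E).
      rewrite -!EFinM lee_fin; move: ((1 - x ^+ 2) ^+ 2) => b'; rewrite invfM; move: (b'^-1) => b.
      by rewrite le_eqVlt; apply/orP; left; apply/eqP; field.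
    by rewrite lee_pmul2l// lee_wpmul2l// lee_fin sqr_ge0.
apply: (le_lt_trans le); apply: lte_mul_pinfty; [by rewrite lee_fin|by []|].
rewrite integral_nneseries; first last.
- by move=> n p _; rewrite lee_fin sqr_ge0.
- by move=> n; exact: (measurable_derivative_sqr (hc n)).
- exact: measurable_disc.
have : (\sum_(0 <= n <oo) (pi%:E * dirichlet_sqnorm (e n \o phi)) < +oo)%E.
  rewrite nneseriesZl; last by move=> n _; exact: dirichlet_sqnorm_ge0.
  by apply: lte_mul_pinfty; [rewrite lee_fin pi_ge0|by []|exact: HS].
apply: le_lt_trans; apply: lee_nneseries => n *; first exact: gradient_integral_ge0.
rewrite /dirichlet_sqnorm dirichlet_integralE ge0_muleDr; first last.
- by rewrite mule_ge0 ?gradient_integral_ge0// lee_fin invr_ge0 pi_ge0.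
- by rewrite lee_fin sqr_ge0.
have -> : (pi%:E * ((pi^-1)%:E * gradient_integral (e n \o phi)) = gradient_integral (e n \o phi))%E.
  by rewrite muleA -(EFinM pi pi^-1) divff ?mul1e// gt_eqF ?pi_gt0.
by rewrite leeDr// mule_ge0// lee_fin ?sqr_ge0 ?pi_ge0.
Qed.

End HilbertSchmidt.

(** * Fourier coefficients of a function on concentric circles *)

Section ParametricIntegrals.
Context {R : realType}.
Local Notation mu := (@lebesgue_measure R).
Variables (rho a b : R) (V : R -> R -> R) (h : R -> R).
Hypothesis h_cont : continuous h.
Hypothesis h_le1 : forall t, `|h t| <= 1.
Hypothesis V_cont : forall r, `|r| < rho -> continuous (V r).

Let integrable_Vh r : `|r| < rho -> mu.-integrable `[a, b] (EFin \o (fun t => V r t * h t)).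
Proof.
by move=> r1; apply: segment_integrable => t _; apply: cvgM; [exact: V_cont|exact: h_cont].
Qed.

Lemma parametric_continuous r : (forall r t, `|r| < rho -> {for r, continuous (V ^~ t)}) ->
  (forall rho1, rho1 < rho -> exists M, forall r t, `|r| <= rho1 -> `|V r t| <= M) ->
  `|r| < rho -> {for r, continuous (fun r => \int[mu]_(t in `[a, b]) (V r t * h t))}.
Proof.
move=> cV bV r1; pose s := (`|r| + rho) / 2.
have rs : `|r| < s by rewrite /s; lra.
have srho : s < rho by rewrite /s; lra.
have [M MP] := bV s srho.
apply: (@continuity_under_integral R _ _ mu (fun r t => V r t * h t) `[a, b]
  (measurable_itv _) (- s) s _ _ (cst M) (itv_cst_integrable _ _ _)).
- by move=> x /=; rewrite in_itv/= -ltr_norml => xs; apply: integrable_Vh; exact: lt_trans srho.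
- apply: aeW => t _ x /set_mem/=; rewrite in_itv/= -ltr_norml => xs.
  by apply: cvgM; [apply: cV; exact: lt_trans srho|exact: cvg_cst].
- move=> x /=; rewrite in_itv/= -ltr_norml => xs; apply: aeW => t _.
  rewrite normrM; apply: (le_trans (ler_piMr (normr_ge0 _) (h_le1 t))).
  by apply: MP; exact: ltW.
- by rewrite inE/= in_itv/= -ltr_norml.
Qed.

Lemma parametric_derive (V' : R -> R -> R) (r : R) :
  (forall r t : R, `|r| < rho -> is_derive r (1 : R) (V ^~ t) (V' r t)) ->
  (forall rho1, rho1 < rho -> exists M, forall r t, `|r| <= rho1 -> `|V' r t| <= M) ->
  `|r| < rho -> is_derive r (1 : R) (fun r => \int[mu]_(t in `[a, b]) (V r t * h t))
    (\int[mu]_(t in `[a, b]) (V' r t * h t)).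
Proof.
move=> dV bV r1; pose s := (`|r| + rho) / 2.
have rs : `|r| < s by rewrite /s; lra.
have srho : s < rho by rewrite /s; lra.
have [M MP] := bV s srho.
have M0 : 0 <= M by apply: le_trans (normr_ge0 _) (MP r 0 (ltW rs)).
have dVh (x t : R) : `|x| < s -> is_derive x (1 : R) (fun x => V x t * h t) (V' x t * h t).
  move=> xs; have d := is_deriveM (dV x t (lt_trans xs srho)) (is_derive_cst (h t) x 1).
  apply: (is_derive_eq d); rewrite scaler0 add0r /GRing.scale/= mulrC; by [].
have Ir : `]- s, s[%classic r by rewrite /= in_itv/= -ltr_norml.
have intf x : `]- s, s[%classic x -> mu.-integrable `[a, b] (EFin \o (fun t => V x t * h t)).
  by rewrite /= in_itv/= -ltr_norml => xs; apply: integrable_Vh; exact: lt_trans srho.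
have derf x t : `]- s, s[%classic x -> `[a, b]%classic t -> derivable (fun x => V x t * h t) x 1.
  by rewrite /= in_itv/= -ltr_norml => xs _; case: (dVh x t xs).
have ub x t : `]- s, s[%classic x -> `[a, b]%classic t ->
    `|partial1of2 (fun r t => V r t * h t) x t| <= cst M t.
  rewrite /= in_itv/= -ltr_norml => xs _; rewrite partial1of2E; have [_ ->] := dVh x t xs.
  rewrite normrM; apply: (le_trans (ler_piMr (normr_ge0 _) (h_le1 t))).
  by apply: MP; exact: ltW.
split.
  exact: (@derivable_under_integral R _ _ mu (fun r t => V r t * h t) `[a, b] (measurable_itv _)
    r (- s) s Ir intf derf (cst M) (fun=> M0) (itv_cst_integrable _ _ _) ub).
rewrite -derive1E (@differentiation_under_integral R _ _ mu (fun r t => V r t * h t) `[a, b] (measurable_itv _)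
    r (- s) s Ir intf derf (cst M) (fun=> M0) (itv_cst_integrable _ _ _) ub).
by apply: eq_Rintegral => t _; rewrite partial1of2E; case: (dVh r t rs).
Qed.

End ParametricIntegrals.

Section CircleFourier.
Context {R : realType}.
Local Notation mu := (@lebesgue_measure R).

Definition fourier_real (v : R -> R) (k : int) : R[i] := fourier (- pi) (fun t => (v t)%:C%C) k.

Lemma Re_fourier_real v k : complex.Re (fourier_real v k) =
  (2 * pi)^-1 * \int[mu]_(t in `[- pi, - pi + 2 * pi]) (v t * cos (k%:~R * t)).
Proof.
rewrite /fourier_real /fourier /fourier_form Re_mul/= mul0r subr0; congr (_ * _).
by apply: eq_Rintegral => t _; rewrite mul0r subr0.
Qed.

Lemma Im_fourier_real v k : complex.Im (fourier_real v k) =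
  (2 * pi)^-1 * \int[mu]_(t in `[- pi, - pi + 2 * pi]) (v t * - sin (k%:~R * t)).
Proof.
rewrite /fourier_real /fourier /fourier_form Im_mul/= mul0r addr0; congr (_ * _).
by apply: eq_Rintegral => t _; rewrite mul0r addr0.
Qed.

Lemma fourier_realN (v : R -> R) k : continuous v -> fourier_real v (- k) = conjc (fourier_real v k).
Proof.
move=> cv; rewrite /fourier_real /fourier /fourier_form conjcM conj_real -cintJ.
  congr (_ * _); apply: eq_cint => t _.
  by rewrite conjcM conj_real -conj_wave.
move=> t _; apply: ccontM; first by apply: ccont_real; exact: cv.
by apply: ccontJ; exact: ccont_wave.
Qed.

Lemma fourier_real_cst (c : R) (k : int) : k != 0 -> fourier_real (fun=> c) k = 0.
Proof.
move=> k0; have le_pi : - pi <= - pi + 2 * pi :> R by rewrite lerDl pi2_ge0.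
have z0 : fourier (- pi) (fun=> 0 : R[i]) k = 0.
  rewrite /fourier /fourier_form (@cint_FTC _ _ (fun=> 0)) ?subrr ?mulr0//.
    by move=> t _; rewrite mul0r; exact: curve_derive_cst.
  by move=> t _; under eq_fun do rewrite mul0r; exact: ccont_cst.
have := @fourier_derive R (- pi) (fun=> c%:C%C) (fun=> 0) k (fun t => curve_derive_cst _ t)
  (fun t => ccont_cst _ t) (fun=> erefl).
rewrite z0 => /esym/eqP; rewrite mulf_eq0 => /orP[|/eqP//].
by rewrite mulf_eq0 intr_eq0 (negbTE k0) orbF -modulus_eq0 modulusi oner_eq0.
Qed.

(** Opposite frequencies are conjugate to each other. *)
Lemma fourier_sum_real (v : R -> R) N x : continuous v -> fourier_sum (- pi) (fun t => (v t)%:C%C) N x =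
  (complex.Re (fourier_real v 0) +
   2 * \sum_(k < N) complex.Re (fourier_real v k.+1%:Z * wave k.+1%:Z x))%:C%C.
Proof.
move=> cv; elim: N => [|N ih].
  transitivity (fourier_real v 0 * wave 0 x); first by rewrite /fourier_sum big_ord_recl big_ord0 addr0.
  rewrite big_ord0 mulr0 addr0 wave0 mulr1; apply: complex_eqP; first by [].
  change (complex.Im (fourier_real v 0) = 0).
  have := congr1 (@complex.Im R) (fourier_realN 0 cv); rewrite oppr0 Im_conjc; lra.
have -> : fourier_sum (- pi) (fun t => (v t)%:C%C) N.+1 x =
    fourier_real v (- N.+1%:Z) * wave (- N.+1%:Z) x +
    fourier_sum (- pi) (fun t => (v t)%:C%C) N x + fourier_real v N.+1%:Z * wave N.+1%:Z x.
  rewrite /fourier_sum doubleS big_ord_recl/= sub0r -addrA; congr (_ + _).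
  rewrite big_ord_recr/=; congr (_ + _); last first.
    rewrite /bump leq0n add1n.
    have -> : N.*2.+2%:Z - N.+1%:Z = N.+1%:Z by lia.
    by [].
  apply: eq_bigr => i _; rewrite /bump leq0n add1n.
  by have -> : i.+1%:Z - N.+1%:Z = i%:Z - N%:Z by lia.
rewrite ih (fourier_realN _ cv) -conj_wave -conjcM.
have -> : \sum_(k < N.+1) complex.Re (fourier_real v k.+1%:Z * wave k.+1%:Z x) =
    \sum_(k < N) complex.Re (fourier_real v k.+1%:Z * wave k.+1%:Z x) +
    complex.Re (fourier_real v N.+1%:Z * wave N.+1%:Z x) by exact: big_ord_recr.
move: (fourier_real v N.+1%:Z * wave N.+1%:Z x) (complex.Re (fourier_real v 0)) (\sum_(k < N) _) => z a S.
by apply: complex_eqP; rewrite ?Re_add ?Im_add ?Re_conjc ?Im_conjc/=; lra.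
Qed.

End CircleFourier.

(** * The Dirichlet integral controls the weighted Fourier coefficients *)

Section CoefficientGrowth.
Context {R : realType}.
Local Notation mu := (@lebesgue_measure R).
Variables (W : R[i] -> R) (P : R[i] -> R[i]).
(** The differential of [W] at [z] is [v |-> Re (P z * v)]. *)
Hypothesis W_diff : forall g (t : R) v, unit_disc R (g t) -> curve_derive g t v ->
  is_derive t 1 (fun t => W (g t)) (complex.Re (P (g t) * v)).
Hypothesis P_cont : forall z : R[i]^o, unit_disc R z -> {for z, continuous (P : R[i]^o -> R[i]^o)}.

Definition dirichlet_radius (r : R) : R :=
  \int[mu]_(x in `[0, r]) (x * circle_integral (fun z => modulus (P z) ^+ 2) x).

Let A k r := fourier_real (fun t => W (polar r t)) k.
Let Wr r t := complex.Re (P (polar r t) * expi t).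
Let A' k r := fourier_real (Wr r) k.
Let m r := (2 * pi)^-1 * circle_integral (fun z => modulus (P z) ^+ 2) r.

Let W_ray (r t : R) : `|r| < 1 -> is_derive r (1 : R) (fun r => W (polar r t)) (Wr r t).
Proof. by move=> r1; apply: W_diff (curve_derive_ray r t); exact: polar_disc. Qed.

Let W_arc (r t : R) : `|r| < 1 ->
  is_derive t (1 : R) (fun t => W (polar r t)) (complex.Re (P (polar r t) * ('i%C * polar r t))).
Proof. by move=> r1; apply: (W_diff (g := polar r)) (curve_derive_arc r t); exact: polar_disc. Qed.

Let is_derive_continuous (f : R -> R) (x d : R) : is_derive x 1 f d -> {for x, continuous f}.
Proof. by move=> [fx _]; apply: differentiable_continuous; apply/derivable1_diffP. Qed.

Let W_circle (r : R) : `|r| < 1 -> continuous (fun t => W (polar r t)).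
Proof. by move=> r1 t; exact: is_derive_continuous (W_arc t r1). Qed.

Let ccont_P (g : R -> R[i]) (t : R) : unit_disc R (g t) -> ccont g t -> ccont (fun t => P (g t)) t.
Proof. by move=> g1 [cg]; split; apply: (continuous_comp cg); exact: P_cont. Qed.

Let Wr_circle (r : R) : `|r| < 1 -> continuous (Wr r).
Proof.
move=> r1 t; apply: ccont_Re; apply: ccontM.
  by apply: ccont_P; [exact: polar_disc|exact: curve_derive_ccont (curve_derive_arc r t)].
by exact: curve_derive_ccont (curve_derive_expi t).
Qed.

Let Wr_ray (r t : R) : `|r| < 1 -> {for r, continuous (Wr ^~ t)}.
Proof.
move=> r1; apply: ccont_Re; apply: ccontM; last exact: ccont_cst.
by apply: ccont_P; [exact: polar_disc|exact: curve_derive_ccont (curve_derive_ray r t)].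
Qed.

Let P_sqr_cont (z : R[i]^o) : unit_disc R z -> {for z, continuous (fun z : R[i]^o => modulus (P z) ^+ 2)}.
Proof.
move=> z1; have c : {for z, continuous (fun z : R[i]^o => modulus (P z))}.
  apply: (@continuous_comp _ _ _ (P : R[i]^o -> R[i]^o) (modulus : R[i]^o -> R)).
    exact: P_cont.
  exact: continuous_modulus.
exact: (cvgM c c).
Qed.

Let Wr_le r t : `|Wr r t| <= modulus (P (polar r t)).
Proof. by apply: (le_trans (le_Re_modulus _)); rewrite modulusM modulus_expi mulr1. Qed.

Let Wr_bounded (rho : R) : rho < 1 -> exists M, forall r t : R, `|r| <= rho -> `|Wr r t| <= M.
Proof.
move=> rho1; have [M MP] : exists M, forall z, modulus z <= rho -> `|modulus (P z) ^+ 2| <= M.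
  by apply: disc_bounded => z zr; apply: P_sqr_cont; exact: le_lt_trans rho1.
exists (1 + M) => r t rr; apply: (le_trans (Wr_le r t)).
have := MP (polar r t); rewrite modulus_polarE => /(_ rr).
rewrite ger0_norm ?sqr_ge0//; move: (modulus _) => x h.
by have := sqr_ge0 (x - 1); have := sqr_ge0 x; nra.
Qed.

Let A_derive k (r : R) : `|r| < 1 -> curve_derive (A k) r (A' k r).
Proof.
move=> r1; have p2 := (2 * pi : R)^-1.
have cosk : continuous (fun t : R => cos (k%:~R * t)).
  by move=> t; have := ccont_Re (ccont_wave k t).
have sink : continuous (fun t : R => - sin (k%:~R * t)).
  by move=> t; have := ccont_Im (ccontJ (ccont_wave k t)).
have cos1 (t : R) : `|cos (k%:~R * t)| <= 1 by rewrite ler_norml cos_geN1 cos_le1.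
have sin1 (t : R) : `|- sin (k%:~R * t)| <= 1 by rewrite normrN ler_norml sin_geN1 sin_le1.
split.
  rewrite Re_fourier_real; under eq_fun do rewrite Re_fourier_real.
  apply: is_deriveZ.
  exact: (parametric_derive (- pi) (- pi + 2 * pi) cosk cos1 W_circle (V' := Wr) W_ray Wr_bounded r1).
rewrite Im_fourier_real; under eq_fun do rewrite Im_fourier_real.
apply: is_deriveZ.
exact: (parametric_derive (- pi) (- pi + 2 * pi) sink sin1 W_circle (V' := Wr) W_ray Wr_bounded r1).
Qed.

Let A'_ccont k (r : R) : `|r| < 1 -> ccont (A' k) r.
Proof.
move=> r1; split; apply/cvg_ReImP.
have cosk : continuous (fun t : R => cos (k%:~R * t)).
  by move=> t; have := ccont_Re (ccont_wave k t).
have sink : continuous (fun t : R => - sin (k%:~R * t)).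
  by move=> t; have := ccont_Im (ccontJ (ccont_wave k t)).
have cos1 (t : R) : `|cos (k%:~R * t)| <= 1 by rewrite ler_norml cos_geN1 cos_le1.
have sin1 (t : R) : `|- sin (k%:~R * t)| <= 1 by rewrite normrN ler_norml sin_geN1 sin_le1.
have cR := parametric_continuous (a := - pi) (b := - pi + 2 * pi) cosk cos1 Wr_circle Wr_ray Wr_bounded r1.
have cI := parametric_continuous (a := - pi) (b := - pi + 2 * pi) sink sin1 Wr_circle Wr_ray Wr_bounded r1.
split.
  rewrite Re_fourier_real; under eq_fun do rewrite Re_fourier_real.
  by apply: cvgM; [exact: cvg_cst|exact: cR].
rewrite Im_fourier_real; under eq_fun do rewrite Im_fourier_real.
by apply: cvgM; [exact: cvg_cst|exact: cI].
Qed.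

Let m_ge0 r : 0 <= m r.
Proof.
rewrite /m mulr_ge0 ?invr_ge0 ?pi2_ge0//.
by apply: Rintegral_ge0 => t _; exact: sqr_ge0.
Qed.

Let circle_bessel (ks : seq int) (r c : R) (v : R -> R) : `|r| < 1 -> uniq ks -> continuous v ->
  0 <= c -> (forall t, `|v t| <= c * modulus (P (polar r t))) ->
  \sum_(k <- ks) modulus (fourier_real v k) ^+ 2 <= c ^+ 2 * m r.
Proof.
move=> r1 uks cv c0 vle.
have cvC : ccont_on (- pi) (- pi + 2 * pi) (fun t => (v t)%:C%C).
  by move=> t _; apply: ccont_real; exact: cv.
apply: (le_trans (fourier_bessel uks cvC)).
rewrite /m mulrCA ler_pM2l ?invr_gt0 ?mulr_gt0 ?pi_gt0//.
have cP t : {for t, continuous (fun t => modulus (P (polar r t)) ^+ 2)}.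
  apply: (circle_continuous (G := fun z => modulus (P z) ^+ 2) (rho := 1)) => //.
have iP : mu.-integrable `[- pi, - pi + 2 * pi] (EFin \o (fun t => modulus (P (polar r t)) ^+ 2)).
  by apply: segment_integrable => t _; exact: cP.
rewrite /circle_integral -RintegralZl//; apply: le_Rintegral.
- exact: measurable_itv.
- apply: segment_integrable => t _; have cm := ccont_modulus (ccont_real (cv t)).
  exact: (cvgM cm cm).
- by apply: segment_integrable => t _; apply: cvgM; [exact: cvg_cst|exact: cP].
- move=> t _; rewrite modulus_real -exprMn lerXn2r ?nnegrE//.
  by rewrite mulr_ge0 ?modulus_ge0.
Qed.

Let A'_bessel ks (r : R) : `|r| < 1 -> uniq ks ->
  \sum_(k <- ks) modulus (A' k r) ^+ 2 <= m r.
Proof.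
move=> r1 uks; have := @circle_bessel ks r 1 (Wr r) r1 uks (Wr_circle r1) ler01 _.
by rewrite expr1n mul1r; apply => t; rewrite mul1r.
Qed.

Let A_bessel ks (r : R) : `|r| < 1 -> uniq ks ->
  \sum_(k <- ks) k%:~R ^+ 2 * modulus (A k r) ^+ 2 <= r ^+ 2 * m r.
Proof.
move=> r1 uks; pose v t := complex.Re (P (polar r t) * ('i%C * polar r t)).
have cv : continuous v.
  move=> t; have cp := curve_derive_ccont (curve_derive_arc r t).
  apply: ccont_Re; apply: ccontM; first by apply: ccont_P => //; exact: polar_disc.
  by apply: ccontM; [exact: ccont_cst|exact: cp].
have E k : k%:~R ^+ 2 * modulus (A k r) ^+ 2 = modulus (fourier_real v k) ^+ 2.
  rewrite /fourier_real (@fourier_derive _ _ (fun t => (W (polar r t))%:C%C) (fun t => (v t)%:C%C)).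
  - rewrite (modulusM ('i%C * k%:~R)) (modulusM 'i%C) modulusi mul1r exprMn; congr (_ * _).
    by rewrite -(rmorph_int (real_complex R)) modulus_real real_normK ?num_real.
  - by move=> t; apply: curve_derive_real; exact: W_arc.
  - by move=> t; apply: ccont_real; exact: cv.
  - by move=> t; rewrite polar_period.
under eq_bigr do rewrite E.
rewrite -[r ^+ 2]real_normK ?num_real//; apply: circle_bessel => // t.
apply: (le_trans (le_Re_modulus _)).
by rewrite (modulusM (P _)) (modulusM 'i%C) modulusi mul1r modulus_polarE mulrC.
Qed.

Let density_cont (r : R) : 0 <= r < 1 ->
  {for r, continuous (fun x : R => x * circle_integral (fun z => modulus (P z) ^+ 2) x)}.
Proof.
move=> /andP[r0 r1]; apply: cvgM; first exact: cvg_id.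
by apply: (@circle_integral_continuous _ _ 1) => //; rewrite ger0_norm.
Qed.

Let densityE r : 2 * (r * m r) = pi^-1 * (r * circle_integral (fun z => modulus (P z) ^+ 2) r).
Proof.
rewrite /m; have p0 : pi != 0 :> R by rewrite gt_eqF// pi_gt0.
by move: (circle_integral _ _) (pi : R) p0 => c p p0; field.
Qed.

Let mean_cont (r : R) : 0 <= r < 1 -> {for r, continuous (fun r : R => 2 * (r * m r))}.
Proof.
move=> r01; have -> : (fun r : R => 2 * (r * m r)) =
    (fun r => pi^-1 * (r * circle_integral (fun z => modulus (P z) ^+ 2) r)).
  by apply/funext => x; exact: densityE.
by apply: cvgM; [exact: cvg_cst|exact: density_cont].
Qed.

Let density_integrable (a b : R) : 0 <= a -> b < 1 ->
  mu.-integrable `[a, b] (EFin \o (fun r => 2 * (r * m r))).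
Proof.
move=> a0 b1; apply: segment_integrable => r /andP[ar rb].
by apply: mean_cont; rewrite (le_trans a0 ar) (le_lt_trans rb b1).
Qed.

Let density_total (b : R) : b < 1 -> \int[mu]_(r in `[0, b]) (2 * (r * m r)) = pi^-1 * dirichlet_radius b.
Proof.
move=> b1; under eq_Rintegral do rewrite densityE.
rewrite RintegralZl//; apply: segment_integrable => r /andP[r0 rb].
by apply: density_cont; rewrite r0 (le_lt_trans rb b1).
Qed.

Let A0 k : k != 0 -> A k 0 = 0.
Proof.
move=> k0; rewrite /A (_ : (fun t => W (polar 0 t)) = (fun=> W 0)) ?fourier_real_cst//.
by apply/funext => t; rewrite /polar mul0r.
Qed.

(** The derivative [2 k Re (conj (A k) * A' k)] of [k * |A k|^2] along the radius is
    at most [r * (|A' k|^2 + (k |A k| / r)^2)]: the coefficients of the radial and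
    of the angular derivative of [W] appear.  Bessel's inequality bounds the sum
    over [k] of either square by the mean of [|P|^2], and integrating over the
    radius produces the Dirichlet integral. *)
Lemma weighted_coef_le N (b : R) : 0 <= b < 1 ->
  \sum_(k < N) k.+1%:R * modulus (fourier_real (fun t => W (polar b t)) k.+1%:Z) ^+ 2 <=
  pi^-1 * dirichlet_radius b.
Proof.
move=> /andP[b0 b1].
pose a (k : nat) r := complex.Re (A k.+1%:Z r); pose c (k : nat) r := complex.Im (A k.+1%:Z r).
pose a' (k : nat) r := complex.Re (A' k.+1%:Z r); pose c' (k : nat) r := complex.Im (A' k.+1%:Z r).
pose S r := \sum_(k < N) k.+1%:R * (a k r * a k r + c k r * c k r).
pose D r := \sum_(k < N) k.+1%:R * (2 * (a k r * a' k r + c k r * c' k r)).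
have r_lt r : 0 <= r <= b -> `|r| < 1 by move=> /andP[r0 rb]; rewrite ger0_norm// (le_lt_trans rb b1).
have SE : \sum_(k < N) k.+1%:R * modulus (A k.+1%:Z b) ^+ 2 = S b.
  by apply: eq_bigr => k _; rewrite modulus_sqr !expr2.
have dS (r : R) : 0 <= r <= b -> is_derive r 1 S (D r).
  move=> rb; rewrite /S /D; elim: {S D SE} N => [|n ih].
    rewrite big_ord0 (_ : (fun _ => _) = (fun=> 0)); first exact: is_derive_cst.
    by apply/funext => x; rewrite big_ord0.
  rewrite big_ord_recr/= (_ : (fun _ => _) = (fun x => \sum_(k < n) k.+1%:R * (a k x * a k x + c k x * c k x) +
    n.+1%:R * (a n x * a n x + c n x * c n x))); last by apply/funext => x; rewrite big_ord_recr.
  apply: is_deriveD.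
  have [da dc] := A_derive n.+1%:Z (r_lt r rb).
  apply: (is_derive_eq (is_deriveZ n.+1%:R (is_deriveD (is_deriveM da da) (is_deriveM dc dc)))).
  rewrite /a /c /a' /c'.
  move: (complex.Re (A _ r)) (complex.Im (A _ r)) (complex.Re (A' _ r)) (complex.Im (A' _ r)) => x y x' y'.
  rewrite /GRing.scale/=; ring.
have cD r : 0 <= r <= b -> {for r, continuous D}.
  move=> rb; rewrite /D; elim: {S D SE dS} N => [|n ih].
    rewrite (_ : (fun _ => _) = (fun=> 0)); first exact: cvg_cst.
    by apply/funext => x; rewrite big_ord0.
  rewrite (_ : (fun _ => _) = (fun r => \sum_(k < n) k.+1%:R * (2 * (a k r * a' k r + c k r * c' k r)) +
    n.+1%:R * (2 * (a n r * a' n r + c n r * c' n r)))); last by apply/funext => x; rewrite big_ord_recr.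
  apply: cvgD; first exact: ih.
  have cA := curve_derive_ccont (A_derive n.+1%:Z (r_lt r rb)).
  have cA' := A'_ccont n.+1%:Z (r_lt r rb).
  apply: cvgM; first exact: cvg_cst.
  apply: cvgM; first exact: cvg_cst.
  by apply: cvgD; apply: cvgM; [exact: ccont_Re|exact: ccont_Re|exact: ccont_Im|exact: ccont_Im].
have S0 : S 0 = 0.
  by rewrite /S big1// => k _; rewrite /a /c A0//= !mul0r addr0 mulr0.
have bessel_nat (F : int -> R) r : (forall ks, uniq ks -> \sum_(k <- ks) F k <= r) ->
    \sum_(k < N) F k.+1%:Z <= r.
  move=> /(_ [seq (k.+1)%:Z | k <- iota 0 N]).
  rewrite map_inj_uniq ?iota_uniq => [/(_ isT)|i j [] //].
  by rewrite big_map -{1}[N]subn0 -/(index_iota 0 N) big_mkord.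
have D_le r : 0 <= r <= b -> D r <= 2 * (r * m r).
  move=> rb; have r1 := r_lt r rb; move: (rb) => /andP[]; rewrite le_eqVlt => /predU1P[<- _|r0 _].
    by rewrite mul0r mulr0 /D big1// => k _; rewrite /a /c A0//= !mul0r addr0 !mulr0.
  rewrite -(ler_pM2l r0) /D mulr_sumr.
  apply: (@le_trans _ _ (\sum_(k < N) (r ^+ 2 * modulus (A' k.+1%:Z r) ^+ 2 +
      k.+1%:Z%:~R ^+ 2 * modulus (A k.+1%:Z r) ^+ 2))).
    apply: ler_sum => k _; rewrite !modulus_sqr -/(a k r) -/(c k r) -/(a' k r) -/(c' k r).
    rewrite (_ : k.+1%:Z%:~R = k.+1%:R)//.
    move: (a k r) (c k r) (a' k r) (c' k r) (k.+1%:R : R) => x y x' y' n.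
    have := sqr_ge0 (r * x' - n * x); have := sqr_ge0 (r * y' - n * y); nra.
  rewrite big_split/= -mulr_sumr.
  have h1 := bessel_nat _ _ (fun ks => @A'_bessel ks r r1).
  have h2 := bessel_nat (fun k => k%:~R ^+ 2 * modulus (A k r) ^+ 2) _ (fun ks => @A_bessel ks r r1).
  have -> : r * (2 * (r * m r)) = r ^+ 2 * m r + r ^+ 2 * m r by ring.
  by apply: lerD => //; rewrite ler_wpM2l ?sqr_ge0.
have -> : \sum_(k < N) k.+1%:R * modulus (fourier_real (fun t => W (polar b t)) k.+1%:Z) ^+ 2 =
    \int[mu]_(r in `[0, b]) D r by rewrite (Rintegral_FTC b0 dS cD) S0 subr0; exact: SE.
rewrite -density_total//; apply: le_Rintegral.
- exact: measurable_itv.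
- by apply: segment_integrable => r rb; exact: cD.
- exact: density_integrable.
- by move=> r /=; rewrite in_itv/= => rb; exact: D_le.
Qed.

(** The derivative [a'] of the mean satisfies [a' <= 1 / 16 + 4 a'^2], and Bessel's
    inequality bounds [a'^2].  The term [1 / 32] is [1 / 16] times the length of
    the interval from [1 / 2] to [1]. *)
Lemma mean_growth (b : R) : 1 / 2 <= b < 1 ->
  complex.Re (fourier_real (fun t => W (polar b t)) 0) <=
  complex.Re (fourier_real (fun t => W (polar (1 / 2) t)) 0) + 1 / 32 + 4 * (pi^-1 * dirichlet_radius b).
Proof.
move=> /andP[hb b1]; pose a r := complex.Re (A 0 r); pose a' r := complex.Re (A' 0 r).
have h0 : 0 < 1 / 2 :> R by rewrite divr_gt0.
have r_lt r : 1 / 2 <= r <= b -> `|r| < 1.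
  by move=> /andP[r0 rb]; rewrite ger0_norm ?(le_lt_trans rb b1)// (le_trans (ltW h0)).
have FTC : \int[mu]_(r in `[1 / 2, b]) a' r = a b - a (1 / 2).
  apply: (Rintegral_FTC hb) => r rb; first by have [] := A_derive 0 (r_lt r rb).
  by apply: ccont_Re; apply: A'_ccont; exact: r_lt.
have i1 : mu.-integrable `[1 / 2, b] (EFin \o cst (1 / 16)) by exact: itv_cst_integrable.
have i2 := @density_integrable (1 / 2) b (ltW h0) b1.
have i3 : mu.-integrable `[1 / 2, b] (EFin \o (fun r => 4 * (2 * (r * m r)))).
  apply: segment_integrable => r /andP[r0 rb]; apply: cvgM; first exact: cvg_cst.
  by apply: mean_cont; rewrite (le_trans (ltW h0) r0) (le_lt_trans rb b1).
have le1 : a b - a (1 / 2) <= \int[mu]_(r in `[1 / 2, b]) (1 / 16 + 4 * (2 * (r * m r))).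
  rewrite -FTC; apply: le_Rintegral.
  - exact: measurable_itv.
  - by apply: segment_integrable => r rb; apply: ccont_Re; apply: A'_ccont; exact: r_lt.
  - apply: segment_integrable => r /andP[r0 rb]; apply: cvgD; first exact: cvg_cst.
    apply: cvgM; first exact: cvg_cst.
    by apply: mean_cont; rewrite (le_trans (ltW h0) r0) (le_lt_trans rb b1).
  - move=> r /=; rewrite in_itv/= => rb; have := @A'_bessel [:: 0] r (r_lt r rb) isT.
    rewrite big_seq1 modulus_sqr -/(a' r) => h.
    have r2 : 1 / 2 <= r by case/andP : rb.
    have m0 := m_ge0 r; have := sqr_ge0 (complex.Im (A' 0 r)) => i0.
    have : 4 * a' r ^+ 2 <= 8 * (r * m r) by nra.
    have := sqr_ge0 (2 * a' r - 1 / 4); nra.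
move: le1; rewrite RintegralD// Rintegral_cst// RintegralZl//.
have -> : fine (mu `[1 / 2, b]%classic) = b - 1 / 2.
  rewrite lebesgue_measure_itv/= lte_fin; move: hb; rewrite le_eqVlt => /predU1P[->|->].
    by rewrite ltxx subrr.
  by [].
have -> : \int[mu]_(r in `[1 / 2, b]) (2 * (r * m r)) =
    pi^-1 * dirichlet_radius b - \int[mu]_(r in `[0, 1 / 2]) (2 * (r * m r)).
  have h2 : (0 <= 1 / 2 :> R) && (1 / 2 <= b) by apply/andP; split; [exact: ltW|exact: hb].
  rewrite -density_total// (@Rintegral_cat _ (fun r => 2 * (r * m r)) 0 (1 / 2) b h2).
    by rewrite addrAC subrr add0r.
  by move=> r /andP[r0 rb]; apply: mean_cont; rewrite r0 (le_lt_trans rb b1).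
have : 0 <= \int[mu]_(r in `[0, 1 / 2]) (2 * (r * m r)).
  by apply: Rintegral_ge0 => r /=; rewrite in_itv/= => /andP[r0 _]; apply: mulr_ge0; [|exact: mulr_ge0 r0 (m_ge0 r)].
rewrite -/(A 0 b) -/(A 0 (1 / 2)) -/(a b) -/(a (1 / 2)).
move: (\int[mu]_(r in _) _) (pi^-1 * _) (a b) (a (1 / 2)) => x y u v; lra.
Qed.

Lemma sum_inv_sqr N : \sum_(k < N) (k.+1%:R ^- 2 : R) <= 2.
Proof.
suff h n : \sum_(k < n.+1) (k.+1%:R ^- 2 : R) <= 2 - n.+1%:R^-1.
  case: N => [|n]; first by rewrite big_ord0.
  by apply: (le_trans (h n)); rewrite gerBl invr_ge0.
elim: n => [|n ih]; first by rewrite big_ord_recl big_ord0 addr0 expr1n invr1; lra.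
rewrite big_ord_recr/=; apply: (le_trans (lerD ih (lexx _))).
have x0 : 0 < n.+1%:R :> R by rewrite ltr0Sn.
rewrite -[n.+2%:R]natr1; move: (n.+1%:R : R) x0 => x x0; rewrite -subr_ge0.
have -> : 2 - (x + 1)^-1 - (2 - x^-1 + (x + 1) ^- 2) = x^-1 * (x + 1) ^- 2.
  by field; rewrite !gt_eqF// ltr_wpDr.
by rewrite mulr_ge0// invr_ge0 ?sqr_ge0// ltW.
Qed.

(** [2 |A k| <= 1 / k^2 + k^2 |A k|^2], where the last terms are the squared
    coefficients of the angular derivative. *)
Lemma coef_summable (b : R) : 0 <= b < 1 ->
  exists C, forall N, \sum_(k < N) modulus (fourier_real (fun t => W (polar b t)) k.+1%:Z) <= C.
Proof.
move=> /andP[b0 b1]; have br : `|b| < 1 by rewrite ger0_norm.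
exists (2 + b ^+ 2 * m b) => N.
apply: (@le_trans _ _ (\sum_(k < N) (k.+1%:R ^- 2 +
    k.+1%:Z%:~R ^+ 2 * modulus (A k.+1%:Z b) ^+ 2))).
  apply: ler_sum => k _; rewrite (_ : k.+1%:Z%:~R = k.+1%:R :> R)//.
  have x0 : 0 < k.+1%:R :> R by rewrite ltr0Sn.
  rewrite -/(A k.+1%:Z b); move: (modulus _) (k.+1%:R : R) (modulus_ge0 (A k.+1%:Z b)) x0 => y x y0 x0.
  rewrite -exprVn -exprMn.
  have {1}-> : y = x^-1 * (x * y) by rewrite mulKf// gt_eqF.
  move: (x^-1) (x * y) => u v.
  have := sqr_ge0 (u - v); have := sqr_ge0 u; have := sqr_ge0 v; nra.
rewrite big_split/=; apply: lerD; first exact: sum_inv_sqr.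
have := @A_bessel [seq (k.+1)%:Z | k <- iota 0 N] b br.
rewrite map_inj_uniq ?iota_uniq => [/(_ isT)|i j [] //].
by rewrite big_map -{1}[N]subn0 -/(index_iota 0 N) big_mkord.
Qed.

Lemma fourier_series_W (b t : R) : 0 <= b < 1 -> - pi <= t <= pi ->
  (complex.Re (fourier_real (fun t => W (polar b t)) 0) +
   2 * \sum_(k < N) complex.Re (fourier_real (fun t => W (polar b t)) k.+1%:Z * wave k.+1%:Z t))
    @[N --> \oo] --> W (polar b t).
Proof.
move=> /andP[b0 b1] /andP[t0 t1]; have br : `|b| < 1 by rewrite ger0_norm.
have cW := W_circle br.
have c1 (x : R) : ccont (fun t => (W (polar b t))%:C%C) x by apply: ccont_real; exact: cW.
have p1 (x : R) : (W (polar b (x + 2 * pi)))%:C%C = (W (polar b x))%:C%C by rewrite polar_period.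
have tp : - pi <= t <= - pi + 2 * pi by rewrite t0/=; lra.
have /cvg_ReImP[+ _] := fourier_sum_cvg c1 p1 tp (curve_derive_real (W_arc t br)).
apply: cvg_trans; apply: near_eq_cvg; apply: nearW => N.
by rewrite fourier_sum_real.
Qed.

End CoefficientGrowth.

(** * Testing measures of finite energy against functions on the disc *)

Section LowerLimits.
Context {R : realType}.
Implicit Types (u : nat -> \bar R).

Lemma limn_einf_ge (c : \bar R) u : (\forall n \near \oo, (c <= u n)%E) -> (c <= limn_einf u)%E.
Proof.
case=> N _ NP; rewrite limn_einf_lim; apply: lime_ge; first exact: is_cvg_einfs.
exists N => // n /= Nn; apply: le_ereal_inf_tmp => _ [k /= nk <-]; apply: NP => /=.
exact: leq_trans nk.
Qed.

Lemma limn_einf_le (c : \bar R) u : (forall n, (u n <= c)%E) -> (limn_einf u <= c)%E.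
Proof.
move=> uc; rewrite limn_einf_lim; apply: lime_le; first exact: is_cvg_einfs.
by apply: nearW => n; apply: (le_trans (@ereal_inf_lbound _ _ _ _)); [exists n => //=|exact: uc].
Qed.

End LowerLimits.

(** The integral of a nonnegative function is a supremum over the simple functions
    below it, hence monotone on arbitrary functions; this is applied to capacities
    and to lower limits. *)
Lemma ge0_integral_monotone d (T : measurableType d) (R : realType) (mu : {measure set T -> \bar R})
  (D : set T) (f g : T -> \bar R) : (forall x, D x -> (0 <= f x)%E) -> (forall x, D x -> (f x <= g x)%E) ->
  (\int[mu]_(x in D) f x <= \int[mu]_(x in D) g x)%E.
Proof.
move=> f0 fg; have g0 x : D x -> (0 <= g x)%E by move=> Dx; exact: le_trans (f0 x Dx) (fg x Dx).
rewrite (ge0_integralE _ f0) (ge0_integralE _ g0).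
apply: ge_ereal_sup => _ [h hf <-]; apply: ereal_sup_ubound; exists h => // x; apply: (le_trans (hf x)).
by rewrite !patchE; case: ifPn => // /set_mem; exact: fg.
Qed.

Section ClosedCircle.
Context {R : realType}.

Definition circle : set (plane R) := to_complex @^-1` unit_circle R.

Lemma measurable_circle : measurable circle.
Proof.
have -> : circle = plane_disc 1 `\` disc.
  apply/seteqP; split => p; rewrite /circle /plane_disc /disc /unit_disc /unit_circle /=.
    by move=> ->; rewrite lexx ltxx.
  by move=> [h /negP]; rewrite -leNgt => h'; apply/eqP; rewrite eq_le h.
by apply: measurableD; [exact: measurable_plane_disc|exact: measurable_disc].
Qed.

(** A closed subset of the circle is the union of two graphs over closed subsets of the line. *)
Lemma measurable_closed_circle (K : set R[i]) : closed (K : set R[i]^o) -> K `<=` unit_circle R ->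
  measurable (to_complex @^-1` K : set (plane R)).
Proof.
move=> cK KC; pose h (x : R) := Num.sqrt (1 - x ^+ 2).
have ch : continuous h.
  move=> x; apply: (@continuous_comp _ _ _ (fun x : R => 1 - x ^+ 2) (Num.sqrt : R -> R)); last exact: sqrt_continuous.
  by apply: cvgB; [exact: cvg_cst|exact: exprn_continuous].
pose g (b : bool) (x : R) : R[i]^o := (x +i* ((-1) ^+ b * h x))%C.
have cg b : continuous (g b).
  move=> x; apply/cvg_ReImP; split; first exact: cvg_id.
  by apply: cvgM; [exact: cvg_cst|exact: ch].
pose Kb b := [set x : R | K (g b x)].
have mKb b : measurable (Kb b : set (measurableTypeR R)).
  by apply: closed_measurable; apply: (@preimage_closed _ _ (g b)).
have mh : measurable_fun setT (fun p : plane R => h p.1).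
  by apply: (measurableT_comp (continuous_measurable_fun ch)); exact: measurable_plane1.
have m1 b : measurable ([set p : plane R | Kb b p.1] : set (plane R)).
  have := @measurable_plane1 R measurableT _ (mKb b); rewrite setTI; by apply.
have m2 (b : bool) : measurable [set p : plane R | 0 <= (-1) ^+ b * p.2].
  apply: measurable_le_set; first exact: measurable_cst.
  by apply: measurable_funM; [exact: measurable_cst|exact: measurable_plane2].
pose T (b : bool) := circle `&` ([set p : plane R | 0 <= (-1) ^+ b * p.2] `&` [set p : plane R | Kb b p.1]).
have mT b : measurable (T b).
  by apply: measurableI; [exact: measurable_circle|apply: measurableI].
suff -> : (to_complex @^-1` K : set (plane R)) = T false `|` T true by exact: measurableU.
have hE (p : plane R) : circle p -> h p.1 = `|p.2|.
  rewrite /circle /unit_circle/= => p1; have := modulus_sqr (to_complex p).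
  by rewrite p1 expr1n/= /h => ->; rewrite addrAC subrr add0r sqrtr_sqr.
apply/seteqP; split => p.
  move=> Kp; have Cp : circle p by exact: KC.
  have pE : to_complex p = (p.1 +i* p.2)%C by [].
  case: (ltP p.2 0) => p2; [right|left]; split => //; split => /=.
  - by rewrite expr1 mulN1r oppr_ge0 ltW.
  - by rewrite /Kb/= /g hE// ltr0_norm// expr1 mulrNN mul1r.
  - by rewrite expr0 mul1r.
  - by rewrite /Kb/= /g hE// ger0_norm// expr0 mul1r.
move=> [|] [Cp [/= p2]]; rewrite /Kb/= /g hE//; move: p2.
  by rewrite expr0 !mul1r => p2; rewrite ger0_norm.
by rewrite expr1 !mulN1r oppr_ge0 => p2; rewrite ler0_norm// opprK.
Qed.

End ClosedCircle.

Section EnergyTest.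
Context {R : realType}.
Variable mu : probability (plane R) R.
Hypothesis mu1 : mu circle = 1%E.

Lemma conj_circle (z : R[i]) : modulus z = 1 -> conjc z = z^-1.
Proof.
move=> z1; have z0 : z != 0 by rewrite -modulus_eq0 z1 oner_eq0.
by apply: (mulfI z0); rewrite mulCJ z1 expr1n divff.
Qed.

Lemma pintegrable_bounded (F : plane R -> R[i]) (M : R) : cmeasurable circle F ->
  (forall p, circle p -> modulus (F p) <= M) -> pintegrable mu circle F.
Proof.
move=> mF FM; apply: (pintegrable_le measurable_circle mF (g := fun=> M)) => //.
exact: finite_measure_integrable_cst measurable_circle.
Qed.

Lemma pint_cst (c : R[i]) : pint mu circle (fun=> c) = c.
Proof.
have mC := @measurable_circle R.
by apply: complex_eqP; rewrite ?Re_pint ?Im_pint (Rintegral_cst _ mC) (congr1 fine mu1) mulr1.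
Qed.

Lemma pintegrable_pow n : pintegrable mu circle (fun p => to_complex p ^+ n).
Proof.
apply: (@pintegrable_bounded _ 1); first by apply: cmeasurableX; exact: cmeasurable_to_complex.
by move=> p p1; rewrite modulusX p1 expr1n.
Qed.

(** On the circle the conjugate of a power is the power with opposite exponent. *)
Lemma pint_pow n : pint mu circle (fun p => to_complex p ^+ n) = conjc (fourier_coef mu n).
Proof.
rewrite /fourier_coef -[complex_integral _ _ _]/(pint mu circle (fun p => to_complex p ^- n)).
have iF : pintegrable mu circle (fun p => to_complex p ^- n).
  apply: (@pintegrable_bounded _ 1); last by move=> p p1; rewrite modulusV modulusX p1 expr1n invr1.
  apply: (cmeasurable_eq (F := fun p => conjc (to_complex p) ^+ n)).
    by move=> p p1; rewrite conj_circle// exprVn.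
  by apply: cmeasurableX; apply: cmeasurableJ; exact: cmeasurable_to_complex.
rewrite -(pintJ measurable_circle iF).
by apply: eq_pint => p p1; rewrite -exprVn -(conj_circle p1) -(rmorphXn (@conjc R)) conjcK.
Qed.

Definition trig_poly (c : R) (a : nat -> R[i]) N (p : plane R) : R[i] :=
  c%:C%C + \sum_(k < N) 2 * a k * to_complex p ^+ k.+1.

Lemma pintegrable_trig_poly c a N : pintegrable mu circle (trig_poly c a N) /\
  pint mu circle (trig_poly c a N) = c%:C%C + \sum_(k < N) 2 * a k * conjc (fourier_coef mu k.+1).
Proof.
have mC := @measurable_circle R.
elim: N => [|N [ih1 ih2]].
  have -> : trig_poly c a 0 = (fun=> c%:C%C) by apply/funext => p; rewrite /trig_poly big_ord0 addr0.
  rewrite big_ord0 addr0 pint_cst; split => //.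
  by apply: (@pintegrable_bounded _ `|c|); [exact: cmeasurable_cst|move=> p _; rewrite modulus_real].
have -> : trig_poly c a N.+1 = (fun p => trig_poly c a N p + 2 * a N * to_complex p ^+ N.+1).
  by apply/funext => p; rewrite /trig_poly big_ord_recr/= addrA.
have iz := pintegrableZ mC (2 * a N) (pintegrable_pow N.+1).
split; first exact: (pintegrableD mC ih1 iz).
rewrite (pintD mC ih1 iz) ih2 (pintZ mC _ (pintegrable_pow _)) pint_pow.
by rewrite big_ord_recr/= addrA.
Qed.

Variable I : R.
Hypothesis muI : energy mu = I%:E.

Lemma energy_sum_le N : \sum_(k < N) modulus (fourier_coef mu k.+1) ^+ 2 / k.+1%:R <= I.
Proof.
rewrite -lee_fin -muI /energy.
rewrite -sumEFin -(big_mkord xpredT (fun k => (modulus (fourier_coef mu k.+1) ^+ 2 / k.+1%:R)%:E)).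
have := @nneseries_lim_ge R (fun n => (modulus (fourier_coef mu n) ^+ 2 / n%:R)%:E) xpredT 1 N.+1.
by rewrite big_add1; apply => n _ _; rewrite lee_fin divr_ge0 ?sqr_ge0.
Qed.

(** Fourier duality: the weights [k] and [1 / k] are split by the inequality
    between arithmetic and geometric means. *)
Lemma trig_poly_integral_le c (a : nat -> R[i]) N (lambda E : R) : 0 < lambda ->
  \sum_(k < N) k.+1%:R * modulus (a k) ^+ 2 <= E ->
  \int[mu]_(p in circle) complex.Re (trig_poly c a N p) <= c + lambda * E + I / lambda.
Proof.
move=> l0 aE; rewrite -Re_pint (pintegrable_trig_poly c a N).2 Re_add -addrA lerD//.
have Re_sum n (F : nat -> R[i]) : complex.Re (\sum_(k < n) F k) = \sum_(k < n) complex.Re (F k).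
  by elim: n => [|n ih]; rewrite ?big_ord0// !big_ord_recr/= Re_add ih.
rewrite (Re_sum N (fun k => 2 * a k * conjc (fourier_coef mu k.+1))).
apply: (@le_trans _ _ (\sum_(k < N) (lambda * (k.+1%:R * modulus (a k) ^+ 2) +
    modulus (fourier_coef mu k.+1) ^+ 2 / k.+1%:R / lambda))).
  apply: ler_sum => k _; apply: (le_trans (ler_norm _)); apply: (le_trans (le_Re_modulus _)).
  rewrite (modulusM (2 * a k)) (modulusM 2) modulus_conj (modulus_nat 2).
  have k0 : 0 < k.+1%:R :> R by rewrite ltr0Sn.
  move: (modulus (a k)) (modulus (fourier_coef _ _)) (k.+1%:R : R) k0 => x y n n0.
  have l' := gt_eqF l0; have n' := gt_eqF n0; rewrite -subr_ge0.
  have -> : lambda * (n * x ^+ 2) + y ^+ 2 / n / lambda - 2 * x * y =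
      (lambda * n * x - y) ^+ 2 / (n * lambda) by field; rewrite l' n'.
  by rewrite divr_ge0 ?sqr_ge0// mulr_ge0// ltW.
rewrite big_split/= -mulr_sumr -mulr_suml lerD//; first by rewrite ler_pM2l.
by rewrite ler_pM2r ?invr_gt0// energy_sum_le.
Qed.

Variables (W : R[i] -> R) (P : R[i] -> R[i]).
Hypothesis W_diff : forall g (t : R) v, unit_disc R (g t) -> curve_derive g t v ->
  is_derive t 1 (fun t => W (g t)) (complex.Re (P (g t) * v)).
Hypothesis P_cont : forall z : R[i]^o, unit_disc R z -> {for z, continuous (P : R[i]^o -> R[i]^o)}.
Hypothesis W_ge0 : forall z, 0 <= W z.
Hypothesis W_meas : forall r : R, 0 <= r < 1 -> measurable_fun circle (fun p => W (r%:C%C * to_complex p)).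

(** The partial sums of the Fourier series of [W] on the circle of radius [b] are
    uniformly bounded.  After the addition of a constant they are nonnegative, and
    Fatou's lemma transfers [trig_poly_integral_le] to their limit. *)
Lemma circle_integral_le (b lambda : R) : 0 <= b < 1 -> 0 < lambda ->
  (\int[mu]_(p in circle) (W (b%:C%C * to_complex p))%:E <=
   (complex.Re (fourier_real (fun t => W (polar b t)) 0) +
    lambda * (pi^-1 * dirichlet_radius P b) + I / lambda)%:E)%E.
Proof.
move=> b01 l0; have mC := @measurable_circle R.
pose A k := fourier_real (fun t => W (polar b t)) k; pose c := complex.Re (A 0).
pose a k := A k.+1%:Z; pose S N p := complex.Re (trig_poly c a N p).
have [C CP] := coef_summable W_diff P_cont b01; have C0 : 0 <= C by have := CP 0%N; rewrite big_ord0.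
pose M := `|c| + 2 * C; have M0 : 0 <= M by rewrite addr_ge0 ?mulr_ge0.
have SE N t : S N (cos t, sin t) = c + 2 * \sum_(k < N) complex.Re (A k.+1%:Z * wave k.+1%:Z t).
  rewrite /S /trig_poly; elim: N => [|N ih]; first by rewrite !big_ord0 mulr0 !addr0.
  have -> : \sum_(k < N.+1) 2 * a k * to_complex (cos t, sin t) ^+ k.+1 =
      \sum_(k < N) 2 * a k * to_complex (cos t, sin t) ^+ k.+1 +
      2 * a N * to_complex (cos t, sin t) ^+ N.+1 by exact: big_ord_recr.
  have -> : \sum_(k < N.+1) complex.Re (A k.+1%:Z * wave k.+1%:Z t) =
      \sum_(k < N) complex.Re (A k.+1%:Z * wave k.+1%:Z t) +
      complex.Re (A N.+1%:Z * wave N.+1%:Z t) by exact: big_ord_recr.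
  rewrite addrA Re_add ih mulrDr addrA; congr (_ + _).
  rewrite -mulrA -[to_complex _]/(expi t) -wave_nat -/(a N); move: (a N * _) => z.
  by rewrite [2 * z]mulr_natl mulr2n Re_add [RHS]mulr_natl mulr2n.
have SM N p : circle p -> `|S N p| <= M.
  move=> p1; apply: (le_trans (le_Re_modulus _)); apply: (le_trans (le_modulusD _ _)).
  rewrite modulus_real lerD2l; apply: (le_trans (le_modulus_sum _ _)).
  apply: (@le_trans _ _ (2 * \sum_(k < N) modulus (a k))); last by rewrite ler_pM2l.
  rewrite mulr_sumr; apply: ler_sum => k _.
  by rewrite (modulusM (2 * a k)) (modulusM 2) (modulus_nat 2) modulusX p1 expr1n mulr1.
have mS N : measurable_fun circle (S N).
  have [[/integrableP[/measurable_EFinP h _] _] _] := pintegrable_trig_poly c a N.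
  exact: h.
have S_cvg p : circle p -> S N p @[N --> \oo] --> W (b%:C%C * to_complex p).
  move=> p1; have [t tpi pE] := expi_surj p1.
  have -> : p = (cos t, sin t) by move: pE; rewrite /expi; case: p {p1} => x y [-> ->].
  have -> : to_complex (cos t, sin t) = expi t by [].
  have := fourier_series_W W_diff b01 tpi.
  by apply: cvg_trans; apply: near_eq_cvg; apply: nearW => N; rewrite SE.
pose B := c + lambda * (pi^-1 * dirichlet_radius P b) + I / lambda.
have intS N : (\int[mu]_(p in circle) (S N p + M)%:E <= (B + M)%:E)%E.
  have [[iS _] _] := pintegrable_trig_poly c a N.
  have iM : mu.-integrable circle (EFin \o cst M) by exact: finite_measure_integrable_cst mC.
  have iSM : mu.-integrable circle (EFin \o (fun p => S N p + M)) by have := integrableD mC iS iM.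
  have -> : (\int[mu]_(p in circle) (S N p + M)%:E = (\int[mu]_(p in circle) (S N p + M))%:E)%E.
    by rewrite /Rintegral fineK//; exact: integrable_fin_num.
  rewrite lee_fin (RintegralD mC iS iM) (Rintegral_cst _ mC) (congr1 fine mu1) mulr1 lerD2r.
  apply: trig_poly_integral_le => //.
  exact: (weighted_coef_le W_diff P_cont).
have : (\int[mu]_(p in circle) (W (b%:C%C * to_complex p) + M)%:E <= (B + M)%:E)%E.
  apply: (@le_trans _ _ (\int[mu]_(p in circle) limn_einf (fun N => (S N p + M)%:E))%E).
    rewrite le_eqVlt; apply/orP; left; apply/eqP; apply: eq_integral => p /set_mem p1.
    suff /cvg_limn_einf_sup[] : (S N p + M)%:E @[N --> \oo] --> (W (b%:C%C * to_complex p) + M)%:E by [].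
    apply: cvg_EFin; first exact: nearW.
    by apply: cvgD; [exact: S_cvg|exact: cvg_cst].
  apply: (le_trans (fatou _ _ _ _)).
  - exact: mC.
  - move=> N; apply/measurable_EFinP; apply: measurable_funD; [exact: mS|exact: measurable_cst].
  - move=> N p p1; rewrite lee_fin -lerBlDr sub0r.
    by have := SM N p p1; rewrite ler_norml => /andP[].
  - by apply: limn_einf_le => N; exact: intS.
under eq_integral do rewrite EFinD.
rewrite ge0_integralD//; first last.
- by apply/measurable_EFinP; exact: W_meas.
- by move=> p _; rewrite lee_fin.
rewrite integral_cst// [X in (_ + _ * X)%E](_ : _ = 1%E) ?mule1 ?EFinD ?leeD2rE//; exact: mu1.
Qed.

(** Fatou's lemma along the radii [1 - 1 / (n + 2)] gives
    [1 / 2 <= 1 / 4 + lambda * H + I / lambda] for every positive [lambda]. *)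
Lemma level_test (K : set R[i]) (H : R) : closed (K : set R[i]^o) -> K `<=` unit_circle R ->
  mu (to_complex @^-1` K) = 1%E ->
  (forall zeta, K zeta -> \forall n \near \oo, 1 / 2 <= W ((1 - n.+2%:R^-1)%:C%C * zeta)) ->
  (forall b, 1 / 2 <= b < 1 -> complex.Re (fourier_real (fun t => W (polar b t)) 0) <= 1 / 4) ->
  (forall b, 0 <= b < 1 -> pi^-1 * dirichlet_radius P b <= H) ->
  1 <= 64 * H * I.
Proof.
move=> cK KC muK near_half mean_le H_le.
have mC := @measurable_circle R; have mK := measurable_closed_circle cK KC.
have I0 : 0 <= I by have := energy_sum_le 0; rewrite big_ord0.
have H0 : 0 <= H.
  apply: le_trans (H_le 0 _); last by rewrite lexx ltr01.
  rewrite mulr_ge0 ?invr_ge0 ?pi_ge0// Rintegral_ge0// => r /=; rewrite in_itv/= => /andP[r0 _].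
  by rewrite mulr_ge0// Rintegral_ge0// => t _; exact: sqr_ge0.
suff key (lambda : R) : 0 < lambda -> 1 / 4 <= lambda * H + I / lambda.
  move: I0; rewrite le_eqVlt => /predU1P[I0|I0].
    have l0 : 0 < (8 * (H + 1))^-1 by rewrite invr_gt0 mulr_gt0// ltr_wpDl.
    have h := key _ l0; rewrite -I0 mul0r addr0 in h; exfalso.
    have h' : (8 * (H + 1))^-1 * H <= 1 / 8.
      by rewrite mulrC ler_pdivrMr ?mulr_gt0 ?ltr_wpDl//; lra.
    by have := le_trans h h'; lra.
  (* The choice [lambda = 8 I] makes the last term [1 / 8]. *)
  have l0 : 0 < 8 * I by rewrite mulr_gt0.
  have := key _ l0; rewrite invfM mulrCA divff ?gt_eqF// mulr1; lra.
move=> l0.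
pose r (n : nat) : R := 1 - n.+2%:R^-1.
have r_half n : 1 / 2 <= r n < 1.
  have n0 : 0 < n.+2%:R :> R by rewrite ltr0Sn.
  rewrite /r ltrBlDr ltrDl invr_gt0 n0 andbT lerBrDl -lerBrDr.
  have -> : 1 - 1 / 2 = 2^-1 :> R by lra.
  by rewrite lef_pV2 ?posrE// ler_nat.
have r01 n : 0 <= r n < 1 by have /andP[h ->] := r_half n; rewrite (le_trans _ h)//; lra.
have : ((1 / 2)%:E <= (1 / 4 + lambda * H + I / lambda)%:E)%E.
  apply: (@le_trans _ _ (\int[mu]_(p in to_complex @^-1` K) (1 / 2)%:E)%E).
    by rewrite integral_cst// [X in (_ * X)%E](_ : _ = 1%E) ?mule1//; exact: muK.
  apply: (@le_trans _ _ (\int[mu]_(p in to_complex @^-1` K)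
      limn_einf (fun n => (W ((r n)%:C%C * to_complex p))%:E))%E).
    apply: ge0_integral_monotone => [p _|p Kp]; first by rewrite lee_fin.
    by apply: limn_einf_ge; apply: filterS (near_half _ Kp) => n; rewrite lee_fin.
  apply: (le_trans (fatou mu mK _ _)).
  - move=> n; apply/measurable_EFinP; apply: measurable_funS (W_meas (r01 n)) => //.
    by move=> p; exact: KC.
  - by move=> n p _; rewrite lee_fin.
  apply: limn_einf_le => n.
  apply: (@le_trans _ _ (\int[mu]_(p in circle) (W ((r n)%:C%C * to_complex p))%:E)%E).
    apply: ge0_subset_integral => //.
    - by apply/measurable_EFinP; exact: W_meas.
    - by move=> p _; rewrite lee_fin.
    - by move=> p; exact: KC.
  apply: (le_trans (circle_integral_le (r01 n) l0)); rewrite lee_fin lerD2r.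
  by apply: lerD; [exact: mean_le|rewrite ler_pM2l// H_le].
rewrite lee_fin; lra.
Qed.

End EnergyTest.

Section CapacityBound.
Context {R : realType}.

Lemma energy_ge0 (mu : probability (plane R) R) : (0 <= energy mu)%E.
Proof. by apply: nneseries_ge0 => n _ _; rewrite lee_fin divr_ge0 ?sqr_ge0. Qed.

Lemma capacity_closed_le (K : set R[i]) (c : R) : 0 <= c ->
  (forall mu, probability_on K mu -> forall I, energy mu = I%:E -> 1 <= c * I) ->
  (capacity_closed K <= c%:E)%E.
Proof.
move=> c0 H; rewrite /capacity_closed.
set x := ereal_inf _.
have x0 : (0 <= x)%E by apply: le_ereal_inf_tmp => _ [mu _ <-]; exact: energy_ge0.
have xc : (c%:E^-1 <= x)%E.
  apply: le_ereal_inf_tmp => _ [mu muK <-]; have := energy_ge0 mu.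
  case E : (energy mu) => [I| |] I0; [|by rewrite leey|by []].
  have h := H mu muK I E; move: c0; rewrite [(0 <= c)%R]le_eqVlt => /predU1P[c0|c0].
    by move: h; rewrite -c0 mul0r ler10.
  by rewrite inver gt_eqF// lee_fin -div1r ler_pdivrMr// mulrC.
by rewrite inve_ple// ?inE ?lee_fin ?inve_ge0.
Qed.

End CapacityBound.

(** * Capacity of the level sets *)

Section Cutoff.
Context {R : realType}.
Implicit Types (T u q : R).

(** At [q = |phi|^2] this is the hyperbolic distance of [phi] from [0], up to a
    bounded term. *)
Definition depth q : R := ln 2 - ln (1 - q).
(** A smooth cutoff at height [T]: close to [0] when [u] is small against [T] and
    close to [1] when it is large. *)
Definition cutoff T u : R := u ^+ 2 / (T ^+ 2 + u ^+ 2).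
Definition cutoff' T u : R := 2 * u * T ^+ 2 / (T ^+ 2 + u ^+ 2) ^+ 2.
Definition cutoff_density T u : R := 16 * u ^+ 2 * T ^+ 4 / (T ^+ 2 + u ^+ 2) ^+ 4.

Lemma depth_gt0 q : 0 <= q < 1 -> 0 < depth q.
Proof.
move=> /andP[q0 q1]; rewrite /depth.
have : ln (1 - q) <= 0 by apply: ln_le0; rewrite gerBl.
have : 0 < ln 2 :> R by apply: ln_gt0; rewrite ltr1n.
lra.
Qed.

Lemma is_derive_depth (f : R -> R) (t d : R) : f t < 1 -> is_derive t 1 f d ->
  is_derive t 1 (fun t => depth (f t)) (d / (1 - f t)).
Proof.
move=> ft df; have d1 : is_derive t 1 (fun t => 1 - f t) (- d).
  by have := is_deriveB (is_derive_cst (1 : R) t 1) df; rewrite sub0r.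
have p1 : 0 < 1 - f t by rewrite subr_gt0.
have d2 := @is_derive1_comp R (@ln R) (fun t => 1 - f t) t _ _ (is_derive1_ln p1) d1.
have := is_deriveB (is_derive_cst (ln 2 : R) t 1) d2.
by rewrite sub0r mulrN opprK mulrC.
Qed.

Lemma is_derive_cutoff T (f : R -> R) (t d : R) : 0 < T -> is_derive t 1 f d ->
  is_derive t 1 (fun t => cutoff T (f t)) (cutoff' T (f t) * d).
Proof.
move=> T0 df; have T20 : 0 < T ^+ 2 by rewrite exprn_gt0.
have d1 := is_deriveM df df.
have d2 := is_deriveD (is_derive_cst (T ^+ 2) t (1 : R)) d1.
have n0 : (cst (T ^+ 2) + f * f) t != 0.
  by rewrite gt_eqF// -[(_ + _) t]/(T ^+ 2 + f t * f t) ltr_wpDr// -expr2 sqr_ge0.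
have d3 := is_deriveV n0 d2; have d4 := is_deriveM d1 d3.
apply: (is_derive_eq d4); rewrite /cutoff' /GRing.scale/=.
have -> : (cst (T ^+ 2) + f * f) t = T ^+ 2 + f t ^+ 2 by rewrite expr2.
have -> : (f * f) t = f t ^+ 2 by rewrite expr2.
have m0 : T ^+ 2 + f t ^+ 2 != 0 by rewrite gt_eqF// ltr_wpDr ?sqr_ge0.
move: (f t) (T ^+ 2) m0 => u x m0; rewrite add0r; field; exact: m0.
Qed.

Lemma cutoff_ge0 T u : 0 <= cutoff T u.
Proof. by rewrite /cutoff divr_ge0 ?addr_ge0 ?sqr_ge0. Qed.

Lemma cutoff_le T u : 0 < T -> cutoff T u <= u ^+ 2 / T ^+ 2.
Proof.
move=> T0; have T20 : 0 < T ^+ 2 by rewrite exprn_gt0.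
rewrite /cutoff ler_wpM2l ?sqr_ge0// lef_pV2 ?posrE// ?lerDl ?sqr_ge0//.
by rewrite ltr_wpDr ?sqr_ge0.
Qed.

Lemma cutoff_half T u : 0 < T <= u -> 1 / 2 <= cutoff T u.
Proof.
move=> /andP[T0 Tu]; have T20 : 0 < T ^+ 2 by rewrite exprn_gt0.
rewrite /cutoff ler_pdivlMr ?ltr_wpDr ?sqr_ge0//.
have : T ^+ 2 <= u ^+ 2 by rewrite lerXn2r ?nnegrE ?(le_trans (ltW T0)) ?(ltW T0).
lra.
Qed.

Lemma cutoff_density_ge0 T u : 0 <= cutoff_density T u.
Proof.
apply: divr_ge0; last exact: exprn_even_ge0.
by apply: mulr_ge0; [rewrite mulr_ge0 ?sqr_ge0|exact: exprn_even_ge0].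
Qed.

Lemma cutoff'_sqr T u : 4 * cutoff' T u ^+ 2 = cutoff_density T u.
Proof.
rewrite /cutoff' /cutoff_density; move: (T ^+ 2 + u ^+ 2) => x.
have -> : x ^+ 4 = (x ^+ 2) ^+ 2 by rewrite -exprM.
rewrite expr_div_n; move: ((_ ^+ 2) ^-1) => y; ring.
Qed.

Lemma cutoff_density_le T u : 0 < T -> cutoff_density T u <= 16 / T ^+ 2.
Proof.
move=> T0; have T20 : 0 < T ^+ 2 by rewrite exprn_gt0.
rewrite /cutoff_density; have -> : T ^+ 4 = (T ^+ 2) ^+ 2 by rewrite -exprM.
move: (T ^+ 2) (u ^+ 2) T20 (sqr_ge0 u) => x y x0 y0.
have s0 : 0 < x + y by rewrite ltr_wpDr.
rewrite ler_pdivrMr ?exprn_gt0// [16 / x * _]mulrAC ler_pdivlMr// -!mulrA ler_pM2l//.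
have : y * (x ^+ 2 * x) <= (x + y) * (x + y) ^+ 3.
  rewrite -exprSr; apply: ler_pM; rewrite ?exprn_ge0 ?(ltW x0)// ?lerDr ?(ltW x0)//.
  by rewrite lerXn2r ?nnegrE ?(ltW x0) ?(ltW s0)// lerDl.
by rewrite -exprS expr2 -!mulrA.
Qed.

End Cutoff.

Section Potential.
Context {R : realType}.
Local Notation D' := complex_derivative.
Local Notation lam := (@planar_lebesgue R).
Local Notation leb := (@lebesgue_measure R).
Variable phi : R[i] -> R[i].
Hypothesis phi_holo : holomorphic phi.
Hypothesis phi_self : forall z, unit_disc R z -> unit_disc R (phi z).
Hypothesis hyperbolic_fin : (hyperbolic_integral phi < +oo)%E.

Let q z := modulus (phi z) ^+ 2.
Definition hyperbolic_density (z : R[i]) : R := modulus (D' phi z) ^+ 2 / (1 - modulus (phi z) ^+ 2) ^+ 2.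
Definition potential (T : R) z := cutoff T (depth (modulus (phi z) ^+ 2)).
Definition potential_gradient (T : R) z : R[i] :=
  (cutoff' T (depth (modulus (phi z) ^+ 2)) / (1 - modulus (phi z) ^+ 2) * 2)%:C%C * conjc (phi z) * D' phi z.
Definition potential_integral (T : R) : \bar R :=
  (\int[lam]_(p in disc) (cutoff_density T (depth (modulus (phi (to_complex p)) ^+ 2)) *
     hyperbolic_density (to_complex p))%:E)%E.

Let q01 z : unit_disc R z -> 0 <= q z < 1.
Proof. by move=> z1; rewrite sqr_ge0/= expr_lt1 ?modulus_ge0//; exact: phi_self. Qed.

Lemma potential_diff (T : R) g (t : R) v : 0 < T -> unit_disc R (g t) -> curve_derive g t v ->
  is_derive t 1 (fun t => potential T (g t)) (complex.Re (potential_gradient T (g t) * v)).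
Proof.
move=> T0 g1 dg; have [da db] := curve_derive_comp (is_derive_holomorphic phi_holo g1) dg.
have dq : is_derive t 1 (fun t => q (g t)) (2 * complex.Re (conjc (phi (g t)) * (D' phi (g t) * v))).
  have E : (fun t => q (g t)) = ((fun t => complex.Re (phi (g t))) * (fun t => complex.Re (phi (g t))) +
      (fun t => complex.Im (phi (g t))) * (fun t => complex.Im (phi (g t)))).
    by apply/funext => x; rewrite /q modulus_sqr !expr2.
  rewrite E; apply: (is_derive_eq (is_deriveD (is_deriveM da da) (is_deriveM db db))).
  rewrite /GRing.scale/= (Re_mul (conjc _)) Re_conjc Im_conjc.
  move: (complex.Re (phi _)) (complex.Im (phi _)) (complex.Re (_ * v)) (complex.Im (_ * v)) => x y a b; ring.
have /andP[_ qt] := q01 g1.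
change (is_derive t (1 : R) (fun t => cutoff T (depth (q (g t)))) (complex.Re (potential_gradient T (g t) * v))).
have d1 := @is_derive_depth R (fun t => q (g t)) t _ qt dq.
have d2 := @is_derive_cutoff R T (fun t => depth (q (g t))) t _ T0 d1.
apply: (is_derive_eq d2).
have E (k : R) (w : R[i]) : complex.Re (k%:C%C * w) = k * complex.Re w.
  by rewrite Re_mul/= mul0r subr0.
have A (x y z w : R[i]) : x * y * z * w = x * (y * (z * w)) by rewrite !mulrA.
rewrite /potential_gradient A E -/(q (g t)).
move: (complex.Re _) (cutoff' _ _) ((1 - q (g t))^-1) => x y z; ring.
Qed.

Lemma real_complex_continuous (f : R[i] -> R) (z : R[i]^o) : {for z, continuous (f : R[i]^o -> R)} ->
  {for z, continuous (fun z : R[i]^o => (f z)%:C%C : R[i]^o)}.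
Proof.
move=> cf; apply/(@cvg_modulusP _ _ (nbhs z)) => e e0.
have /cvgrPdist_lt/(_ _ e0) := cf; apply: filterS => w.
by rewrite -rmorphB/= modulus_real.
Qed.

Let q_cont (z : R[i]^o) : unit_disc R z -> {for z, continuous (q : R[i]^o -> R)}.
Proof. by move=> z1; exact: holomorphic_sqr_continuous. Qed.

Lemma depth_continuous (x : R) : x < 1 -> {for x, continuous depth}.
Proof.
move=> x1; have [d _] := @is_derive_depth R id x 1 x1 (is_derive_id _ _).
by apply: differentiable_continuous; apply/derivable1_diffP.
Qed.

Let depth_cont (z : R[i]^o) : unit_disc R z -> {for z, continuous (fun z : R[i]^o => depth (q z))}.
Proof.
move=> z1; apply: (@continuous_comp _ _ _ (q : R[i]^o -> R) (@depth R)); first exact: q_cont.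
by apply: depth_continuous; case/andP : (q01 z1).
Qed.

Lemma potential_gradient_continuous (T : R) (z : R[i]^o) : 0 < T -> unit_disc R z ->
  {for z, continuous (potential_gradient T : R[i]^o -> R[i]^o)}.
Proof.
move=> T0 z1; have T20 : 0 < T ^+ 2 by rewrite exprn_gt0.
have cu := depth_cont z1.
have cu2 : {for z, continuous (fun z : R[i]^o => depth (q z) ^+ 2)} by exact: (cvgM cu cu).
have cS : {for z, continuous (fun z : R[i]^o => T ^+ 2 + depth (q z) ^+ 2)}.
  have cc : {for z, continuous (fun _ : R[i]^o => T ^+ 2)} by exact: cst_continuous.
  exact: (cvgD cc cu2).
have S0 : T ^+ 2 + depth (q z) ^+ 2 != 0 by rewrite gt_eqF// ltr_wpDr ?sqr_ge0.
have c1 : {for z, continuous (fun z : R[i]^o => cutoff' T (depth (q z)) / (1 - q z) * 2)}.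
  have cc (c : R) : {for z, continuous (fun _ : R[i]^o => c)} by exact: cst_continuous.
  have cM (f g : R[i]^o -> R) : {for z, continuous f} -> {for z, continuous g} ->
      {for z, continuous (fun z => f z * g z)} by move=> cf cg; exact: (cvgM cf cg).
  have cV (f : R[i]^o -> R) : f z != 0 -> {for z, continuous f} ->
      {for z, continuous (fun z => (f z)^-1)} by move=> f0 cf; exact: (cvgV f0 cf).
  have c1q : {for z, continuous (fun z : R[i]^o => 1 - q z)} by exact: (cvgB (cc 1) (q_cont z1)).
  have q1 : 1 - q z != 0 by rewrite subr_eq0 eq_sym lt_eqF//; case/andP : (q01 z1).
  have S20 : (T ^+ 2 + depth (q z) ^+ 2) ^+ 2 != 0 by rewrite expf_neq0.
  have cS2 : {for z, continuous (fun z : R[i]^o => (T ^+ 2 + depth (q z) ^+ 2) ^+ 2)} by exact: (cvgM cS cS).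
  exact: (cM _ _ (cM _ _ (cM _ _ (cM _ _ (cM _ _ (cc 2) cu) (cc (T ^+ 2))) (cV _ S20 cS2)) (cV _ q1 c1q)) (cc 2)).
have cD := holomorphic_continuous (holomorphic_derivative phi_holo) z1.
have cphi := holomorphic_continuous phi_holo z1.
have cj : {for z, continuous (fun z : R[i]^o => conjc (phi z) : R[i]^o)}.
  exact: (@continuous_comp _ _ _ (phi : R[i]^o -> R[i]^o) (conjc : R[i]^o -> R[i]^o) z cphi (@continuous_conj R _)).
have cc := real_complex_continuous c1.
apply: (@cvgM R[i] (R[i]^o)); [exact: nbhs_filter| |exact: cD].
by apply: (@cvgM R[i] (R[i]^o)); [exact: nbhs_filter|exact: cc|exact: cj].
Qed.

Lemma potential_gradient_sqr_le (T : R) z : unit_disc R z ->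
  modulus (potential_gradient T z) ^+ 2 <=
  cutoff_density T (depth (modulus (phi z) ^+ 2)) * hyperbolic_density z.
Proof.
move=> z1; have /andP[q0 q1] := q01 z1.
rewrite /potential_gradient -/(q z) !modulusM modulus_real modulus_conj !exprMn real_normK ?num_real//.
rewrite -cutoff'_sqr /hyperbolic_density -/(q z).
move: (cutoff' _ _) (modulus (D' _ _)) => a b; rewrite !exprMn exprVn.
have : 0 <= ((1 - q z) ^+ 2)^-1 by rewrite invr_ge0 sqr_ge0.
move: (((1 - q z) ^+ 2)^-1) => c; move: (q z) q0 q1 => x x0 x1 c0.
have : 0 <= a ^+ 2 * c * b ^+ 2 by exact: mulr_ge0 (mulr_ge0 (sqr_ge0 a) c0) (sqr_ge0 b).
move: (a ^+ 2) (b ^+ 2) => A B h; have : 0 <= (A * c * B) * (1 - x) by rewrite mulr_ge0// subr_ge0 ltW.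
nra.
Qed.

Lemma measurable_depth d (X : measurableType d) (A : set X) (u : X -> R) : measurable_fun A u ->
  measurable_fun A (fun p => depth (u p)).
Proof.
move=> mu_; apply: measurable_funB; first exact: measurable_cst.
apply: (measurableT_comp (@measurable_ln R)).
by apply: measurable_funB; [exact: measurable_cst|exact: mu_].
Qed.

Lemma potential_measurable (T r : R) : 0 <= r < 1 ->
  measurable_fun circle (fun p : plane R => potential T (r%:C%C * to_complex p)).
Proof.
move=> /andP[r0 r1]; have m1 : cmeasurable circle (fun p : plane R => phi (r%:C%C * to_complex p)).
  apply: cmeasurable_holomorphic => //.
    by apply: cmeasurableM; [exact: cmeasurable_cst|exact: cmeasurable_to_complex].
  by move=> p p1; rewrite /unit_disc/= modulusM modulus_real p1 mulr1 ger0_norm.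
have mu_ := measurable_depth (cmeasurable_sqr m1).
apply: measurable_funM; first exact: measurable_funX.
apply: measurable_fun_inv; last by move=> p _; rewrite addr_ge0 ?sqr_ge0.
by apply: measurable_funD; [exact: measurable_cst|exact: measurable_funX].
Qed.

Lemma measurable_hyperbolic_density : measurable_fun disc (fun p : plane R => hyperbolic_density (to_complex p)).
Proof.
apply: measurable_funM; first exact: cmeasurable_sqr (cmeasurable_disc (holomorphic_derivative phi_holo)).
apply: measurable_fun_inv; last by move=> p _; rewrite sqr_ge0.
apply: measurable_funX; apply: measurable_funB; first exact: measurable_cst.
exact: cmeasurable_sqr (cmeasurable_disc phi_holo).
Qed.

Lemma hyperbolic_density_ge0 z : 0 <= hyperbolic_density z.
Proof. by rewrite /hyperbolic_density divr_ge0 ?sqr_ge0. Qed.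

Lemma measurable_cutoff_density d (X : measurableType d) (A : set X) (v u : X -> R) :
  measurable_fun A v -> measurable_fun A u ->
  measurable_fun A (fun p => cutoff_density (v p) (u p)).
Proof.
move=> mv mu_; apply: measurable_funM.
  apply: measurable_funM; last exact: measurable_funX.
  by apply: measurable_funM; [exact: measurable_cst|exact: measurable_funX].
apply: measurable_fun_inv; last by move=> p _; exact: exprn_even_ge0.
by apply: measurable_funX; apply: measurable_funD; exact: measurable_funX.
Qed.

Lemma potential_integral_ge0 (T : R) : (0 <= potential_integral T)%E.
Proof.
by apply: integral_ge0 => p _; rewrite lee_fin mulr_ge0 ?cutoff_density_ge0 ?hyperbolic_density_ge0.
Qed.

Lemma potential_integral_le (T : R) : 0 < T ->
  (potential_integral T <= (16 / T ^+ 2)%:E * hyperbolic_integral phi)%E.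
Proof.
move=> T0; have c0 : 0 <= 16 / T ^+ 2 by rewrite divr_ge0 ?sqr_ge0.
rewrite /hyperbolic_integral -ge0_integralZl; first last.
- by rewrite lee_fin.
- by move=> p _; rewrite lee_fin; exact: hyperbolic_density_ge0.
- by apply/measurable_EFinP; exact: measurable_hyperbolic_density.
- exact: measurable_disc.
apply: ge0_integral_monotone => p _.
  by rewrite lee_fin mulr_ge0 ?cutoff_density_ge0 ?hyperbolic_density_ge0.
by rewrite -EFinM lee_fin ler_wpM2r ?cutoff_density_le ?hyperbolic_density_ge0.
Qed.

Lemma potential_integral_fin (T : R) : 0 < T -> potential_integral T \is a fin_num.
Proof.
move=> T0; rewrite ge0_fin_numE ?potential_integral_ge0//.
apply: (le_lt_trans (potential_integral_le T0)); apply: lte_mul_pinfty => //.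
by rewrite lee_fin divr_ge0 ?sqr_ge0.
Qed.

Lemma dirichlet_radius_le (T b : R) : 0 < T -> 0 <= b < 1 ->
  dirichlet_radius (potential_gradient T) b <= fine (potential_integral T).
Proof.
move=> T0 /andP[]; rewrite le_eqVlt => /predU1P[<- _|b0 b1].
  rewrite /dirichlet_radius set_itv1 Rintegral_set1.
  by rewrite fine_ge0 ?potential_integral_ge0.
rewrite -lee_fin [X in (_ <= X)%E]fineK ?potential_integral_fin// /dirichlet_radius.
have mP : measurable_fun disc (fun p : plane R => modulus (potential_gradient T (to_complex p)) ^+ 2).
  apply: cmeasurable_sqr; apply: cmeasurableM; last exact: cmeasurable_disc (holomorphic_derivative phi_holo).
  apply: cmeasurableM; last by apply: cmeasurableJ; exact: cmeasurable_disc.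
  have mq := cmeasurable_sqr (cmeasurable_disc phi_holo).
  have mu_ := measurable_depth mq.
  split; last exact: measurable_cst.
  apply: measurable_funM; last exact: measurable_cst.
  apply: measurable_funM.
    apply: measurable_funM.
      by apply: measurable_funM; [apply: measurable_funM; [exact: measurable_cst|exact: mu_]|exact: measurable_cst].
    apply: measurable_fun_inv; last by move=> p _; rewrite sqr_ge0.
    by apply: measurable_funX; apply: measurable_funD; [exact: measurable_cst|exact: measurable_funX].
  apply: measurable_fun_inv; first by apply: measurable_funB; [exact: measurable_cst|exact: mq].
  by move=> p /q01 /andP[_ h]; rewrite subr_ge0 ltW.
rewrite -(@disc_integral _ (fun z => modulus (potential_gradient T z) ^+ 2) b 1).
- apply: (@le_trans _ _ (\int[lam]_(p in disc) (modulus (potential_gradient T (to_complex p)) ^+ 2)%:E)%E).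
    apply: ge0_subset_integral.
    + exact: measurable_plane_disc.
    + exact: measurable_disc.
    + by apply/measurable_EFinP; exact: mP.
    + by move=> p _; rewrite lee_fin sqr_ge0.
    + by move=> p /= pb; exact: le_lt_trans b1.
  apply: ge0_integral_monotone => p p1; first by rewrite lee_fin sqr_ge0.
  by rewrite lee_fin potential_gradient_sqr_le.
- by rewrite b0.
- by move=> z _; rewrite sqr_ge0.
- exact: mP.
- move=> z z1; have c : {for (z : R[i]^o), continuous (fun z : R[i]^o => modulus (potential_gradient T z))}.
    apply: (@continuous_comp _ _ _ (potential_gradient T : R[i]^o -> R[i]^o) (modulus : R[i]^o -> R)).
      exact: potential_gradient_continuous.
    exact: continuous_modulus.
  exact: (cvgM c c).
Qed.

(** On the circle of radius [1 / 2] the depth is bounded, so that the cutoff is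
    small there when [T] is large; by [mean_growth] its mean grows from there
    outwards by at most [1 / 32] and a multiple of a Dirichlet integral of order
    [1 / T^2]. *)
Lemma mean_small : exists2 T0 : R, 0 < T0 & forall T b, T0 <= T -> 1 / 2 <= b < 1 ->
  complex.Re (fourier_real (fun t => potential T (polar b t)) 0) <= 1 / 4.
Proof.
have h12 : `|1 / 2| < 1 :> R by rewrite ger0_norm//; lra.
have [U UP] : exists U, forall z, modulus z <= 1 / 2 -> `|depth (q z)| <= U.
  apply: (@disc_bounded _ (fun z => depth (q z))) => z z1; apply: depth_cont.
  by apply: (le_lt_trans z1); lra.
pose J := fine (hyperbolic_integral phi).
have hJ : hyperbolic_integral phi = J%:E.
  rewrite fineK// ge0_fin_numE//; apply: integral_ge0 => p _.
  by rewrite lee_fin; exact: hyperbolic_density_ge0.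
have J0 : 0 <= J.
  by rewrite -lee_fin -hJ; apply: integral_ge0 => p _; rewrite lee_fin; exact: hyperbolic_density_ge0.
pose c := pi^-1 * J; have c0 : 0 <= c by rewrite mulr_ge0 ?invr_ge0 ?pi_ge0.
(* The summand [16 U^2] is for a mean of at most [1 / 16] on the circle of radius
   [1 / 2], the summand [1024 c] for a Dirichlet term of at most [1 / 64]. *)
pose T0 := 1 + 16 * U ^+ 2 + 1024 * c.
have T01 : 1 <= T0 by rewrite /T0; have := sqr_ge0 U; move: (U ^+ 2) c0 => x c0 x0; lra.
exists T0 => [|T b TT b1]; first exact: lt_le_trans ltr01 T01.
have Tp : 0 < T by apply: lt_le_trans TT; exact: lt_le_trans ltr01 T01.
have T2 : 0 < T ^+ 2 by rewrite exprn_gt0.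
have TT2 : T <= T ^+ 2 by rewrite expr2 ler_peMl ?(ltW Tp)// (le_trans T01).
have p0 := pi_gt0 R.
have dW g (t : R) v := @potential_diff T g t v Tp.
have cP (z : R[i]^o) := @potential_gradient_continuous T z Tp.
apply: (le_trans (mean_growth dW cP b1)).
have b01 : 0 <= b < 1 by case/andP : b1 => h ->; rewrite andbT (le_trans _ h)//; lra.
have hb : pi^-1 * dirichlet_radius (potential_gradient T) b <= 1 / 64.
  apply: (@le_trans _ _ (pi^-1 * fine (potential_integral T))).
    by rewrite ler_pM2l ?invr_gt0// dirichlet_radius_le.
  apply: (@le_trans _ _ (pi^-1 * (16 / T ^+ 2 * J))).
    rewrite ler_pM2l ?invr_gt0// -lee_fin fineK ?potential_integral_fin//.
    by rewrite EFinM -hJ potential_integral_le.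
  rewrite mulrCA -/c mulrAC ler_pdivrMr//.
  have : 0 <= U ^+ 2 by exact: sqr_ge0.
  by move: TT; rewrite /T0; lra.
have ha : complex.Re (fourier_real (fun t => potential T (polar (1 / 2) t)) 0) <= 1 / 16.
  rewrite Re_fourier_real ler_pdivrMl ?mulr_gt0//.
  have cW : continuous (fun t => potential T (polar (1 / 2) t)).
    move=> t; have [d _] := dW (polar (1 / 2)) t _ (polar_disc t h12) (curve_derive_arc _ t).
    by apply: differentiable_continuous; apply/derivable1_diffP.
  apply: (le_trans (ler_norm _)).
  have le_pi : - pi <= - pi + 2 * pi :> R by rewrite lerDl pi2_ge0.
  have -> : \int[leb]_(t in `[- pi, - pi + 2 * pi]) (potential T (polar (1 / 2) t) * cos (0%:~R * t)) =
      \int[leb]_(t in `[- pi, - pi + 2 * pi]) potential T (polar (1 / 2) t).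
    by apply: eq_Rintegral => t _; rewrite mul0r cos0 mulr1.
  apply: (le_trans (Rintegral_le_cst (M := 1 / 16) le_pi (fun t _ => cW t) _)).
    move=> t _; rewrite ger0_norm; last exact: cutoff_ge0.
    apply: (le_trans (cutoff_le _ Tp)); rewrite ler_pdivrMr//.
    have zh : modulus (polar (1 / 2) t) <= 1 / 2 by rewrite modulus_polarE ger0_norm.
    have := UP _ zh; rewrite ler_norml -/(q _) => /andP[u1 u2].
    apply: (@le_trans _ _ (U ^+ 2)); first by move: (depth _) u1 u2 => d u1 u2; nra.
    move: TT c0; rewrite /T0; lra.
  by rewrite addrAC subrr add0r mulrC.
move: ha hb; lra.
Qed.

Lemma radius_seq01 n : 0 <= (1 - n.+2%:R^-1 : R) < 1.
Proof.
have n0 : 0 < n.+2%:R :> R by rewrite ltr0Sn.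
rewrite ltrBlDr ltrDl invr_gt0 n0 andbT subr_ge0 invf_le1// ler1n//.
Qed.

Lemma radius_seq_cvg : (fun n => 1 - n.+2%:R^-1 : R) @ \oo --> (1 : R)^'-.
Proof.
have h : (fun n => 1 - n.+2%:R^-1 : R) @ \oo --> (1 : R).
  rewrite -[X in _ --> X]subr0; apply: cvgB; first exact: cvg_cst.
  by have := @cvg_harmonic R; rewrite -(cvg_shiftS (@harmonic R)).
move=> A /= /h; rewrite /nbhs/=; apply: filterS => n; apply.
by case/andP : (radius_seq01 n).
Qed.

(** In the limit [1 - |phi|^2] is at most [1 - s^2], which is less than
    [2 (1 - s)]: the summand [ln 2] of the depth turns this into a depth of at
    least [T]. *)
Lemma near_level (T s : R) zeta : 0 < T -> 0 < s < 1 -> T = - ln (1 - s) -> level_set phi s zeta ->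
  \forall n \near \oo, 1 / 2 <= potential T ((1 - n.+2%:R^-1)%:C%C * zeta).
Proof.
move=> T0 /andP[s0 s1] TE [z1 [w wlim sw]].
pose r (n : nat) : R := 1 - n.+2%:R^-1.
have r_cvg : r n @[n --> \oo] --> (1 : R)^'- by exact: radius_seq_cvg.
have qlim : q ((r n)%:C%C * zeta) @[n --> \oo] --> modulus w ^+ 2.
  have c : modulus (phi ((r n)%:C%C * zeta)) @[n --> \oo] --> modulus w.
    apply: (@cvg_comp _ _ _ (fun n => phi ((r n)%:C%C * zeta) : R[i]^o) (modulus : R[i]^o -> R)); last exact: continuous_modulus.
    exact: (cvg_comp _ _ r_cvg wlim).
  exact: (cvgM c c).
have lt_w : 2 * s - 1 < modulus w ^+ 2.
  apply: (@lt_le_trans _ _ (s ^+ 2)); last by rewrite lerXn2r ?nnegrE ?(ltW s0)// ?modulus_ge0.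
  by rewrite -subr_gt0 (_ : _ - _ = (1 - s) ^+ 2); [rewrite exprn_gt0// subr_gt0|ring].
have /cvgr_gt/(_ _ lt_w) := qlim; apply: filterS => n qn.
have r01 := radius_seq01 n.
have zd : unit_disc R ((r n)%:C%C * zeta).
  by case/andP: r01 => r0 r1; rewrite /unit_disc/= modulusM modulus_real z1 mulr1 ger0_norm.
have /andP[q0 q1] := q01 zd.
apply: cutoff_half; rewrite T0/= TE /depth -/(q _) lerBrDr -lerBrDl opprK.
rewrite -lnM ?posrE ?subr_gt0// ler_ln ?posrE ?subr_gt0 ?mulr_gt0 ?subr_gt0//.
by move: qn; rewrite -/(r n); lra.
Qed.

(** Every measure of finite energy on a closed part of the level set is tested
    against the potential of height [T = - ln (1 - s)]. *)
Lemma capacity_level_le : exists2 T0 : R, 0 < T0 & forall s, 0 < s < 1 -> T0 <= - ln (1 - s) ->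
  (capacity (level_set phi s) <= (64 / pi)%:E * potential_integral (- ln (1 - s)))%E.
Proof.
have [T0 T00 T0P] := mean_small; exists T0 => // s s01 Ts; set T := - ln (1 - s).
have Tp : 0 < T by exact: lt_le_trans Ts.
pose H := pi^-1 * fine (potential_integral T).
have H0 : 0 <= H by rewrite mulr_ge0 ?invr_ge0 ?pi_ge0// fine_ge0 ?potential_integral_ge0.
have -> : ((64 / pi)%:E * potential_integral T = (64 * H)%:E)%E.
  by rewrite -[potential_integral T]fineK ?potential_integral_fin// -EFinM /H mulrA.
apply: ge_ereal_sup => _ [K [cK KE] <-].
have KC : K `<=` unit_circle R by move=> z /KE [].
apply: capacity_closed_le; first by rewrite mulr_ge0.
move=> mu muK I muI; have mC := @measurable_circle R; have mK := measurable_closed_circle cK KC.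
have muC : mu circle = 1%E.
  apply/eqP; rewrite eq_le; apply/andP; split; first exact: probability_le1.
  rewrite -[X in (X <= _)%E](muK : _ = 1%E); apply: le_measure; rewrite ?inE//.
  by move=> p; exact: KC.
have dW g (t : R) v := @potential_diff T g t v Tp.
have cP (z : R[i]^o) := @potential_gradient_continuous T z Tp.
have W0 z : 0 <= potential T z by exact: cutoff_ge0.
have Wm (r : R) := @potential_measurable T r.
apply: (level_test muC muI dW cP W0 Wm cK KC muK).
- by move=> z /KE [zs _]; exact: (near_level Tp s01 erefl zs).
- by move=> b hb; exact: T0P.
- by move=> b hb; rewrite ler_pM2l ?invr_gt0 ?pi_gt0// dirichlet_radius_le.
Qed.

End Potential.

(** * Integration over the levels *)

Section LevelKernel.
Context {R : realType}.
Local Notation leb := (@lebesgue_measure R).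
Implicit Types u s a b : R.

Definition level_depth (s : R) : R := - ln (1 - s).

(** With [T = level_depth s] the factor [T / (1 - s)] is the weight of the level
    [s] in the integral over the levels. *)
Definition level_kernel (u s : R) : R :=
  cutoff_density (level_depth s) u * (level_depth s / (1 - s)).

Lemma level_depth_gt0 s : 0 < s < 1 -> 0 < level_depth s.
Proof.
move=> /andP[s0 s1]; rewrite /level_depth oppr_gt0; apply: ln_lt0.
by rewrite subr_gt0 s1 ltrBlDr ltrDl s0.
Qed.

Lemma is_derive_level_depth s : s < 1 -> is_derive s 1 level_depth (1 - s)^-1.
Proof.
move=> s1; have d1 : is_derive s 1 (fun s : R => 1 - s) (- 1).
  by have := is_deriveB (is_derive_cst (1 : R) s 1) (is_derive_id s 1); rewrite sub0r.
have p1 : 0 < 1 - s by rewrite subr_gt0.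
have d2 := @is_derive1_comp R (@ln R) (fun t => 1 - t) s _ _ (is_derive1_ln p1) d1.
by apply: (is_derive_eq (is_deriveN d2)); rewrite mulrN1 opprK.
Qed.

Lemma level_depth_continuous s : s < 1 -> {for s, continuous level_depth}.
Proof.
by move=> /is_derive_level_depth[d _]; apply/differentiable_continuous/derivable1_diffP.
Qed.

Lemma level_kernel_continuous u s : 0 < u -> s < 1 -> {for s, continuous (level_kernel u)}.
Proof.
move=> u0 s1; have cT := level_depth_continuous s1.
have c2 : {for s, continuous (fun s : R => level_depth s ^+ 2 + u ^+ 2)}.
  apply: cvgD; last exact: cvg_cst.
  exact: (continuous_comp cT (@exprn_continuous R 2 _)).
have c4 : {for s, continuous (fun s : R => (level_depth s ^+ 2 + u ^+ 2) ^+ 4)}.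
  exact: (continuous_comp c2 (@exprn_continuous R 4 _)).
have n4 : (level_depth s ^+ 2 + u ^+ 2) ^+ 4 != 0.
  by rewrite expf_neq0// gt_eqF// ltr_wpDl ?sqr_ge0 ?exprn_gt0.
have ci : {for s, continuous (fun s : R => (1 - s)^-1)}.
  apply: cvgV; first by rewrite subr_eq0 gt_eqF.
  by apply: cvgB; [exact: cvg_cst|exact: cvg_id].
have c5 : {for s, continuous (fun s : R => 16 * u ^+ 2 * level_depth s ^+ 4)}.
  apply: cvgM; first exact: cvg_cst.
  exact: (continuous_comp cT (@exprn_continuous R 4 _)).
exact: (cvgM (cvgM c5 (cvgV n4 c4)) (cvgM cT ci)).
Qed.

(** With [X = T^2 / (T^2 + u^2)] the kernel is the derivative of [8/3 X^3],
    which stays between [0] and [8/3]. *)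
Lemma is_derive_level_kernel u s : 0 < u -> s < 1 ->
  is_derive s 1 (fun s => 8 / 3 * cutoff u (level_depth s) ^+ 3) (level_kernel u s).
Proof.
move=> u0 s1; have dX := is_derive_cutoff u0 (is_derive_level_depth s1).
have d3 := @is_deriveX _ _ (fun s => cutoff u (level_depth s)) 3 s 1 _ dX.
have d := is_deriveZ (8 / 3) d3.
apply: (is_derive_eq d); rewrite /level_kernel /cutoff_density /cutoff /cutoff' /GRing.scale/=.
have m0 : level_depth s ^+ 2 + u ^+ 2 != 0 by rewrite gt_eqF// ltr_wpDl ?sqr_ge0 ?exprn_gt0.
have p0 : 1 - s != 0 by rewrite subr_eq0 gt_eqF.
move: (level_depth s) (1 - s) m0 p0 => T w m0 p0.
rewrite [u ^+ 2 + _]addrC; field; by rewrite ?p0 ?m0.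
Qed.

Lemma level_kernel_ge0 u s : 0 < s < 1 -> 0 <= level_kernel u s.
Proof.
move=> s01; have /andP[_ s1] := s01.
by rewrite mulr_ge0 ?cutoff_density_ge0 ?divr_ge0 ?subr_ge0 ?(ltW s1) ?(ltW (level_depth_gt0 s01)).
Qed.

Lemma level_kernel_measurable u s0 : 0 < u ->
  measurable_fun (`]s0, 1%R[%classic : set (measurableTypeR R)) (level_kernel u).
Proof.
move=> u0; apply: subspace_continuous_measurable_fun; first exact: measurable_itv.
apply: (@continuous_in_subspaceT _ _ `]s0, 1%R[%classic) => x /set_mem; rewrite /= in_itv/= => /andP[_ x1].
exact: level_kernel_continuous.
Qed.

Lemma level_kernel_segment u a b : 0 < u -> 0 < a -> b < 1 ->
  (\int[leb]_(s in `[a, b]) (level_kernel u s)%:E <= (8 / 3)%:E)%E.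
Proof.
move=> u0 a0 b1; have [ab|ba] := leP a b; last first.
  by rewrite set_itv_ge ?bnd_simp -?ltNge// integral_set0 lee_fin.
have c (x : R) : a <= x <= b -> {for x, continuous (level_kernel u)}.
  by move=> /andP[_ xb]; apply: level_kernel_continuous => //; exact: le_lt_trans b1.
have ii : leb.-integrable `[a, b] (EFin \o level_kernel u).
  by apply: segment_integrable => x xab; exact: c.
have F := Rintegral_FTC ab (fun (x : R) (h : a <= x <= b) => is_derive_level_kernel u0 (le_lt_trans (proj2 (andP h)) b1)) c.
have X01 T : 0 <= cutoff u T <= 1.
  rewrite cutoff_ge0 ler_pdivrMr ?mul1r ?lerDr ?sqr_ge0//.
  by rewrite ltr_wpDr ?sqr_ge0 ?exprn_gt0.
have X3 T : 0 <= cutoff u T ^+ 3 <= 1.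
  have /andP[h0 h1] := X01 T; rewrite exprn_ge0//=.
  by rewrite exprn_ile1.
move: F; rewrite /Rintegral => F.
rewrite -[X in (X <= _)%E]fineK; last exact: integrable_fin_num.
rewrite lee_fin F; have := X3 (level_depth a); have := X3 (level_depth b).
move: (cutoff u (level_depth a) ^+ 3) (cutoff u (level_depth b) ^+ 3) => x y; lra.
Qed.

Lemma level_kernel_integral u s0 : 0 < u -> 0 < s0 < 1 ->
  (\int[leb]_(s in `]s0, 1%R[) (level_kernel u s)%:E <= (8 / 3)%:E)%E.
Proof.
move=> u0 /andP[s00 s01].
pose F n : set R := `[s0, (1 - n.+2%:R^-1)%R]%classic.
have lt1 n : 1 - n.+2%:R^-1 < 1 :> R by have /andP[] := @radius_seq01 R n.
have mF n : measurable (F n : set (measurableTypeR R)) by exact: measurable_itv.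
have cF n : measurable_fun (F n : set (measurableTypeR R)) (fun s => (level_kernel u s)%:E).
  apply/measurable_EFinP; apply: subspace_continuous_measurable_fun; first exact: measurable_itv.
  apply: (@continuous_in_subspaceT _ _ (F n)) => x /set_mem; rewrite /F/= in_itv/= => /andP[_ x1].
  by apply: level_kernel_continuous => //; exact: le_lt_trans (lt1 n).
have F0 n (x : measurableTypeR R) : F n x -> (0 <= (level_kernel u x)%:E)%E.
  rewrite /F/= in_itv/= lee_fin => /andP[x0 x1]; apply: level_kernel_ge0.
  by rewrite (lt_le_trans s00 x0) (le_lt_trans x1 (lt1 n)).
have nF : {homo F : n m / (n <= m)%N >-> (n <= m)%O}.
  move=> n m nm; apply/subsetPset => x; rewrite /F/= !in_itv/= => /andP[-> /=] xn.
  apply: (le_trans xn); rewrite lerB// lef_pV2 ?posrE ?ltr0Sn//.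
  by rewrite ler_nat.
have cv := @ge0_nondecreasing_set_cvg_integral _ (measurableTypeR R) _ F (fun s => (level_kernel u s)%:E) leb nF mF cF F0.
apply: (@le_trans _ _ (\int[leb]_(s in \bigcup_n F n) (level_kernel u s)%:E)%E).
  have sub : `]s0, 1%R[%classic `<=` \bigcup_n F n.
    move=> x /=; rewrite in_itv/= => /andP[x0 x1].
    have x1' : (1 : R)^'- [set y | x < y] by exact: nbhs_left_gt.
    have [N _ h] := radius_seq_cvg x1'.
    exists N => //; rewrite /F/= in_itv/= (ltW x0)/=; apply/ltW.
    by apply: (h N) => /=.
  apply: ge0_subset_integral => //.
  - exact: bigcupT_measurable.
  - exact/(measurable_fun_bigcup _ mF).
  - by move=> x [n _ Fx]; exact: F0 Fx.
rewrite -(cvg_lim _ cv)//; apply: lime_le; first by apply/cvg_ex; exists (\int[leb]_(s in \bigcup_n F n) (level_kernel u s)%:E)%E.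
by apply: nearW => n; exact: level_kernel_segment.
Qed.

End LevelKernel.

(** A copy of the planar Lebesgue measure that carries the sigma-finiteness on
    which Tonelli's theorem, for the product of the line and the plane, rests. *)
Definition planar_measure (R : realType) : set (plane R) -> \bar R := @planar_lebesgue R.
HB.instance Definition _ (R : realType) := Measure.copy (@planar_measure R) (@planar_lebesgue R).
Lemma planar_measure_sigma_finite (R : realType) : sigma_finite setT (@planar_measure R).
Proof.
pose I (n : nat) : set (measurableTypeR R) := `[- n%:R, n%:R]%classic.
have mI n : measurable (I n) by exact: measurable_itv.
have nI (x : R) (n : nat) : (Num.bound `|x| <= n)%N -> I n x.
  move=> bn; rewrite /I/= in_itv/= -ler_norml; apply: (le_trans (ltW (archi_boundP (normr_ge0 x)))).
  by rewrite ler_nat.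
exists (fun n => I n `*` I n).
  apply/esym/seteqP; split=> // -[x y] _.
  exists (maxn (Num.bound `|x|) (Num.bound `|y|)) => //; split; apply: nI; [exact: leq_maxl|exact: leq_maxr].
move=> n; split; first exact: measurableX.
rewrite /planar_measure /planar_lebesgue/= product_measure1E//=.
have fI : (lebesgue_measure (I n) < +oo)%E by rewrite /I lebesgue_measure_itv/=; case: ifP => // _; rewrite -EFinB ltry.
by apply: lte_mul_pinfty => //; rewrite ge0_fin_numE.
Qed.
HB.instance Definition _ (R : realType) := Measure_isSigmaFinite.Build _ _ _ (@planar_measure R) (@planar_measure_sigma_finite R).

Section Conclusion.
Context {R : realType}.
Local Notation leb := (@lebesgue_measure R).
Local Notation lam := (@planar_lebesgue R).
Variable phi : R[i] -> R[i].
Hypothesis phi_holo : holomorphic phi.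
Hypothesis phi_self : forall z, unit_disc R z -> unit_disc R (phi z).
Hypothesis hyperbolic_fin : (hyperbolic_integral phi < +oo)%E.

Lemma level_set_decr s t : s <= t -> level_set phi t `<=` level_set phi s.
Proof. by move=> st z [z1 [w cw tw]]; split => //; exists w => //; exact: le_trans tw. Qed.

Lemma capacity_monotone (E F : set R[i]) : E `<=` F -> (capacity E <= capacity F)%E.
Proof.
move=> EF; apply: ge_ereal_sup => _ [K [cK KE] <-]; apply: ereal_sup_ubound.
by exists K => //; split => // z /KE[/EF].
Qed.

Lemma capacity_closed_ge0 (K : set R[i]) : (0 <= capacity_closed K)%E.
Proof.
by rewrite /capacity_closed inve_ge0; apply: le_ereal_inf_tmp => _ [m _ <-]; exact: energy_ge0.
Qed.

Lemma capacity_ge0 (E : set R[i]) : (0 <= capacity E)%E.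
Proof.
apply: (le_trans (capacity_closed_ge0 set0)); apply: ereal_sup_ubound.
by exists set0 => //; split; [exact: closed0|exact: sub0set].
Qed.

(* The integrand of the theorem, with the potential integral in place of the capacity. *)
Let weighted s : \bar R :=
  (\int[lam]_(p in disc) (level_kernel (depth (modulus (phi (to_complex p)) ^+ 2)) s *
     hyperbolic_density phi (to_complex p))%:E)%E.

Let weightedE s : 0 < s < 1 ->
  weighted s = ((level_depth s / (1 - s))%:E * potential_integral phi (level_depth s))%E.
Proof.
move=> s01; have /andP[_ s1] := s01.
rewrite /weighted /potential_integral -ge0_integralZl; first last.
- by rewrite lee_fin divr_ge0 ?subr_ge0 ?(ltW s1) ?(ltW (level_depth_gt0 s01)).
- by move=> p _; rewrite lee_fin mulr_ge0 ?cutoff_density_ge0 ?hyperbolic_density_ge0.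
- apply/measurable_EFinP; apply: measurable_funM; last exact: measurable_hyperbolic_density.
  apply: measurable_cutoff_density; first exact: measurable_cst.
  exact: measurable_depth (cmeasurable_sqr (cmeasurable_disc phi_holo)).
- exact: measurable_disc.
apply: eq_integral => p _; rewrite -EFinM /level_kernel; congr EFin.
by rewrite mulrAC mulrC.
Qed.

Let interval_measurable s0 : measurable (`]s0, 1%R[%classic : set (measurableTypeR R)).
Proof. exact: measurable_itv. Qed.

Let weighted_measurable2 s0 : measurable_fun (`]s0, 1%R[%classic `*` disc : set (measurableTypeR R * plane R))
  (fun x => (level_kernel (depth (modulus (phi (to_complex x.2)) ^+ 2)) x.1 *
     hyperbolic_density phi (to_complex x.2))%:E).
Proof.
pose A : set (measurableTypeR R * plane R) := `]s0, 1%R[%classic `*` disc.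
have mA : measurable A by apply: measurableX => //; exact: measurable_disc.
have m2 (h : plane R -> R) : measurable_fun disc h -> measurable_fun A (fun x => h x.2).
  move=> mh; apply: (@measurable_comp _ _ _ _ _ _ disc) => //; first exact: measurable_disc.
    by move=> _ [x [_ ?] <-].
  exact: measurable_funTS measurable_snd.
have m1 : measurable_fun A (fun x => x.1 : measurableTypeR R) by exact: measurable_funTS measurable_fst.
have mw : measurable_fun A (fun x => 1 - x.1) by apply: measurable_funB; [exact: measurable_cst|exact: m1].
have mT : measurable_fun A (fun x => level_depth x.1).
  rewrite /level_depth; apply: (measurableT_comp (@oppr_measurable R setT)).
  exact: (measurableT_comp (@measurable_ln R) mw).
apply/measurable_EFinP; apply: measurable_funM; last first.
  exact: (m2 (fun p => hyperbolic_density phi (to_complex p)) (measurable_hyperbolic_density phi_holo)).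
apply: measurable_funM.
  apply: measurable_cutoff_density; first exact: mT.
  exact: (m2 _ (measurable_depth (cmeasurable_sqr (cmeasurable_disc phi_holo)))).
apply: measurable_funM; first exact: mT.
apply: measurable_fun_inv; first exact: mw.
by move=> x [/= ]; rewrite in_itv/= subr_ge0 => /andP[_ /ltW].
Qed.

Let weighted_ge0 s0 (x : measurableTypeR R * plane R) : 0 < s0 -> `]s0, 1%R[%classic x.1 -> disc x.2 ->
  (0 <= (level_kernel (depth (modulus (phi (to_complex x.2)) ^+ 2)) x.1 *
     hyperbolic_density phi (to_complex x.2))%:E)%E.
Proof.
move=> s00 /=; rewrite in_itv/= => /andP[x0 x1] _.
by rewrite lee_fin mulr_ge0 ?hyperbolic_density_ge0 ?level_kernel_ge0 ?(lt_trans s00 x0).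
Qed.

(** By Tonelli's theorem the levels are integrated out first. *)
Lemma weighted_integral_lty s0 : 0 < s0 < 1 ->
  (\int[leb]_(s in `]s0, 1%R[) weighted s < +oo)%E.
Proof.
move=> s01; have /andP[s00 s0lt1] := s01.
have tn : (\int[leb]_(s in `]s0, 1%R[) weighted s =
    \int[lam]_(p in disc) \int[leb]_(s in `]s0, 1%R[)
      (level_kernel (depth (modulus (phi (to_complex p)) ^+ 2)) s * hyperbolic_density phi (to_complex p))%:E)%E.
  exact: (@tonelli_rect _ _ (measurableTypeR R) (plane R) R leb (@planar_measure R)
    _ _ _ (@interval_measurable s0) measurable_disc (@weighted_measurable2 s0)
    (fun x hx1 hx2 => weighted_ge0 s00 hx1 hx2)).
rewrite tn.
apply: (@le_lt_trans _ _ ((8 / 3)%:E * hyperbolic_integral phi)%E); last first.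
  by apply: lte_mul_pinfty.
rewrite /hyperbolic_integral -ge0_integralZl; first last.
- by rewrite lee_fin.
- by move=> p _; rewrite lee_fin; exact: (hyperbolic_density_ge0 phi).
- by apply/measurable_EFinP; exact: (measurable_hyperbolic_density phi_holo).
- exact: measurable_disc.
apply: ge0_integral_monotone => p p1.
  by apply: integral_ge0 => s sI; exact: (weighted_ge0 (x := (s, p)) s00 sI p1).
have u0 : 0 < depth (modulus (phi (to_complex p)) ^+ 2).
  by apply: depth_gt0; rewrite sqr_ge0/= expr_lt1 ?modulus_ge0//; exact: phi_self.
rewrite [leLHS](_ : _ = (\int[leb]_(s in `]s0, 1%R[)
    ((hyperbolic_density phi (to_complex p))%:E * (level_kernel (depth (modulus (phi (to_complex p)) ^+ 2)) s)%:E))%E).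
  rewrite ge0_integralZl; first last.
  - by rewrite lee_fin hyperbolic_density_ge0.
  - by move=> s /=; rewrite in_itv/= lee_fin => /andP[h0 h1]; apply: level_kernel_ge0; rewrite (lt_trans s00 h0).
  - by apply/measurable_EFinP; exact: level_kernel_measurable.
  - exact: interval_measurable.
  rewrite muleC; apply: lee_wpmul2r; first by rewrite lee_fin hyperbolic_density_ge0.
  exact: level_kernel_integral.
by apply: eq_integral => s _; rewrite -EFinM mulrC.
Qed.

(** Where [level_depth s] is at least the threshold [T0] the capacity is bounded
    by the potential integral; on the remaining interval it is at most the
    capacity at [s0], and the weight is bounded. *)
Lemma capacity_integral_lty s0 : 0 < s0 < 1 -> (capacity (level_set phi s0) < +oo)%E ->
  (\int[leb]_(s in `]s0, 1%R[)
     (capacity (level_set phi s) / (1 - s)%:E * (ln (1 / (1 - s)))%:E) < +oo)%E.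
Proof.
move=> s01 cfin; have /andP[s00 s0lt1] := s01.
have [T0 T00 T0P] := capacity_level_le phi_holo phi_self hyperbolic_fin.
(* At the threshold [level_depth s = T0] the weight is [T0 / exp (- T0)]. *)
pose c : \bar R := (capacity (level_set phi s0) * (T0 / expR (- T0))%:E)%E.
have c0 : (0 <= c)%E by rewrite mule_ge0 ?capacity_ge0// lee_fin divr_ge0 ?expR_ge0 ?(ltW T00).
have cy : (c < +oo)%E.
  by rewrite /c -(@fineK _ (capacity (level_set phi s0))) ?ge0_fin_numE ?capacity_ge0// -EFinM ltry.
pose g (s : R) : \bar R := ((64 / pi)%:E * weighted s)%E.
have k0 : 0 <= 64 / pi :> R by rewrite divr_ge0 ?pi_ge0.
have w0 s : `]s0, 1%R[%classic s -> (0 <= weighted s)%E.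
  move=> sI; apply: integral_ge0 => p p1; exact: (weighted_ge0 (x := (s, p)) s00 sI p1).
have mw : measurable_fun (`]s0, 1%R[%classic : set (measurableTypeR R)) weighted.
  exact: (@measurable_inner_integral _ _ (measurableTypeR R) (plane R) R (@planar_measure R)
    _ _ _ (@interval_measurable s0) measurable_disc (@weighted_measurable2 s0)
    (fun x hx1 hx2 => weighted_ge0 s00 hx1 hx2)).
apply: (@le_lt_trans _ _ (\int[leb]_(s in `]s0, 1%R[) (c + g s))%E).
  apply: ge0_integral_monotone => s sI; move: (sI); rewrite /= in_itv/= => /andP[ss0 s1].
    have s01' : 0 < s < 1 by rewrite (lt_trans s00 ss0).
    rewrite inver gt_eqF ?subr_gt0// -muleA -EFinM mule_ge0 ?capacity_ge0// lee_fin.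
    rewrite div1r lnV ?posrE ?subr_gt0// mulrC divr_ge0 ?subr_ge0 ?(ltW s1)//.
    exact/ltW/(level_depth_gt0 s01').
  have s01' : 0 < s < 1 by rewrite (lt_trans s00 ss0).
  have T_gt0 := level_depth_gt0 s01'; have w_gt0 : 0 < 1 - s by rewrite subr_gt0.
  have -> : (capacity (level_set phi s) / (1 - s)%:E * (ln (1 / (1 - s)))%:E =
      (level_depth s / (1 - s))%:E * capacity (level_set phi s))%E.
    by rewrite inver gt_eqF// -muleA -EFinM muleC div1r lnV ?posrE// mulrC.
  have d0 : (0 <= (level_depth s / (1 - s))%:E)%E by rewrite lee_fin divr_ge0 ?(ltW T_gt0) ?(ltW w_gt0).
  have [Ts|Ts] := leP T0 (level_depth s).
    rewrite -[leLHS]add0e; apply: leeD; first exact: c0.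
    rewrite /g (weightedE s01') muleCA; apply: lee_wpmul2l; first exact: d0.
    exact: T0P.
  rewrite -[leLHS]adde0; apply: leeD; last by rewrite mule_ge0 ?lee_fin// w0.
  rewrite /c muleC; apply: lee_pmul.
  - exact: capacity_ge0.
  - exact: d0.
  - exact: capacity_monotone (level_set_decr (ltW ss0)).
  rewrite lee_fin ler_pM ?invr_ge0 ?(ltW T_gt0) ?(ltW w_gt0) ?(ltW Ts)//.
  rewrite lef_pV2 ?posrE ?expR_gt0// -[leRHS](lnK (x := 1 - s)) ?posrE// ler_expR.
  by rewrite lerNl ltW.
rewrite ge0_integralD; first last.
- by apply: measurable_funeM; exact: mw.
- by move=> s sI; rewrite mule_ge0 ?lee_fin// w0.
- exact: measurable_cst.
- by move=> s _.
- exact: interval_measurable.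
apply: lte_add_pinfty.
  rewrite integral_cst; last exact: interval_measurable.
  rewrite [X in (_ * X)%E](_ : _ = (1 - s0)%:E); last first.
    by have := @lebesgue_measure_itv R `]s0, 1[; rewrite /= lte_fin s0lt1 -EFinB.
  by rewrite -/c -(@fineK _ c) ?ge0_fin_numE// -EFinM ltry.
rewrite /g ge0_integralZl//.
- by apply: lte_mul_pinfty; rewrite ?lee_fin// weighted_integral_lty.
Qed.

(** At the level [1 - exp (- T0)] the height is exactly the threshold [T0] of
    [capacity_level_le]. *)
Lemma capacity_level_lty : exists2 s0 : R, 0 < s0 < 1 & (capacity (level_set phi s0) < +oo)%E.
Proof.
have [T0 T00 T0P] := capacity_level_le phi_holo phi_self hyperbolic_fin.
have s01 : 0 < 1 - expR (- T0) < 1.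
  by rewrite subr_gt0 expR_lt1 oppr_lt0 T00/= ltrBlDr ltrDl expR_gt0.
exists (1 - expR (- T0)) => //.
have TE : - ln (1 - (1 - expR (- T0))) = T0 by rewrite opprB addrC subrK expRK opprK.
apply: (@le_lt_trans _ _ ((64 / pi)%:E * potential_integral phi T0)%E).
  by rewrite -[X in potential_integral _ X]TE; apply: T0P => //; rewrite TE.
by rewrite -(fineK (potential_integral_fin phi_holo hyperbolic_fin T00)) -EFinM ltry.
Qed.

End Conclusion.

Theorem theorem3p4 (R : realType) (phi : R[i] -> R[i])
    (phi_holo : holomorphic phi)
    (phi_self : forall z, unit_disc R z -> unit_disc R (phi z))
    (phi_HS : hilbert_schmidt (composition_operator phi)) :
  (exists2 s0 : R, 0 < s0 < 1 & (capacity (level_set phi s0) < +oo)%E) /\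
  (forall s0 : R, 0 < s0 < 1 -> (capacity (level_set phi s0) < +oo)%E ->
    (\int[@lebesgue_measure R]_(s in `]s0, 1%R[)
       (capacity (level_set phi s) / (1 - s)%:E * (ln (1 / (1 - s)))%:E)
     < +oo)%E).
Proof.
have J := hyperbolic_integral_lty phi_holo phi_self phi_HS.
by split; [exact: capacity_level_lty|exact: capacity_integral_lty].
Qed.
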